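(* Let $0<a<b<\infty$ and $\Omega_{a,b}=\{x\in\mathbb{R}^2: a<|x|<b\}$. Let $v=(v_1,v_2)\in C^2(\overline{\Omega_{a,b}})$ be a flow solving the steady Euler equations $$v\cdot\nabla v+\nabla p=0\ \text{ and }\ \mathrm{div}\,v=0\ \text{ in }\Omega_{a,b}$$ (for some pressure $p$), with the boundary conditions $v\cdot e_r=0$ on $C_a$ and on $C_b$, and such that $|v|>0$ in $\overline{\Omega_{a,b}}$. Then $v$ is a circular flow, and there is a $C^2([a,b])$ function $V$ with constant strict sign (that is, $V>0$ on all of $[a,b]$ or $V<0$ on all of $[a,b]$) such that $$v(x)=V(|x|)\,e_\theta(x)\ \text{ for all }x\in\overline{\Omega_{a,b}}.$$
   Context: $|\cdot|$ is the Euclidean norm in $\mathbb{R}^2$; $C_r=\{x\in\mathbb{R}^2:|x|=r\}$. For $x=(x_1,x_2)\neq0$, $e_r(x)=x/|x|$ and $e_\theta(x)=(-x_2/|x|,x_1/|x|)$. Solutions $(v,p)$ of the Euler equations are understood in the classical sense: $v$ and $p$ are (at least) of class $C^1$ in the open domain and the equations hold at every point. A flow $v$ in $\Omega_{a,b}$ is called circular if $v(x)$ is parallel to $e_\theta(x)$ at every $x\in\Omega_{a,b}$, i.e. $v\cdot e_r=0$ in $\Omega_{a,b}$. *)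

(* Defs.v *)
From Stdlib Require Import Reals.
From Coquelicot Require Import Coquelicot.

Open Scope R_scope.

(* Coquelicot's [norm] on the product [R * R] is the Euclidean norm. *)
Lemma norm_plane (x : R * R) : norm x = sqrt (fst x ^ 2 + snd x ^ 2).
Proof.
  change (sqrt (Rabs (fst x) ^ 2 + Rabs (snd x) ^ 2)
          = sqrt (fst x ^ 2 + snd x ^ 2)).
  now rewrite !pow2_abs.
Qed.

Definition dot (x y : R * R) : R := fst x * fst y + snd x * snd y.

Definition e_r (x : R * R) : R * R := (fst x / norm x, snd x / norm x).

Definition e_theta (x : R * R) : R * R := (- snd x / norm x, fst x / norm x).

Definition annulus (a b : R) (x : R * R) : Prop := a < norm x < b.

Definition closed_annulus (a b : R) (x : R * R) : Prop := a <= norm x <= b.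

Definition circle (r : R) (x : R * R) : Prop := norm x = r.

(* [Ck Om K k f], for an open set [Om] and [Om <= K <= closure of Om]:
   [f] is continuous on [K], it is [k] times continuously differentiable in
   [Om], and its partial derivatives up to order [k] extend continuously to [K]
   (the functions [g1], [g2] are these extensions).  Thus
   [Ck Om Om k] is C^k(Om) and [Ck Om (closure of Om) k] is C^k(closure of Om). *)
Fixpoint Ck (Om K : R * R -> Prop) (k : nat) (f : R * R -> R) : Prop :=
  match k with
  | O => continuous_on K f
  | S k' =>
      continuous_on K f /\
      exists g1 g2 : R * R -> R,
        (forall x : R * R, Om x ->
           is_derive (fun t : R => f (t, snd x)) (fst x) (g1 x) /\
           is_derive (fun t : R => f (fst x, t)) (snd x) (g2 x)) /\
        Ck Om K k' g1 /\ Ck Om K k' g2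
  end.

Definition Ck_vec (Om K : R * R -> Prop) (k : nat) (v : R * R -> R * R) : Prop :=
  Ck Om K k (fun x => fst (v x)) /\ Ck Om K k (fun x => snd (v x)).

(* One-dimensional analogue: C^k([a,b]), with derivatives taken in (a,b) and
   extended continuously to [a,b]. *)
Fixpoint Ck_segment (a b : R) (k : nat) (f : R -> R) : Prop :=
  match k with
  | O => continuous_on (fun r => a <= r <= b) f
  | S k' =>
      continuous_on (fun r => a <= r <= b) f /\
      exists g : R -> R,
        (forall r : R, a < r < b -> is_derive f r (g r)) /\
        Ck_segment a b k' g
  end.

Definition d1 (f : R * R -> R) (x : R * R) : R :=
  Derive (fun t : R => f (t, snd x)) (fst x).

Definition d2 (f : R * R -> R) (x : R * R) : R :=
  Derive (fun t : R => f (fst x, t)) (snd x).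

Definition grad (f : R * R -> R) (x : R * R) : R * R := (d1 f x, d2 f x).

Definition div (v : R * R -> R * R) (x : R * R) : R :=
  d1 (fun y => fst (v y)) x + d2 (fun y => snd (v y)) x.

(* v . grad v *)
Definition convection (v : R * R -> R * R) (x : R * R) : R * R :=
  (dot (v x) (grad (fun y => fst (v y)) x),
   dot (v x) (grad (fun y => snd (v y)) x)).

Definition steady_euler (Om : R * R -> Prop)
    (v : R * R -> R * R) (p : R * R -> R) : Prop :=
  Ck_vec Om Om 1 v /\ Ck Om Om 1 p /\
  forall x : R * R, Om x ->
    plus (convection v x) (grad p x) = zero /\ div v x = 0.

Definition circular (Om : R * R -> Prop) (v : R * R -> R * R) : Prop :=
  forall x : R * R, Om x -> dot (v x) (e_r x) = 0.

(* Main.v *)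
(** The stream function [u] (with gradient [(v2, - v1)]) is constant on each
    boundary circle and has no critical point, so it lies strictly between its two
    boundary values.  By Euler's equations the gradient of the vorticity
    [Delta u] is parallel to that of [u].  In the universal cover of the annulus,
    the level sets of [u] are connected: chains of nearby points of one level set
    can be refined, and can be pushed to nearby levels along the gradient, starting
    from the inner circle.  Hence the vorticity is a Lipschitz function of [u].
    Say [u] increases outwards.  Then the method of moving planes reaches every line
    through the origin without any Neumann condition: a reflected point that meets
    the inner circle takes the least value of [u], and at points of the reflection
    axis lying on the boundary the derivative has a sign because [u] has no critical
    point.  So [u] is radial. *)

Require Import Defs.
From Stdlib Require Import Reals Lra Classical IndefiniteDescription.
From Coquelicot Require Import Coquelicot.

Open Scope R_scope.

(** * Compactness and mean values in the plane *)

(** Neither regular parametrisations of level curves nor a function f with Delta u = f(u) are at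
    hand. Polar coordinates turn the annulus into the convex strip [a,b] x R, where a first-order
    Taylor bound with quadratic remainder, valid up to the boundary lines, does all the work. With L
    for the remainder, M above the gradient and m below its square, a point can be moved to any
    level at distance m^2 / (16 L M^2), and two points of one level at distance m / (64 L M) can be
    joined by a Lipschitz curve inside it. Finite chains thus replace both connectedness and the
    gradient flow. Moving planes needs only |Delta u(x') - Delta u(x)| <= K |u(x') - u(x)|: the
    difference w between u and its reflection then satisfies Delta w <= K w wherever w >= 0, and
    this linear inequality is enough for Hopf's barrier. Each reflection gives a one-sided
    comparison of two angles on a circle; comparing s with s' and then s' with s + 2 PI turns it
    into equality. The stream function is built by integration along rays, each started at value 0
    on the inner circle. This is consistent because the field (v2, - v1) is normal to that circle,
    so its circulation there vanishes. *)

Definition clamp (a b x : R) : R := Rmax a (Rmin b x).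

Lemma clamp_id (a b x : R) : a <= x <= b -> clamp a b x = x.
Proof. intros H. unfold clamp, Rmax, Rmin. repeat destruct (Rle_dec _ _); lra. Qed.

Lemma clamp_in (a b x : R) : a <= b -> a <= clamp a b x <= b.
Proof. intros H. unfold clamp, Rmax, Rmin. repeat destruct (Rle_dec _ _); lra. Qed.

Lemma clamp_lipschitz (a b x y : R) : Rabs (clamp a b x - clamp a b y) <= Rabs (x - y).
Proof.
  unfold clamp, Rmax, Rmin, Rabs.
  repeat destruct (Rle_dec _ _); repeat destruct (Rcase_abs _); lra.
Qed.

Lemma Rabs_self_lt (x d : R) : 0 < d -> Rabs (x - x) < d.
Proof. now rewrite Rminus_diag, Rabs_R0. Qed.

Lemma disk_coordinates (x y r : R) : 0 <= r -> x ^ 2 + y ^ 2 <= r ^ 2 -> Rabs x <= r /\ Rabs y <= r.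
Proof.
  intros Hr H. pose proof (pow2_ge_0 x). pose proof (pow2_ge_0 y).
  rewrite <- (Rabs_pos_eq r Hr). split; apply Rsqr_le_abs_0; rewrite !Rsqr_pow2; lra.
Qed.

(** [compactness_value_2d] provides one e such that each point lies in the ball of a tag whose gauge
    is at least e; monotonicity then passes from the gauge to e. Gauges come from
    [functional_choice], with the dummy value 1 outside the rectangle. *)
Lemma local_to_uniform_2d (a b c d : R) (P : R -> R -> R -> Prop) :
  (forall e e' x y : R, e' <= e -> P e x y -> P e' x y) ->
  (forall x y : R, a <= x <= b -> c <= y <= d ->
     exists e : R, 0 < e /\
       forall u v : R, Rabs (u - x) < e -> Rabs (v - y) < e -> P e u v) ->
  exists e : R, 0 < e /\ forall x y : R, a <= x <= b -> c <= y <= d -> P e x y.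
Proof.
  intros Hmon Hloc.
  assert (H : forall p : R * R, exists e : posreal,
    a <= fst p <= b -> c <= snd p <= d ->
    forall u v : R, Rabs (u - fst p) < e -> Rabs (v - snd p) < e -> P e u v).
  { intros [x y]; simpl.
    destruct (classic (a <= x <= b /\ c <= y <= d)) as [[Hx Hy]|Hn].
    - destruct (Hloc x y Hx Hy) as (e & He & Hp).
      exists (mkposreal e He); simpl; intros _ _; exact Hp.
    - exists (mkposreal 1 Rlt_0_1); intros Hx Hy; exfalso; tauto. }
  apply functional_choice in H. destruct H as [f Hf].
  destruct (compactness_value_2d a b c d (fun x y => f (x, y))) as [e He].
  exists e. split; [apply cond_pos|].
  intros x y Hx Hy.
  destruct (NNPP _ (He x y Hx Hy)) as (u & v & Hu & Hv & Hxu & Hyv & Hle).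
  apply (Hmon (f (u, v)) e); [exact Hle|].
  exact (Hf (u, v) Hu Hv x y Hxu Hyv).
Qed.

Definition continuous_2d_on (K : R -> R -> Prop) (f : R -> R -> R) : Prop :=
  forall x y : R, K x y -> forall eps : R, 0 < eps ->
  exists d : R, 0 < d /\ forall u v : R, K u v ->
    Rabs (u - x) < d -> Rabs (v - y) < d -> Rabs (f u v - f x y) < eps.

Definition compact_2d (K : R -> R -> Prop) : Prop :=
  (exists M : R, forall x y : R, K x y -> -M <= x <= M /\ -M <= y <= M) /\
  (forall x y : R, ~ K x y -> exists d : R, 0 < d /\
     forall u v : R, Rabs (u - x) < d -> Rabs (v - y) < d -> ~ K u v).

Lemma compact_local_to_uniform (K : R -> R -> Prop) (P : R -> R -> R -> Prop) :
  compact_2d K ->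
  (forall e e' x y : R, e' <= e -> P e x y -> P e' x y) ->
  (forall x y : R, K x y ->
     exists e : R, 0 < e /\ forall u v : R, K u v ->
       Rabs (u - x) < e -> Rabs (v - y) < e -> P e u v) ->
  exists e : R, 0 < e /\ forall x y : R, K x y -> P e x y.
Proof.
  intros [[M HM] HK] Hmon Hloc.
  destruct (local_to_uniform_2d (-M) M (-M) M (fun e x y => K x y -> P e x y))
    as (e & He & H).
  - intros e e' x y Hle H Hk. exact (Hmon e e' x y Hle (H Hk)).
  - intros x y _ _. destruct (classic (K x y)) as [Hk|Hk].
    + destruct (Hloc x y Hk) as (e & He & H). exists e. split; [exact He|].
      intros u v Hu Hv Hk'. now apply H.
    + destruct (HK x y Hk) as (e & He & H). exists e. split; [exact He|].
      intros u v Hu Hv Hk'. exfalso. exact (H u v Hu Hv Hk').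
  - exists e. split; [exact He|]. intros x y Hk.
    destruct (HM x y Hk). now apply H.
Qed.

(** The local property made uniform is Rabs (f x y) * e <= 1, which turns e into the bound / e. *)
Lemma compact_bounded (K : R -> R -> Prop) (f : R -> R -> R) :
  compact_2d K -> continuous_2d_on K f ->
  exists M : R, 0 < M /\ forall x y : R, K x y -> Rabs (f x y) <= M.
Proof.
  intros HK Hf.
  destruct (compact_local_to_uniform K (fun e x y => Rabs (f x y) * e <= 1) HK)
    as (e & He & H).
  - intros e e' x y Hle H. pose proof (Rabs_pos (f x y)). nra.
  - intros x y Hk. destruct (Hf x y Hk 1 Rlt_0_1) as (d & Hd & H).
    pose proof (Rabs_pos (f x y)) as Hp.
    assert (Hi : 0 < / (Rabs (f x y) + 1)) by (apply Rinv_0_lt_compat; lra).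
    exists (Rmin d (/ (Rabs (f x y) + 1))). split; [now apply Rmin_glb_lt|].
    intros u v Huv Hu Hv.
    pose proof (Rmin_l d (/ (Rabs (f x y) + 1))).
    pose proof (Rmin_r d (/ (Rabs (f x y) + 1))).
    assert (Hb : Rabs (f u v) <= Rabs (f x y) + 1).
    { pose proof (H u v Huv ltac:(lra) ltac:(lra)).
      pose proof (Rabs_triang_inv (f u v) (f x y)). lra. }
    assert (0 <= Rabs (f u v)) by apply Rabs_pos.
    assert ((Rabs (f x y) + 1) * / (Rabs (f x y) + 1) = 1) by (field; lra).
    apply Rle_trans with ((Rabs (f x y) + 1) * / (Rabs (f x y) + 1)); [|lra].
    apply Rmult_le_compat; try lra.
    apply Rmin_glb; lra.
  - exists (/ e). split; [now apply Rinv_0_lt_compat|].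
    intros x y Hk. pose proof (H x y Hk).
    apply Rmult_le_reg_r with e; [exact He|]. rewrite Rinv_l; lra.
Qed.

(** If the infimum - m is not attained, compactness improves - m < f to - m + e <= f, against the
    choice of m as the supremum of - f. *)
Lemma compact_min (K : R -> R -> Prop) (f : R -> R -> R) :
  compact_2d K -> continuous_2d_on K f -> (exists x y : R, K x y) ->
  exists x y : R, K x y /\ forall u v : R, K u v -> f x y <= f u v.
Proof.
  intros HK Hf (x0 & y0 & H0).
  destruct (compact_bounded K f HK Hf) as (M & _ & HM).
  destruct (completeness (fun z => exists x y, K x y /\ z = - f x y)) as [m [Hub Hlub]].
  - exists M. intros z (x & y & Hk & ->). pose proof (HM x y Hk).
    pose proof (Rle_abs (- f x y)). rewrite Rabs_Ropp in *. lra.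
  - exists (- f x0 y0), x0, y0. now split.
  - apply NNPP. intros Hn.
    assert (Hlt : forall x y, K x y -> - m < f x y).
    { intros x y Hk. assert (- f x y <= m) by (apply Hub; now exists x, y).
      destruct (Req_dec (- f x y) m) as [He|He]; [|lra].
      exfalso. apply Hn. exists x, y. split; [exact Hk|]. intros u v Huv.
      assert (- f u v <= m) by (apply Hub; now exists u, v). lra. }
    destruct (compact_local_to_uniform K (fun e x y => - m + e <= f x y) HK)
      as (e & He & H).
    + intros; lra.
    + intros x y Hk. pose proof (Hlt x y Hk).
      destruct (Hf x y Hk ((f x y + m) / 2) ltac:(lra)) as (d & Hd & Hc).
      exists (Rmin d ((f x y + m) / 2)). split; [apply Rmin_glb_lt; lra|].
      intros u v Huv Hu Hv.
      pose proof (Rmin_l d ((f x y + m) / 2)). pose proof (Rmin_r d ((f x y + m) / 2)).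
      pose proof (Hc u v Huv ltac:(lra) ltac:(lra)) as Ha.
      apply Rabs_def2 in Ha. lra.
    + assert (m <= m - e); [|lra].
      apply Hlub. intros z (x & y & Hk & ->). pose proof (H x y Hk). lra.
Qed.

(* Continuity at the end points is one-sided, as the functions of interest are only controlled on a closed annulus. *)
Lemma MVT_within (f df : R -> R) (a b : R) :
  a < b ->
  (forall x : R, a < x < b -> is_derive f x (df x)) ->
  (forall x : R, x = a \/ x = b -> forall eps : R, 0 < eps -> exists d : R, 0 < d /\
     forall y : R, a <= y <= b -> Rabs (y - x) < d -> Rabs (f y - f x) < eps) ->
  exists c : R, a < c < b /\ f b - f a = df c * (b - a).
Proof.
  intros Hab Hd Hc.
  (* Composing with [clamp] turns one-sided continuity at a and b into the two-sided continuity that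
     [MVT] asks for. *)
  set (g := fun x => f (clamp a b x)).
  assert (Hg : forall x, a < x < b -> derivable_pt_lim g x (df x)).
  { intros x Hx. apply is_derive_Reals.
    apply is_derive_ext_loc with f; [|now apply Hd].
    assert (He : 0 < Rmin (x - a) (b - x)) by (apply Rmin_glb_lt; lra).
    exists (mkposreal _ He). intros y Hy.
    apply Rabs_def2 in Hy. simpl in Hy. unfold minus, plus, opp in Hy; simpl in Hy.
    pose proof (Rmin_l (x - a) (b - x)). pose proof (Rmin_r (x - a) (b - x)).
    unfold g. rewrite clamp_id; [reflexivity|lra]. }
  assert (Hcont : forall x, a <= x <= b -> continuity_pt g x).
  { intros x Hx. destruct (Req_dec x a) as [Hxa|Hxa]; [|destruct (Req_dec x b) as [Hxb|Hxb]].
    3:{ apply derivable_continuous_pt. exists (df x). apply Hg. lra. }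
    all: intros eps He; destruct (Hc x ltac:(tauto) eps He) as (d & Hdp & H);
      exists d; split; [exact Hdp|]; intros y [_ Hy]; simpl in *; unfold Rdist in *;
      unfold g; rewrite (clamp_id a b x) by lra; apply H; [apply clamp_in; lra|];
      rewrite <- (clamp_id a b x) at 1 by lra;
      apply Rle_lt_trans with (2 := Hy), clamp_lipschitz. }
  destruct (MVT g id a b (fun c Hc' => exist _ (df c) (Hg c Hc'))
              (fun c _ => derivable_pt_id c) Hab Hcont) as (c & Hc' & He).
  { intros c _. apply derivable_continuous_pt, derivable_pt_id. }
  exists c. split; [exact Hc'|].
  rewrite derive_pt_id in He. simpl in He. unfold id, g in He.
  rewrite !clamp_id in He by lra. lra.
Qed.

(** The zero slope is expressed by increments because the function will be [W] along a curve that is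
    only known to be Lipschitz. *)
Lemma zero_slope_constant (phi : R -> R) :
  (forall s : R, 0 <= s <= 1 -> forall eps : R, 0 < eps -> exists d : R, 0 < d /\
     forall s' : R, 0 <= s' <= 1 -> Rabs (s' - s) < d ->
       Rabs (phi s' - phi s) <= eps * Rabs (s' - s)) ->
  phi 0 = phi 1.
Proof.
  intros H.
  destruct (MVT_within phi (fun _ => 0) 0 1 Rlt_0_1) as (c & _ & Hc).
  - intros s Hs. apply is_derive_Reals. intros eps He.
    destruct (H s ltac:(lra) (eps / 2) ltac:(lra)) as (d & Hd & Hs').
    assert (Hm : 0 < Rmin d (Rmin s (1 - s))) by (repeat apply Rmin_glb_lt; lra).
    exists (mkposreal _ Hm). intros h Hh Hhd. simpl in Hhd.
    pose proof (Rmin_l d (Rmin s (1 - s))). pose proof (Rmin_r d (Rmin s (1 - s))).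
    pose proof (Rmin_l s (1 - s)). pose proof (Rmin_r s (1 - s)).
    apply Rabs_def2 in Hhd as Hh2.
    specialize (Hs' (s + h) ltac:(lra)). replace (s + h - s) with h in Hs' by ring.
    specialize (Hs' ltac:(lra)).
    pose proof (Rabs_pos_lt h Hh).
    rewrite Rminus_0_r. unfold Rdiv. rewrite Rabs_mult, Rabs_inv.
    apply Rmult_lt_reg_r with (Rabs h); [assumption|].
    rewrite Rmult_assoc, Rinv_l by lra. nra.
  - intros s Hs eps He.
    destruct (H s ltac:(destruct Hs; lra) 1 Rlt_0_1) as (d & Hd & Hs').
    exists (Rmin d eps). split; [now apply Rmin_glb_lt|].
    intros y Hy Hys. pose proof (Rmin_l d eps). pose proof (Rmin_r d eps).
    specialize (Hs' y Hy ltac:(lra)). lra.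
  - lra.
Qed.

(** If l were negative, f1 would be negative just to the right of x, and by the mean value theorem f
    would drop below its minimum. *)
Lemma second_derivative_at_min (f f1 : R -> R) (x l : R) :
  locally x (fun t => is_derive f t (f1 t)) -> is_derive f1 x l ->
  locally x (fun t => f x <= f t) -> f1 x = 0 /\ 0 <= l.
Proof.
  intros [d1 H1] H2 [d2 H3].
  assert (Hball : forall (e : posreal) t, Rabs (t - x) < e -> ball x e t).
  { intros e t Ht. exact Ht. }
  assert (Hx : is_derive f x (f1 x)) by (apply H1, ball_center).
  assert (Hz : f1 x = 0).
  { apply is_derive_Reals in Hx.
    set (pr := exist _ (f1 x) Hx : derivable_pt f x).
    change (f1 x) with (derive_pt f x pr).
    apply deriv_minimum with (x - d2) (x + d2);
      try (pose proof (cond_pos d2); lra).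
    intros t Ht1 Ht2. apply H3, Hball, Rabs_def1; lra. }
  split; [exact Hz|].
  apply Rnot_lt_le. intros Hl. apply is_derive_Reals in H2.
  destruct (H2 (- l / 2) ltac:(lra)) as [d3 Hd3].
  set (d := Rmin d1 (Rmin d2 d3) / 2).
  assert (Hd : 0 < d /\ d < d1 /\ d < d2 /\ d < d3).
  { unfold d. pose proof (cond_pos d1). pose proof (cond_pos d2). pose proof (cond_pos d3).
    pose proof (Rmin_l d1 (Rmin d2 d3)). pose proof (Rmin_r d1 (Rmin d2 d3)).
    pose proof (Rmin_l d2 d3). pose proof (Rmin_r d2 d3).
    assert (0 < Rmin d1 (Rmin d2 d3)) by (repeat apply Rmin_glb_lt; lra). lra. }
  assert (Hder : forall t, x <= t <= x + d -> is_derive f t (f1 t)).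
  { intros t Ht. apply H1, Hball, Rabs_def1; lra. }
  destruct (MVT_cor2 f f1 x (x + d) ltac:(lra)) as (c & Hc & Hcd).
  { intros t Ht. now apply is_derive_Reals, Hder. }
  assert (Hm : f x <= f (x + d)) by (apply H3, Hball, Rabs_def1; lra).
  specialize (Hd3 (c - x) ltac:(lra) ltac:(apply Rabs_def1; lra)).
  replace (x + (c - x)) with c in Hd3 by ring. rewrite Hz in Hd3.
  apply Rabs_def2 in Hd3.
  assert (Hq : (f1 c - 0) / (c - x) < 0) by lra.
  assert (f1 c < 0).
  { replace (f1 c) with ((f1 c - 0) / (c - x) * (c - x)) by (field; lra). nra. }
  nra.
Qed.

(** * The vorticity is a Lipschitz function of the stream function *)

(** C^{1,1} regularity of U with gradient (P, Q). As an inequality between arbitrary pairs of points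
    of the closed strip, it asks for no derivative on the boundary lines and for no path between the
    points. *)
Definition taylor_on (a b L : R) (U P Q : R -> R -> R) : Prop :=
  forall r t r' t' : R, a <= r <= b -> a <= r' <= b ->
    Rabs (U r' t' - U r t - (P r t * (r' - r) + Q r t * (t' - t)))
    <= L * (Rabs (r' - r) + Rabs (t' - t)) ^ 2.

Lemma taylor_continuity (a b L : R) (U P Q : R -> R -> R) (g1 g2 : R -> R) (C s : R) :
  0 <= L -> taylor_on a b L U P Q ->
  (forall x, a <= g1 x <= b) ->
  (forall x y, Rabs (g1 x - g1 y) <= C * Rabs (x - y)) ->
  (forall x y, Rabs (g2 x - g2 y) <= C * Rabs (x - y)) ->
  continuity_pt (fun x => U (g1 x) (g2 x)) s.
Proof.
  intros HL HT Hin H1 H2 eps He.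
  set (A := Rabs (P (g1 s) (g2 s)) + Rabs (Q (g1 s) (g2 s))).
  assert (HA : 0 <= A) by (unfold A; pose proof (Rabs_pos (P (g1 s) (g2 s)));
    pose proof (Rabs_pos (Q (g1 s) (g2 s))); lra).
  assert (HC : 0 <= C) by (pose proof (H1 1 0); pose proof (Rabs_pos (g1 1 - g1 0));
    rewrite Rminus_0_r, Rabs_R1 in *; lra).
  set (D := A * C + L * (2 * C) ^ 2 + 1).
  assert (HD : 0 < D) by (unfold D; nra).
  exists (Rmin 1 (eps / D)). split.
  { apply Rmin_glb_lt; [lra|]. now apply Rdiv_lt_0_compat. }
  intros x [_ Hx]. simpl in *. unfold Rdist in *.
  pose proof (Rmin_l 1 (eps / D)). pose proof (Rmin_r 1 (eps / D)).
  pose proof (HT (g1 s) (g2 s) (g1 x) (g2 x) (Hin s) (Hin x)) as Ht.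
  specialize (H1 x s). specialize (H2 x s).
  set (e := Rabs (x - s)) in *. pose proof (Rabs_pos (x - s)) as He0. fold e in He0.
  assert (Hlin : Rabs (P (g1 s) (g2 s) * (g1 x - g1 s) + Q (g1 s) (g2 s) * (g2 x - g2 s))
    <= A * (C * e)).
  { apply Rle_trans with (1 := Rabs_triang _ _). rewrite !Rabs_mult.
    unfold A. rewrite Rmult_plus_distr_r.
    apply Rplus_le_compat; apply Rmult_le_compat_l; auto using Rabs_pos. }
  set (n := Rabs (g1 x - g1 s) + Rabs (g2 x - g2 s)) in *.
  assert (Hn : 0 <= n <= 2 * C * e).
  { unfold n. pose proof (Rabs_pos (g1 x - g1 s)). pose proof (Rabs_pos (g2 x - g2 s)). lra. }
  assert (n ^ 2 <= (2 * C) ^ 2 * e).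
  { apply Rle_trans with ((2 * C * e) ^ 2); [apply pow_incr; lra|].
    rewrite Rpow_mult_distr. apply Rmult_le_compat_l; [apply pow2_ge_0|]. nra. }
  assert (He2 : e * D < eps).
  { apply Rmult_lt_reg_r with (/ D); [now apply Rinv_0_lt_compat|].
    rewrite Rmult_assoc, Rinv_r by lra. fold (eps / D). lra. }
  assert (Hf : Rabs (U (g1 x) (g2 x) - U (g1 s) (g2 s)) <= A * (C * e) + L * ((2 * C) ^ 2 * e)).
  { replace (U (g1 x) (g2 x) - U (g1 s) (g2 s)) with
      ((U (g1 x) (g2 x) - U (g1 s) (g2 s) - (P (g1 s) (g2 s) * (g1 x - g1 s) + Q (g1 s) (g2 s) * (g2 x - g2 s)))
       + (P (g1 s) (g2 s) * (g1 x - g1 s) + Q (g1 s) (g2 s) * (g2 x - g2 s))) by ring.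
    apply Rle_trans with (1 := Rabs_triang _ _).
    assert (L * n ^ 2 <= L * ((2 * C) ^ 2 * e)) by (apply Rmult_le_compat_l; assumption). lra. }
  unfold D in He2. nra.
Qed.

(* Move from [z = (r, t)] along a direction [e] in which [U] increases, stopping on the boundary if necessary: the values [0] and [c] of [U] there guarantee that the level [h] is met first. *)
Lemma reach_upper_level (a b c L mu : R) (U P Q : R -> R -> R) (r t e1 e2 h : R) :
  a < b -> 0 <= L -> taylor_on a b L U P Q ->
  (forall t, U a t = 0) -> (forall t, U b t = c) ->
  (forall r t, a <= r <= b -> 0 <= U r t <= c) ->
  (forall t, 0 < P a t /\ Q a t = 0) ->
  a <= r <= b -> U r t <= h <= c -> 0 < mu ->
  2 * mu <= P r t * e1 + Q r t * e2 ->
  L * (h - U r t) * (Rabs e1 + Rabs e2) ^ 2 <= mu ^ 2 ->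
  exists s : R, 0 <= s <= (h - U r t) / mu /\
    a <= r + s * e1 <= b /\ U (r + s * e1) (t + s * e2) = h.
Proof.
  intros Hab HL HT Ha Hb Hin Hbd Hr Hh Hmu Hd Hsmall.
  (* Growing at rate mu, U has reached the level h by time T. *)
  set (T := (h - U r t) / mu). set (n := Rabs e1 + Rabs e2) in *.
  assert (HTm : T * mu = h - U r t) by (unfold T; field; lra).
  assert (HT0 : 0 <= T).
  { apply Rmult_le_reg_r with mu; [exact Hmu|]. rewrite HTm. lra. }
  assert (Hn : 0 <= n) by (unfold n; pose proof (Rabs_pos e1); pose proof (Rabs_pos e2); lra).
  assert (HLT : L * T * n ^ 2 <= mu).
  { apply Rmult_le_reg_r with mu; [exact Hmu|].
    replace (L * T * n ^ 2 * mu) with (L * (T * mu) * n ^ 2) by ring.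
    rewrite HTm. simpl in Hsmall |- *. lra. }
  (* The slope is at least 2 mu, and up to time T the quadratic remainder takes away at most mu of
     it. *)
  assert (Hgrow : forall s, 0 <= s <= T -> a <= r + s * e1 <= b ->
    U r t + s * mu <= U (r + s * e1) (t + s * e2)).
  { intros s Hs Hin'.
    pose proof (HT r t (r + s * e1) (t + s * e2) Hr Hin') as Ht.
    replace (r + s * e1 - r) with (s * e1) in Ht by ring.
    replace (t + s * e2 - t) with (s * e2) in Ht by ring.
    rewrite !Rabs_mult, (Rabs_pos_eq s) in Ht by lra.
    replace (s * Rabs e1 + s * Rabs e2) with (s * n) in Ht by (unfold n; ring).
    assert (L * (s * n) ^ 2 <= s * mu).
    { replace (L * (s * n) ^ 2) with (s * (L * s * n ^ 2)) by ring.
      apply Rmult_le_compat_l; [lra|]. apply Rle_trans with (2 := HLT).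
      apply Rmult_le_compat_r; [apply pow2_ge_0|]. apply Rmult_le_compat_l; lra. }
    apply Rabs_le_between in Ht. nra. }
  (* An exit through r = a would occur at value 0, although U has grown strictly from a nonnegative
     value. From r = a itself the direction points inwards, because Q = 0 < P there. *)
  assert (Hnoexit : forall s, 0 <= s <= T -> a <= r + s * e1).
  { intros s Hs. apply Rnot_lt_le. intros Hlt.
    assert (He : e1 < 0) by nra.
    destruct (Req_dec r a) as [->|Hra].
    { destruct (Hbd t) as [Hp Hq]. rewrite Hq in Hd. nra. }
    set (s0 := (a - r) / e1).
    assert (Hs0 : r + s0 * e1 = a) by (unfold s0; field; lra).
    assert (0 < s0 < s) by (split; nra).
    pose proof (Hgrow s0 ltac:(lra) ltac:(lra)) as Hg.
    rewrite Hs0, Ha in Hg. pose proof (Hin r t Hr). nra. }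
  set (g := fun s => U (clamp a b (r + s * e1)) (t + s * e2)).
  assert (Hcont : continuity g).
  { intros s. apply (taylor_continuity a b L U P Q (fun s => clamp a b (r + s * e1))
      (fun s => t + s * e2) n s HL HT).
    - intros x. apply clamp_in. lra.
    - intros x y. apply Rle_trans with (1 := clamp_lipschitz _ _ _ _).
      replace (r + x * e1 - (r + y * e1)) with (e1 * (x - y)) by ring.
      rewrite Rabs_mult. apply Rmult_le_compat_r; [apply Rabs_pos|].
      unfold n. pose proof (Rabs_pos e2). lra.
    - intros x y. replace (t + x * e2 - (t + y * e2)) with (e2 * (x - y)) by ring.
      rewrite Rabs_mult. apply Rmult_le_compat_r; [apply Rabs_pos|].
      unfold n. pose proof (Rabs_pos e1). lra. }
  assert (Hg0 : g 0 = U r t).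
  { unfold g. rewrite !Rmult_0_l, !Rplus_0_r, clamp_id; [reflexivity|lra]. }
  assert (Hclb : forall x, b <= x -> clamp a b x = b).
  { intros x Hx. unfold clamp, Rmax, Rmin. repeat destruct (Rle_dec _ _); lra. }
  assert (HgT : h <= g T).
  { unfold g. destruct (Rle_dec (r + T * e1) b) as [Hle|Hgt].
    - pose proof (Hnoexit T ltac:(lra)). rewrite clamp_id by lra.
      pose proof (Hgrow T ltac:(lra) ltac:(lra)). lra.
    - rewrite Hclb, Hb by lra. lra. }
  destruct (IVT_gen g 0 T h Hcont) as (s & Hs & Hgs).
  { rewrite Hg0, Rmin_left, Rmax_right by lra. lra. }
  rewrite Rmin_left, Rmax_right in Hs by lra.
  destruct (Rle_dec (r + s * e1) b) as [Hle|Hgt].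
  - pose proof (Hnoexit s Hs). exists s. unfold g in Hgs.
    rewrite clamp_id in Hgs by lra. split; [lra|]. split; [lra|exact Hgs].
  (* Beyond r = b the clamped function equals c, so h = c and the crossing point of the ray with r =
     b has the required value. *)
  - unfold g in Hgs. rewrite Hclb, Hb in Hgs by lra.
    assert (He : 0 < e1) by nra.
    exists ((b - r) / e1).
    assert (Hs0 : r + (b - r) / e1 * e1 = b) by (field; lra).
    rewrite Hs0. split; [|split; [lra|now rewrite Hb]].
    split; [apply Rmult_le_pos; [lra|]; apply Rlt_le, Rinv_0_lt_compat; lra|].
    apply Rmult_le_reg_r with e1; [lra|]. nra.
Qed.

(** The substitution r -> - r, U -> c - U exchanges the two boundary lines and the two directions of
    growth. It keeps P and changes the sign of Q, whence - e2. *)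
Lemma reach_lower_level (a b c L mu : R) (U P Q : R -> R -> R) (r t e1 e2 h : R) :
  a < b -> 0 <= L -> taylor_on a b L U P Q ->
  (forall t, U a t = 0) -> (forall t, U b t = c) ->
  (forall r t, a <= r <= b -> 0 <= U r t <= c) ->
  (forall t, 0 < P b t /\ Q b t = 0) ->
  a <= r <= b -> 0 <= h <= U r t -> 0 < mu ->
  2 * mu <= P r t * e1 + Q r t * e2 ->
  L * (U r t - h) * (Rabs e1 + Rabs e2) ^ 2 <= mu ^ 2 ->
  exists s : R, 0 <= s <= (U r t - h) / mu /\
    a <= r - s * e1 <= b /\ U (r - s * e1) (t - s * e2) = h.
Proof.
  intros Hab HL HT Ha Hb Hin Hbd Hr Hh Hmu Hd Hsmall.
  destruct (reach_upper_level (-b) (-a) c L mu (fun r t => c - U (-r) t)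
    (fun r t => P (-r) t) (fun r t => - Q (-r) t) (-r) t e1 (-e2) (c - h))
    as (s & Hs & Hs1 & Hs2); try lra.
  - intros r0 t0 r1 t1 H0 H1.
    pose proof (HT (-r0) t0 (-r1) t1 ltac:(lra) ltac:(lra)) as H.
    replace (- r1 - - r0) with (- (r1 - r0)) in H by ring. rewrite Rabs_Ropp in H.
    rewrite <- Rabs_Ropp.
    match goal with |- Rabs ?x <= _ => replace x with
     (U (- r1) t1 - U (- r0) t0 - (P (- r0) t0 * - (r1 - r0) + Q (- r0) t0 * (t1 - t0))) by ring end.
    exact H.
  - intros t0. rewrite Ropp_involutive, Hb. lra.
  - intros t0. rewrite Ropp_involutive, Ha. lra.
  - intros r0 t0 H0. pose proof (Hin (-r0) t0 ltac:(lra)). lra.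
  - intros t0. rewrite Ropp_involutive. destruct (Hbd t0) as [Hp Hq]. rewrite Hq.
    split; [exact Hp|ring].
  - rewrite Ropp_involutive. lra.
  - rewrite Ropp_involutive. lra.
  - rewrite Ropp_involutive, Rabs_Ropp.
    replace (c - h - (c - U r t)) with (U r t - h) by ring. exact Hsmall.
  - rewrite Ropp_involutive in Hs. replace (c - h - (c - U r t)) with (U r t - h) in Hs by ring.
    exists s. split; [exact Hs|]. split; [lra|].
    replace (- (- r + s * e1)) with (r - s * e1) in Hs2 by ring.
    replace (t + s * - e2) with (t - s * e2) in Hs2 by ring. lra.
Qed.

(** * Level sets of a function without critical points on a strip *)

Section Levels.

Variables (a b c L M m : R) (U P Q W : R -> R -> R).
Hypotheses (Hab : a < b) (Hc : 0 < c) (HL : 0 < L) (HM : 0 < M) (Hm : 0 < m).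
Hypothesis HT : taylor_on a b L U P Q.
Hypotheses (HUa : forall t, U a t = 0) (HUb : forall t, U b t = c)
  (HUin : forall r t, a < r < b -> 0 < U r t < c).
Hypothesis HLip : forall r t r' t', a <= r <= b -> a <= r' <= b ->
  Rabs (P r' t' - P r t) <= L * (Rabs (r' - r) + Rabs (t' - t)) /\
  Rabs (Q r' t' - Q r t) <= L * (Rabs (r' - r) + Rabs (t' - t)).
Hypothesis HPQ : forall r t, a <= r <= b ->
  Rabs (P r t) <= M /\ Rabs (Q r t) <= M /\ m <= P r t ^ 2 + Q r t ^ 2.
Hypothesis HQ : forall t, Q a t = 0 /\ Q b t = 0.
Hypothesis HWM : forall r t, a < r < b -> Rabs (W r t) <= M.
Hypothesis HWL : forall r t r' t', a < r < b -> a < r' < b ->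
  Rabs (W r' t' - W r t) <= M * (Rabs (r' - r) + Rabs (t' - t)).
Hypothesis HW : forall r t, a < r < b -> exists wr wt,
  differentiable_pt_lim W r t wr wt /\ P r t * wt - Q r t * wr = 0.

Lemma level_range (r t : R) : a <= r <= b -> 0 <= U r t <= c.
Proof.
  intros Hr. destruct (Req_dec r a) as [->|]; [rewrite HUa; lra|].
  destruct (Req_dec r b) as [->|]; [rewrite HUb; lra|].
  pose proof (HUin r t ltac:(lra)). lra.
Qed.

Lemma level_interior (r t : R) : a <= r <= b -> 0 < U r t < c -> a < r < b.
Proof.
  intros Hr Hu. destruct (Req_dec r a) as [->|]; [rewrite HUa in Hu; lra|].
  destruct (Req_dec r b) as [->|]; [rewrite HUb in Hu; lra|]. lra.
Qed.

(** Since Q = 0 on the boundary lines, P^2 >= m there. A negative P would push U below 0 just inside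
    r = a, or above c just inside r = b; [sg] is the inward direction. *)
Lemma normal_derivative_pos (t : R) : 0 < P a t /\ 0 < P b t.
Proof.
  assert (Hgen : forall x sg, (x = a /\ sg = 1) \/ (x = b /\ sg = -1) -> 0 < P x t).
  { intros x sg Hx. apply Rnot_le_lt. intros Hle.
    assert (HQx : Q x t = 0) by (destruct Hx as [[-> _]|[-> _]]; apply HQ).
    assert (Hxin : a <= x <= b) by (destruct Hx as [[-> _]|[-> _]]; lra).
    destruct (HPQ x t Hxin) as (_ & _ & Hlow). rewrite HQx in Hlow.
    assert (HP : P x t < 0) by (destruct (Req_dec (P x t) 0) as [Hz|]; [rewrite Hz in Hlow; nra|lra]).
    (* Below - P / (2 L), the remainder L s^2 is smaller than the linear term - P s. *)
    set (s := Rmin (b - a) (- P x t / (2 * L)) / 2).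
    assert (Hq : 0 < - P x t / (2 * L)) by (apply Rdiv_lt_0_compat; lra).
    assert (Hs : 0 < s /\ s < b - a /\ s < - P x t / (2 * L)).
    { unfold s. pose proof (Rmin_l (b - a) (- P x t / (2 * L))).
      pose proof (Rmin_r (b - a) (- P x t / (2 * L))).
      assert (0 < Rmin (b - a) (- P x t / (2 * L))) by (apply Rmin_glb_lt; lra). lra. }
    assert (Hs2 : L * s < - P x t).
    { destruct Hs as (_ & _ & Hs).
      apply (Rmult_lt_compat_l L) in Hs; [|lra].
      replace (L * (- P x t / (2 * L))) with (- P x t / 2) in Hs by (field; lra). lra. }
    assert (Hin : a < x + sg * s < b) by (destruct Hx as [[-> ->]|[-> ->]]; lra).
    pose proof (HT x t (x + sg * s) t Hxin ltac:(lra)) as H.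
    replace (x + sg * s - x) with (sg * s) in H by ring.
    rewrite Rminus_diag, Rabs_R0, Rmult_0_r, !Rplus_0_r, Rabs_mult, (Rabs_pos_eq s) in H by lra.
    assert (Rabs sg = 1) as Hsg by (destruct Hx as [[_ ->]|[_ ->]];
      unfold Rabs; destruct (Rcase_abs _); lra).
    rewrite Hsg, Rmult_1_l in H. apply Rabs_le_between in H.
    pose proof (HUin _ t Hin).
    destruct Hx as [[-> ->]|[-> ->]]; [rewrite HUa in H|rewrite HUb in H]; nra. }
  split; [apply (Hgen a 1)|apply (Hgen b (-1))]; tauto.
Qed.

Lemma reach_level_along (r t e1 e2 h mu : R) :
  a <= r <= b -> 0 <= h <= c -> 0 < mu ->
  2 * mu <= P r t * e1 + Q r t * e2 ->
  L * Rabs (h - U r t) * (Rabs e1 + Rabs e2) ^ 2 <= mu ^ 2 ->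
  exists s : R, Rabs s <= Rabs (h - U r t) / mu /\
    a <= r + s * e1 <= b /\ U (r + s * e1) (t + s * e2) = h.
Proof.
  intros Hr Hh Hmu Hd Hs.
  destruct (Rle_dec (U r t) h) as [Hle|Hgt].
  - rewrite (Rabs_pos_eq (h - _)) in Hs |- * by lra.
    destruct (reach_upper_level a b c L mu U P Q r t e1 e2 h) as (s & H1 & H2);
      auto using level_range; try lra.
    { intros t0. split; [apply normal_derivative_pos|apply HQ]. }
    exists s. split; [rewrite Rabs_pos_eq; lra|exact H2].
  - rewrite (Rabs_left (h - _)) in Hs |- * by lra.
    rewrite Ropp_minus_distr in Hs |- *.
    destruct (reach_lower_level a b c L mu U P Q r t e1 e2 h) as (s & H1 & H2);
      auto using level_range; try lra.
    { intros t0. split; [apply normal_derivative_pos|apply HQ]. }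
    exists (- s). split; [rewrite Rabs_Ropp, Rabs_pos_eq; lra|].
    replace (r + - s * e1) with (r - s * e1) by ring.
    replace (t + - s * e2) with (t - s * e2) by ring. exact H2.
Qed.

(** The direction is the gradient itself, with mu = m / 2 and l1-norm at most 2 M. The smallness
    condition is L * |h - U| * (2 M)^2 <= (m / 2)^2, and the displacement is at most |h - U| / (m /
    2) times 2 M. *)
Lemma reach_level (r t h : R) :
  a <= r <= b -> 0 <= h <= c -> Rabs (h - U r t) <= m ^ 2 / (16 * L * M ^ 2) ->
  exists r' t' : R, a <= r' <= b /\ U r' t' = h /\
    Rabs (r' - r) + Rabs (t' - t) <= 4 * M / m * Rabs (h - U r t).
Proof.
  intros Hr Hh Hsmall.
  destruct (HPQ r t Hr) as (HP & HQ' & Hlow).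
  assert (Hn : Rabs (P r t) + Rabs (Q r t) <= 2 * M) by lra.
  pose proof (Rabs_pos (P r t)). pose proof (Rabs_pos (Q r t)).
  pose proof (Rabs_pos (h - U r t)) as Hp.
  destruct (reach_level_along r t (P r t) (Q r t) h (m / 2) Hr Hh) as (s & H1 & H2 & H3); try nra.
  - apply Rle_trans with (L * (m ^ 2 / (16 * L * M ^ 2)) * (2 * M) ^ 2).
    + apply Rmult_le_compat; [nra|apply pow2_ge_0| |apply pow_incr; lra].
      apply Rmult_le_compat_l; lra.
    + right. field. nra.
  - exists (r + s * P r t), (t + s * Q r t). split; [exact H2|]. split; [exact H3|].
    replace (r + s * P r t - r) with (s * P r t) by ring.
    replace (t + s * Q r t - t) with (s * Q r t) by ring.
    rewrite !Rabs_mult, <- Rmult_plus_distr_l.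
    apply Rle_trans with (Rabs (h - U r t) / (m / 2) * (2 * M)).
    + apply Rmult_le_compat; auto using Rabs_pos; lra.
    + right. field. lra.
Qed.

(** * Chains of points in a level set *)

Inductive linked (h rho r t : R) : R -> R -> Prop :=
| linked_refl : a <= r <= b -> U r t = h -> linked h rho r t r t
| linked_step (r1 t1 r2 t2 : R) :
    linked h rho r t r1 t1 -> a <= r2 <= b -> U r2 t2 = h ->
    Rabs (r2 - r1) + Rabs (t2 - t1) <= rho -> linked h rho r t r2 t2.

Definition level_linked (h rho : R) : Prop :=
  forall r t r' t' : R, a <= r <= b -> a <= r' <= b -> U r t = h -> U r' t' = h ->
    linked h rho r t r' t'.

Lemma linked_on_level (h rho r t r' t' : R) :
  linked h rho r t r' t' -> a <= r' <= b /\ U r' t' = h.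
Proof. intros [|]; auto. Qed.

(** Taylor's bound at the second endpoint shows that the linear part along the segment is at most L
    rho^2. The same bound at the intermediate point adds another L rho^2. Convexity of the strip
    keeps the segment inside. *)
Lemma same_level_flat (h rho s r t r' t' : R) :
  a <= r <= b -> a <= r' <= b -> U r t = h -> U r' t' = h ->
  Rabs (r' - r) + Rabs (t' - t) <= rho -> 0 <= s <= 1 ->
  a <= r + s * (r' - r) <= b /\
  Rabs (h - U (r + s * (r' - r)) (t + s * (t' - t))) <= 2 * L * rho ^ 2.
Proof.
  intros Hr Hr' Hu Hu' Hd Hs.
  assert (Hin : a <= r + s * (r' - r) <= b) by nra.
  split; [exact Hin|].
  pose proof (HT r t r' t' Hr Hr') as H1.
  pose proof (HT r t (r + s * (r' - r)) (t + s * (t' - t)) Hr Hin) as H2.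
  replace (r + s * (r' - r) - r) with (s * (r' - r)) in H2 by ring.
  replace (t + s * (t' - t) - t) with (s * (t' - t)) in H2 by ring.
  rewrite !Rabs_mult, (Rabs_pos_eq s), <- Rmult_plus_distr_l in H2 by lra.
  set (n := Rabs (r' - r) + Rabs (t' - t)) in *.
  assert (Hn : 0 <= n) by (unfold n; pose proof (Rabs_pos (r' - r)); pose proof (Rabs_pos (t' - t)); lra).
  rewrite Hu, Hu' in H1. rewrite Hu in H2.
  replace (P r t * (s * (r' - r)) + Q r t * (s * (t' - t))) with
    (s * (P r t * (r' - r) + Q r t * (t' - t))) in H2 by ring.
  set (g := P r t * (r' - r) + Q r t * (t' - t)) in *.
  assert (Hnn : L * n ^ 2 <= L * rho ^ 2) by (apply Rmult_le_compat_l; [lra|]; apply pow_incr; lra).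
  assert (Hnn2 : L * (s * n) ^ 2 <= L * rho ^ 2).
  { apply Rmult_le_compat_l; [lra|]. apply pow_incr. nra. }
  apply Rabs_le_between in H1, H2. apply Rabs_le_between.
  assert (- (L * rho ^ 2) <= s * g <= L * rho ^ 2) by (split; nra).
  lra.
Qed.

Lemma scale_pos : 0 < 16 * L * M ^ 2.
Proof. apply Rmult_lt_0_compat; [lra|]. now apply pow_lt. Qed.

Lemma scaled_le (x k : R) : 0 < k -> x <= m / (k * L * M) -> k * L * M * x <= m.
Proof.
  intros Hk Hx. apply Rmult_le_compat_l with (r := k * L * M) in Hx.
  - replace (k * L * M * (m / (k * L * M))) with m in Hx by (field; nra). exact Hx.
  - apply Rlt_le. repeat apply Rmult_lt_0_compat; lra.
Qed.

(** The midpoint misses the level by at most 2 L rho^2, so [reach_level] moves it by at most 8 L M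
    rho^2 / m. The bound on rho makes this at most rho / 4, and 1/2 + 1/4 = 3/4. *)
Lemma level_midpoint (h rho r t r' t' : R) :
  0 <= h <= c -> 0 < rho <= m / (64 * L * M) ->
  a <= r <= b -> a <= r' <= b -> U r t = h -> U r' t' = h ->
  Rabs (r' - r) + Rabs (t' - t) <= rho ->
  exists r1 t1 : R, a <= r1 <= b /\ U r1 t1 = h /\
    Rabs (r1 - r) + Rabs (t1 - t) <= 3 / 4 * rho /\
    Rabs (r' - r1) + Rabs (t' - t1) <= 3 / 4 * rho.
Proof.
  intros Hh [Hrho Hrho2] Hr Hr' Hu Hu' Hd.
  destruct (same_level_flat h rho (1/2) r t r' t' Hr Hr' Hu Hu' Hd ltac:(lra)) as [Hin Hfl].
  apply scaled_le in Hrho2; [|lra].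
  assert (Hm2 : (64 * L * M * rho) ^ 2 <= m ^ 2).
  { apply pow_incr. split; [|exact Hrho2]. repeat apply Rmult_le_pos; lra. }
  destruct (reach_level (r + 1/2 * (r' - r)) (t + 1/2 * (t' - t)) h Hin Hh)
    as (r1 & t1 & H1 & H2 & H3).
  - apply Rle_trans with (1 := Hfl).
    apply Rmult_le_reg_r with (16 * L * M ^ 2); [apply scale_pos|].
    replace (m ^ 2 / (16 * L * M ^ 2) * (16 * L * M ^ 2)) with (m ^ 2) by (field; lra).
    nra.
  - exists r1, t1. split; [exact H1|]. split; [exact H2|].
    assert (H4 : Rabs (r1 - (r + 1/2 * (r' - r))) + Rabs (t1 - (t + 1/2 * (t' - t))) <= rho / 4).
    { apply Rle_trans with (1 := H3).
      apply Rle_trans with (4 * M / m * (2 * L * rho ^ 2)).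
      - apply Rmult_le_compat_l; [|exact Hfl]. apply Rlt_le, Rdiv_lt_0_compat; lra.
      - apply Rmult_le_reg_r with m; [exact Hm|].
        replace (4 * M / m * (2 * L * rho ^ 2) * m) with (8 * L * M * rho * rho) by (field; lra).
        nra. }
    assert (Hx : forall x y z, Rabs (z - x) <= Rabs (z - (x + 1/2 * (y - x))) + 1/2 * Rabs (y - x)
               /\ Rabs (y - z) <= Rabs (z - (x + 1/2 * (y - x))) + 1/2 * Rabs (y - x)).
    { intros x y z. unfold Rabs. repeat destruct (Rcase_abs _); lra. }
    destruct (Hx r r' r1), (Hx t t' t1). lra.
Qed.

Lemma linked_refine (h rho r t r' t' : R) :
  0 <= h <= c -> 0 < rho <= m / (64 * L * M) ->
  linked h rho r t r' t' -> linked h (3 / 4 * rho) r t r' t'.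
Proof.
  intros Hh Hrho H. induction H as [Hr Hu|r1 t1 r2 t2 H1 IH Hr Hu Hd].
  - now constructor.
  - destruct (linked_on_level _ _ _ _ _ _ H1) as [Hr1 Hu1].
    destruct (level_midpoint h rho r1 t1 r2 t2) as (r3 & t3 & H3 & Hu3 & Hd3 & Hd3'); auto.
    apply linked_step with r3 t3; auto. apply linked_step with r1 t1; auto.
Qed.

(** Both endpoints are moved to the level h, joined there by a chain, and the chain is refined to
    links of length 3/4 rho. Moving its points back costs rho / 8 at each end of a link, and 1/8 +
    3/4 + 1/8 = 1. *)
Lemma level_linked_propagate (h h' rho : R) :
  0 <= h <= c -> 0 <= h' <= c -> 0 < rho <= m / (64 * L * M) ->
  Rabs (h' - h) <= m ^ 2 / (16 * L * M ^ 2) -> 4 * M / m * Rabs (h' - h) <= rho / 8 ->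
  level_linked h rho -> level_linked h' rho.
Proof.
  intros Hh Hh' Hrho He He2 HD r t r' t' Hr Hr' Hu Hu'.
  rewrite Rabs_minus_sym in He, He2.
  destruct (reach_level r t h Hr Hh ltac:(rewrite Hu; exact He)) as (r1 & t1 & Hr1 & Hu1 & Hd1).
  destruct (reach_level r' t' h Hr' Hh ltac:(rewrite Hu'; exact He)) as (r2 & t2 & Hr2 & Hu2 & Hd2).
  rewrite Hu in Hd1. rewrite Hu' in Hd2.
  pose proof (linked_refine h rho r1 t1 r2 t2 Hh Hrho (HD _ _ _ _ Hr1 Hr2 Hu1 Hu2)) as Hch.
  assert (Hclose : forall x y z : R, Rabs (x - y) <= Rabs (x - z) + Rabs (z - y)).
  { intros x y z. replace (x - y) with ((x - z) + (z - y)) by ring. apply Rabs_triang. }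
  (* Invariant of the induction along the chain at level h: the chain built at level h' ends within
     rho / 8 of the current point. *)
  assert (Hkey : exists r3 t3, linked h' rho r t r3 t3 /\
      Rabs (r3 - r2) + Rabs (t3 - t2) <= rho / 8).
  { clear Hd2 Hr2 Hu2. induction Hch as [_ _|r3 t3 r4 t4 H3 IH Hr4 Hu4 Hd4].
    - exists r, t. split; [now constructor|].
      rewrite (Rabs_minus_sym r), (Rabs_minus_sym t). lra.
    - destruct IH as (r5 & t5 & H5 & Hd5).
      rewrite Rabs_minus_sym in He, He2.
      destruct (reach_level r4 t4 h' Hr4 Hh' ltac:(rewrite Hu4; exact He))
        as (r6 & t6 & Hr6 & Hu6 & Hd6). rewrite Hu4 in Hd6.
      exists r6, t6. split; [|lra].
      apply linked_step with r5 t5; auto.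
      pose proof (Hclose r6 r5 r4). pose proof (Hclose r4 r5 r3).
      pose proof (Hclose t6 t5 t4). pose proof (Hclose t4 t5 t3).
      rewrite (Rabs_minus_sym r5), (Rabs_minus_sym t5) in Hd5. lra. }
  destruct Hkey as (r3 & t3 & H3 & Hd3).
  apply linked_step with r3 t3; auto.
  pose proof (Hclose r' r3 r2). pose proof (Hclose t' t3 t2).
  rewrite (Rabs_minus_sym r3), (Rabs_minus_sym t3) in Hd3.
  rewrite (Rabs_minus_sym r2), (Rabs_minus_sym t2) in Hd2. lra.
Qed.

(** The level 0 is exactly the line r = a, which is cut into equal pieces. *)
Lemma level_linked_bottom (rho : R) : 0 < rho -> level_linked 0 rho.
Proof.
  intros Hrho r t r' t' Hr Hr' Hu Hu'.
  assert (Ha : forall r t, a <= r <= b -> U r t = 0 -> r = a).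
  { intros r0 t0 H0 Hu0. destruct (Req_dec r0 a) as [|Hn]; [assumption|].
    destruct (Req_dec r0 b) as [->|Hn']; [rewrite HUb in Hu0; lra|].
    pose proof (HUin r0 t0 ltac:(lra)). lra. }
  rewrite (Ha r t Hr Hu), (Ha r' t' Hr' Hu') in *. clear r r' Hr Hr' Hu Hu'.
  assert (Hn : forall n t', Rabs (t' - t) <= INR n * rho -> linked 0 rho a t a t').
  { induction n as [|n IH]; intros t1 H1.
    - simpl in H1. assert (t1 = t) as ->; [|constructor; [lra|apply HUa]].
      pose proof (Rabs_pos (t1 - t)).
      apply Rminus_diag_uniq. destruct (Req_dec (t1 - t) 0) as [|Hz]; [assumption|].
      pose proof (Rabs_pos_lt _ Hz). lra.
    - rewrite S_INR in H1. pose proof (pos_INR n).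
      set (t2 := t + (t1 - t) * (INR n / (INR n + 1))).
      assert (Hf : 0 <= INR n / (INR n + 1)).
      { apply Rmult_le_pos; [lra|]. apply Rlt_le, Rinv_0_lt_compat. lra. }
      apply linked_step with a t2; try lra; auto.
      + apply IH. unfold t2. replace (t + (t1 - t) * (INR n / (INR n + 1)) - t) with
          ((t1 - t) * (INR n / (INR n + 1))) by ring.
        rewrite Rabs_mult, (Rabs_pos_eq _ Hf).
        apply Rle_trans with ((INR n + 1) * rho * (INR n / (INR n + 1))).
        * now apply Rmult_le_compat_r.
        * right. field. lra.
      + rewrite Rminus_diag, Rabs_R0, Rplus_0_l. unfold t2.
        replace (t1 - (t + (t1 - t) * (INR n / (INR n + 1)))) with
          ((t1 - t) * / (INR n + 1)) by (field; lra).
        assert (Hi : 0 < / (INR n + 1)) by (apply Rinv_0_lt_compat; lra).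
        rewrite Rabs_mult, (Rabs_pos_eq (/ _)) by lra.
        apply Rle_trans with ((INR n + 1) * rho * / (INR n + 1)).
        * apply Rmult_le_compat_r; lra.
        * right. field. lra. }
  destruct (INR_unbounded (Rabs (t' - t) / rho)) as [n Hn'].
  apply (Hn n). apply Rmult_le_reg_r with (/ rho); [now apply Rinv_0_lt_compat|].
  rewrite Rmult_assoc, Rinv_r by lra. unfold Rdiv in Hn'. lra.
Qed.

Lemma all_levels_linked (h rho : R) :
  0 <= h <= c -> 0 < rho <= m / (64 * L * M) -> level_linked h rho.
Proof.
  intros Hh Hrho.
  (* The first entry is the range of [reach_level]; the second makes its displacement 4 M / m * eta
     at most rho / 8. As eta depends on neither level, finitely many steps climb from 0 to h. *)
  set (eta := Rmin (m ^ 2 / (16 * L * M ^ 2)) (rho * m / (32 * M))).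
  assert (Heta : 0 < eta).
  { apply Rmin_glb_lt; apply Rdiv_lt_0_compat; try nra. apply scale_pos. }
  assert (Hind : forall n h, 0 <= h <= c -> h <= INR n * eta -> level_linked h rho).
  { induction n as [|n IH]; intros h1 Hh1 Hn.
    - simpl in Hn. replace h1 with 0 by lra. apply level_linked_bottom. lra.
    - rewrite S_INR in Hn. pose proof (pos_INR n).
      assert (H0 : 0 <= Rmax 0 (h1 - eta) <= c).
      { split; [apply Rmax_l|]. apply Rmax_lub; lra. }
      assert (Hdist : Rabs (h1 - Rmax 0 (h1 - eta)) <= eta).
      { unfold Rmax. destruct (Rle_dec _ _); rewrite Rabs_pos_eq; lra. }
      apply level_linked_propagate with (Rmax 0 (h1 - eta)); auto.
      + apply Rle_trans with (1 := Hdist). apply Rmin_l.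
      + apply Rle_trans with (4 * M / m * (rho * m / (32 * M))).
        * apply Rmult_le_compat_l; [apply Rlt_le, Rdiv_lt_0_compat; lra|].
          apply Rle_trans with (1 := Hdist). apply Rmin_r.
        * right. field. lra.
      + apply IH; [exact H0|]. apply Rmax_lub; nra. }
  destruct (INR_unbounded (h / eta)) as [n Hn].
  apply (Hind n h Hh). apply Rmult_le_reg_r with (/ eta); [now apply Rinv_0_lt_compat|].
  rewrite Rmult_assoc, Rinv_r by lra. unfold Rdiv in Hn. lra.
Qed.

(** This lets the gradient at one point serve as a direction of increase at all nearby points of a
    curve. *)
Lemma near_gradient (r t r' t' d k : R) :
  a <= r <= b -> a <= r' <= b -> Rabs (r' - r) + Rabs (t' - t) <= d ->
  2 * L * M * d <= k -> m - k <= P r' t' * P r t + Q r' t' * Q r t.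
Proof.
  intros Hr Hr' Hd Hk.
  destruct (HLip r t r' t' Hr Hr') as [H1 H2].
  destruct (HPQ r t Hr) as (HP & HQ' & Hlow).
  assert (H3 : Rabs ((P r' t' - P r t) * P r t) <= L * d * M).
  { rewrite Rabs_mult. apply Rmult_le_compat; auto using Rabs_pos.
    apply Rle_trans with (1 := H1). apply Rmult_le_compat_l; lra. }
  assert (H4 : Rabs ((Q r' t' - Q r t) * Q r t) <= L * d * M).
  { rewrite Rabs_mult. apply Rmult_le_compat; auto using Rabs_pos.
    apply Rle_trans with (1 := H2). apply Rmult_le_compat_l; lra. }
  apply Rabs_le_between in H3, H4. nra.
Qed.

(* The curve is [s |-> x + s (y - x) + tau s * grad U x]. *)
Lemma level_curve (h rho r t r' t' : R) :
  0 < h < c -> 0 < rho <= m / (64 * L * M) ->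
  a <= r <= b -> a <= r' <= b -> U r t = h -> U r' t' = h ->
  Rabs (r' - r) + Rabs (t' - t) <= rho ->
  exists (g1 g2 : R -> R) (C : R), 0 < C /\
    (g1 0 = r /\ g2 0 = t) /\ (g1 1 = r' /\ g2 1 = t') /\
    (forall s, 0 <= s <= 1 -> a <= g1 s <= b /\ U (g1 s) (g2 s) = h) /\
    (forall s s', 0 <= s <= 1 -> 0 <= s' <= 1 ->
       Rabs (g1 s' - g1 s) + Rabs (g2 s' - g2 s) <= C * Rabs (s' - s)).
Proof.
  intros Hh [Hrho Hrho2] Hr Hr' Hu Hu' Hd.
  apply scaled_le in Hrho2; [|lra].
  set (e1 := P r t). set (e2 := Q r t).
  assert (HLM : 0 < L * M * rho) by (repeat apply Rmult_lt_0_compat; lra).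
  assert (Hm2 : (64 * L * M * rho) ^ 2 <= m ^ 2) by (apply pow_incr; lra).
  assert (Hne : Rabs e1 + Rabs e2 <= 2 * M).
  { destruct (HPQ r t Hr) as (HP & HQ' & _). unfold e1, e2. lra. }
  pose proof (Rabs_pos e1) as He1. pose proof (Rabs_pos e2) as He2.
  (* The correction is set to 0 at both ends, where the level is already right, so that the curve
     really joins the two points. *)
  assert (Htau : exists tau : R -> R, forall s, 0 <= s <= 1 ->
    Rabs (tau s) <= 8 * L * rho ^ 2 / m /\
    a <= r + s * (r' - r) + tau s * e1 <= b /\
    U (r + s * (r' - r) + tau s * e1) (t + s * (t' - t) + tau s * e2) = h /\
    (s = 0 \/ s = 1 -> tau s = 0)).
  { assert (H : forall s, exists x, 0 <= s <= 1 ->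
      Rabs x <= 8 * L * rho ^ 2 / m /\
      a <= r + s * (r' - r) + x * e1 <= b /\
      U (r + s * (r' - r) + x * e1) (t + s * (t' - t) + x * e2) = h /\
      (s = 0 \/ s = 1 -> x = 0)).
    { intros s. destruct (classic (0 <= s <= 1)) as [Hs|Hs]; [|exists 0; tauto].
      destruct (classic (s = 0 \/ s = 1)) as [He|He].
      { assert (0 <= 8 * L * rho ^ 2 / m).
        { apply Rdiv_le_0_compat; [|exact Hm]. apply Rmult_le_pos; [lra|apply pow2_ge_0]. }
        exists 0. intros _. rewrite Rabs_R0, !Rmult_0_l, !Rplus_0_r.
        split; [assumption|]. destruct He as [-> | ->].
        - rewrite !Rmult_0_l, !Rplus_0_r. auto.
        - rewrite !Rmult_1_l, !Rplus_minus. auto. }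
      destruct (same_level_flat h rho s r t r' t' Hr Hr' Hu Hu' Hd Hs) as [Hin Hfl].
      (* Along the segment the gradient has product at least m / 2 with the fixed direction, hence
         mu = m / 4. *)
      destruct (reach_level_along (r + s * (r' - r)) (t + s * (t' - t)) e1 e2 h (m / 4))
        as (x & H1 & H2 & H3); auto; try lra.
      - assert (Hg : m - m / 2 <= P (r + s * (r' - r)) (t + s * (t' - t)) * e1 +
          Q (r + s * (r' - r)) (t + s * (t' - t)) * e2); [|lra].
        apply near_gradient with rho; auto; [|lra].
        replace (r + s * (r' - r) - r) with (s * (r' - r)) by ring.
        replace (t + s * (t' - t) - t) with (s * (t' - t)) by ring.
        rewrite !Rabs_mult, (Rabs_pos_eq s) by lra.
        pose proof (Rabs_pos (r' - r)). pose proof (Rabs_pos (t' - t)). nra.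
      - apply Rle_trans with (L * (2 * L * rho ^ 2) * (2 * M) ^ 2); [|nra].
        apply Rmult_le_compat; [|apply pow2_ge_0| |apply pow_incr; lra].
        + apply Rmult_le_pos; [lra|apply Rabs_pos].
        + apply Rmult_le_compat_l; lra.
      - exists x. intros _. split; [|repeat split; tauto].
        apply Rle_trans with (1 := H1).
        apply Rle_trans with (2 * L * rho ^ 2 / (m / 4)); [|right; field; lra].
        apply Rmult_le_compat_r; [|exact Hfl]. apply Rlt_le, Rinv_0_lt_compat. lra. }
    apply functional_choice in H. exact H. }
  destruct Htau as [tau Htau].
  set (g1 := fun s => r + s * (r' - r) + tau s * e1).
  set (g2 := fun s => t + s * (t' - t) + tau s * e2).
  assert (Htb : 8 * L * rho ^ 2 / m * (8 * L * M ^ 2) <= m / 64).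
  { apply Rmult_le_reg_r with (64 * m); [lra|].
    replace (8 * L * rho ^ 2 / m * (8 * L * M ^ 2) * (64 * m))
      with ((64 * L * M * rho) ^ 2) by (field; lra).
    nra. }
  assert (Htb2 : 8 * L * rho ^ 2 / m * (2 * M) <= rho).
  { apply Rmult_le_reg_r with m; [lra|].
    replace (8 * L * rho ^ 2 / m * (2 * M) * m) with (16 * (L * M * rho) * rho) by (field; lra).
    nra. }
  (* [tau] was chosen pointwise, without continuity; its Lipschitz bound comes from Taylor's
     inequality between two points of the curve. Both lie on the level h, so the increment [dl] of
     [tau], times the slope of U along the direction, is controlled by [sg] and by a quadratic term.
     The part of that term in [dl] is absorbed on the left, because [tau] is small. *)
  assert (Hlip : exists C, 0 < C /\ forall s s', 0 <= s <= 1 -> 0 <= s' <= 1 ->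
    Rabs (g1 s' - g1 s) + Rabs (g2 s' - g2 s) <= C * Rabs (s' - s)).
  { set (k := 4 * (M * rho + 2 * L * rho ^ 2) / m).
    assert (Hk : 0 < k) by (apply Rdiv_lt_0_compat; nra).
    exists (rho + k * (2 * M)). split; [nra|]. intros s s' Hs Hs'.
    destruct (Htau s Hs) as (Ht1 & Hin & Hl & _). destruct (Htau s' Hs') as (Ht1' & Hin' & Hl' & _).
    fold (g1 s) in Hin, Hl. fold (g2 s) in Hl. fold (g1 s') in Hin', Hl'. fold (g2 s') in Hl'.
    pose proof (HT (g1 s) (g2 s) (g1 s') (g2 s') Hin Hin') as Ht. rewrite Hl, Hl' in Ht.
    set (sg := s' - s). set (dl := tau s' - tau s).
    assert (Hg1 : g1 s' - g1 s = sg * (r' - r) + dl * e1) by (unfold g1, sg, dl; ring).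
    assert (Hg2 : g2 s' - g2 s = sg * (t' - t) + dl * e2) by (unfold g2, sg, dl; ring).
    assert (Hn : Rabs (g1 s' - g1 s) + Rabs (g2 s' - g2 s) <= Rabs sg * rho + Rabs dl * (2 * M)).
    { rewrite Hg1, Hg2.
      pose proof (Rabs_triang (sg * (r' - r)) (dl * e1)) as Hx1.
      pose proof (Rabs_triang (sg * (t' - t)) (dl * e2)) as Hx2.
      rewrite !Rabs_mult in Hx1, Hx2.
      pose proof (Rabs_pos sg). pose proof (Rabs_pos dl). nra. }
    assert (Hgr : m - m / 4 <= P (g1 s) (g2 s) * e1 + Q (g1 s) (g2 s) * e2).
    { apply near_gradient with (2 * rho); auto; [|lra].
      unfold g1, g2.
      replace (r + s * (r' - r) + tau s * e1 - r) with (s * (r' - r) + tau s * e1) by ring.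
      replace (t + s * (t' - t) + tau s * e2 - t) with (s * (t' - t) + tau s * e2) by ring.
      pose proof (Rabs_triang (s * (r' - r)) (tau s * e1)) as Hx1.
      pose proof (Rabs_triang (s * (t' - t)) (tau s * e2)) as Hx2.
      rewrite !Rabs_mult, (Rabs_pos_eq s) in Hx1, Hx2 by lra.
      assert (Rabs (tau s) * (Rabs e1 + Rabs e2) <= rho).
      { apply Rle_trans with (2 := Htb2). apply Rmult_le_compat; auto using Rabs_pos; lra. }
      pose proof (Rabs_pos (r' - r)). pose proof (Rabs_pos (t' - t)). nra. }
    assert (Hgd : Rabs (P (g1 s) (g2 s) * (r' - r) + Q (g1 s) (g2 s) * (t' - t)) <= M * rho).
    { destruct (HPQ (g1 s) (g2 s) Hin) as (HP & HQ' & _).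
      apply Rle_trans with (1 := Rabs_triang _ _). rewrite !Rabs_mult.
      pose proof (Rabs_pos (r' - r)). pose proof (Rabs_pos (t' - t)). nra. }
    assert (Hdl : Rabs dl <= 2 * (8 * L * rho ^ 2 / m)).
    { unfold dl. apply Rle_trans with (1 := Rabs_triang _ _). rewrite Rabs_Ropp. lra. }
    assert (Hsg : Rabs sg <= 1) by (unfold sg; apply Rabs_le; lra).
    assert (Hn2 : (Rabs (g1 s' - g1 s) + Rabs (g2 s' - g2 s)) ^ 2
      <= 2 * (Rabs sg * rho) ^ 2 + 2 * (Rabs dl * (2 * M)) ^ 2).
    { apply Rle_trans with ((Rabs sg * rho + Rabs dl * (2 * M)) ^ 2).
      - apply pow_incr. split; [|exact Hn].
        pose proof (Rabs_pos (g1 s' - g1 s)). pose proof (Rabs_pos (g2 s' - g2 s)). lra.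
      - pose proof (pow2_ge_0 (Rabs sg * rho - Rabs dl * (2 * M))). nra. }
    assert (Hmain : Rabs dl <= k * Rabs sg).
    { set (G1 := P (g1 s) (g2 s)) in *. set (G2 := Q (g1 s) (g2 s)) in *.
      pose proof (Rabs_pos dl) as Hd0. pose proof (Rabs_pos sg) as Hs0.
      assert (H1 : Rabs (dl * (G1 * e1 + G2 * e2)) <=
        Rabs sg * (M * rho) + L * (Rabs (g1 s' - g1 s) + Rabs (g2 s' - g2 s)) ^ 2).
      { replace (dl * (G1 * e1 + G2 * e2)) with
          (- (h - h - (G1 * (g1 s' - g1 s) + G2 * (g2 s' - g2 s)))
           - sg * (G1 * (r' - r) + G2 * (t' - t))) by (rewrite Hg1, Hg2; ring).
        apply Rle_trans with (1 := Rabs_triang _ _). rewrite !Rabs_Ropp, Rabs_mult.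
        assert (Rabs sg * Rabs (G1 * (r' - r) + G2 * (t' - t)) <= Rabs sg * (M * rho))
          by (apply Rmult_le_compat_l; assumption). lra. }
      rewrite Rabs_mult, (Rabs_pos_eq (_ + _)) in H1 by lra.
      assert (H2 : Rabs dl * (3 / 4 * m) <= Rabs dl * (G1 * e1 + G2 * e2))
        by (apply Rmult_le_compat_l; lra).
      assert (H3 : L * (2 * (Rabs dl * (2 * M)) ^ 2) <= Rabs dl * (m / 32)).
      { replace (L * (2 * (Rabs dl * (2 * M)) ^ 2)) with (Rabs dl * (Rabs dl * (8 * L * M ^ 2))) by ring.
        apply Rmult_le_compat_l; [lra|].
        apply Rle_trans with (2 * (8 * L * rho ^ 2 / m) * (8 * L * M ^ 2)); [|lra].
        apply Rmult_le_compat_r; [|exact Hdl]. pose proof scale_pos. lra. }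
      assert (H4 : L * (2 * (Rabs sg * rho) ^ 2) <= Rabs sg * (2 * L * rho ^ 2)).
      { replace (L * (2 * (Rabs sg * rho) ^ 2)) with (Rabs sg * (Rabs sg * (2 * L * rho ^ 2))) by ring.
        apply Rmult_le_compat_l; [lra|].
        rewrite <- (Rmult_1_l (2 * L * rho ^ 2)) at 2.
        apply Rmult_le_compat_r; [|lra]. pose proof (pow2_ge_0 rho). nra. }
      assert (H5 : L * (Rabs (g1 s' - g1 s) + Rabs (g2 s' - g2 s)) ^ 2 <=
        L * (2 * (Rabs sg * rho) ^ 2 + 2 * (Rabs dl * (2 * M)) ^ 2))
        by (apply Rmult_le_compat_l; lra).
      assert (H6 : Rabs dl * (m / 4) <= Rabs sg * (M * rho + 2 * L * rho ^ 2)) by nra.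
      unfold k. apply Rmult_le_reg_r with (m / 4); [lra|].
      replace (4 * (M * rho + 2 * L * rho ^ 2) / m * Rabs sg * (m / 4)) with
        (Rabs sg * (M * rho + 2 * L * rho ^ 2)) by (field; lra).
      exact H6. }
    apply Rle_trans with (1 := Hn). fold sg. pose proof (Rabs_pos dl). nra. }
  destruct Hlip as (C & HC & Hlip). exists g1, g2, C. split; [exact HC|].
  destruct (Htau 0 ltac:(lra)) as (_ & _ & _ & H0). destruct (Htau 1 ltac:(lra)) as (_ & _ & _ & H1).
  split; [unfold g1, g2; rewrite H0 by tauto; split; ring|].
  split; [unfold g1, g2; rewrite H1 by tauto; split; ring|].
  split; [|exact Hlip]. intros s Hs. destruct (Htau s Hs) as (_ & Hin & Hl & _). now split.
Qed.

(* Along a level curve [W] has zero slope, as its gradient is parallel to that of [U]. *)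
Lemma same_level_local (h rho r t r' t' : R) :
  0 < h < c -> 0 < rho <= m / (64 * L * M) ->
  a <= r <= b -> a <= r' <= b -> U r t = h -> U r' t' = h ->
  Rabs (r' - r) + Rabs (t' - t) <= rho -> W r t = W r' t'.
Proof.
  intros Hh Hrho Hr Hr' Hu Hu' Hd.
  destruct (level_curve h rho r t r' t' Hh Hrho Hr Hr' Hu Hu' Hd)
    as (g1 & g2 & C & HC & [H0 H0'] & [H1 H1'] & Hlev & Hlip).
  rewrite <- H0, <- H0', <- H1, <- H1'.
  apply (zero_slope_constant (fun s => W (g1 s) (g2 s))).
  intros s Hs eps Heps.
  destruct (Hlev s Hs) as [Hin Hl].
  destruct (HW (g1 s) (g2 s)) as (wr & wt & Hdiff & Hpar).
  { apply level_interior with (g2 s); [exact Hin|]. now rewrite Hl. }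
  assert (HeC : 0 < eps / (2 * C)) by (apply Rdiv_lt_0_compat; lra).
  destruct (Hdiff (mkposreal _ HeC)) as [d Hd']. simpl in Hd'.
  destruct (HPQ (g1 s) (g2 s) Hin) as (HP & HQ' & Hlow).
  set (G1 := P (g1 s) (g2 s)) in *. set (G2 := Q (g1 s) (g2 s)) in *.
  (* The factor in grad W = q grad U, obtained by projection onto grad U. *)
  set (q := (wr * G1 + wt * G2) / (G1 ^ 2 + G2 ^ 2)).
  assert (Hq : wr = q * G1 /\ wt = q * G2).
  { unfold q. split; apply Rmult_eq_reg_r with (G1 ^ 2 + G2 ^ 2); try lra.
    - replace ((wr * G1 + wt * G2) / (G1 ^ 2 + G2 ^ 2) * G1 * (G1 ^ 2 + G2 ^ 2))
        with (wr * G1 ^ 2 + (G1 * wt) * G2) by (field; lra).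
      replace (G1 * wt) with (G2 * wr) by lra. ring.
    - replace ((wr * G1 + wt * G2) / (G1 ^ 2 + G2 ^ 2) * G2 * (G1 ^ 2 + G2 ^ 2))
        with ((G2 * wr) * G1 + wt * G2 ^ 2) by (field; lra).
      replace (G2 * wr) with (G1 * wt) by lra. ring. }
  destruct Hq as [Hqr Hqt].
  assert (HD : 0 < 2 * Rabs q * L * C ^ 2 + 1).
  { pose proof (Rabs_pos q). pose proof (pow2_ge_0 C).
    assert (0 <= Rabs q * L * C ^ 2) by (repeat apply Rmult_le_pos; lra). lra. }
  exists (Rmin (d / C) (eps / (2 * Rabs q * L * C ^ 2 + 1))). split.
  { apply Rmin_glb_lt; apply Rdiv_lt_0_compat; auto using cond_pos. }
  intros s' Hs' Hss.
  pose proof (Rmin_l (d / C) (eps / (2 * Rabs q * L * C ^ 2 + 1))) as Hm1.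
  pose proof (Rmin_r (d / C) (eps / (2 * Rabs q * L * C ^ 2 + 1))) as Hm3.
  destruct (Hlev s' Hs') as [Hin' Hl'].
  pose proof (Hlip s s' Hs Hs') as Hn.
  pose proof (HT (g1 s) (g2 s) (g1 s') (g2 s') Hin Hin') as Ht. rewrite Hl, Hl' in Ht.
  fold G1 G2 in Ht.
  pose proof (Rabs_pos (g1 s' - g1 s)). pose proof (Rabs_pos (g2 s' - g2 s)).
  assert (HCs : C * Rabs (s' - s) < d).
  { apply Rmult_lt_reg_r with (/ C); [now apply Rinv_0_lt_compat|].
    replace (C * Rabs (s' - s) * / C) with (Rabs (s' - s)) by (field; lra).
    unfold Rdiv in Hm1. lra. }
  specialize (Hd' (g1 s') (g2 s') ltac:(lra) ltac:(lra)).
  set (A1 := g1 s' - g1 s) in *. set (A2 := g2 s' - g2 s) in *.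
  set (sg := Rabs (s' - s)) in *. assert (Hsg : 0 <= sg) by apply Rabs_pos.
  assert (Hmx : Rmax (Rabs A1) (Rabs A2) <= C * sg) by (apply Rmax_lub; lra).
  (* The linear part of the increment of [W] is q times that of U. As U does not change along the
     curve, the latter is only a Taylor remainder, quadratic in [sg]. *)
  assert (Hlin : Rabs (wr * A1 + wt * A2) <= Rabs q * (L * (C * sg) ^ 2)).
  { rewrite Hqr, Hqt.
    replace (q * G1 * A1 + q * G2 * A2) with (- (q * (h - h - (G1 * A1 + G2 * A2)))) by ring.
    rewrite Rabs_Ropp, Rabs_mult. apply Rmult_le_compat_l; [apply Rabs_pos|].
    apply Rle_trans with (1 := Ht). apply Rmult_le_compat_l; [lra|].
    apply pow_incr. lra. }
  replace (W (g1 s') (g2 s') - W (g1 s) (g2 s)) with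
    ((W (g1 s') (g2 s') - W (g1 s) (g2 s) - (wr * A1 + wt * A2)) + (wr * A1 + wt * A2)) by ring.
  apply Rle_trans with (1 := Rabs_triang _ _).
  assert (Hb1 : eps / (2 * C) * Rmax (Rabs A1) (Rabs A2) <= eps / 2 * sg).
  { apply Rle_trans with (eps / (2 * C) * (C * sg)).
    - apply Rmult_le_compat_l; lra.
    - right. field. lra. }
  assert (Hb2 : Rabs q * (L * (C * sg) ^ 2) <= eps / 2 * sg).
  { replace (Rabs q * (L * (C * sg) ^ 2)) with ((Rabs q * L * C ^ 2 * sg) * sg) by ring.
    apply Rmult_le_compat_r; [lra|].
    assert (sg * (2 * Rabs q * L * C ^ 2 + 1) < eps).
    { apply Rmult_lt_reg_r with (/ (2 * Rabs q * L * C ^ 2 + 1)); [now apply Rinv_0_lt_compat|].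
      rewrite Rmult_assoc, Rinv_r by lra. unfold Rdiv in Hm3. lra. }
    lra. }
  lra.
Qed.

(** Consecutive points of a chain with links m / (64 L M) carry the same value of [W] by
    [same_level_local]. *)
Lemma constant_on_levels (r t r' t' : R) :
  a < r < b -> a < r' < b -> U r t = U r' t' -> W r t = W r' t'.
Proof.
  intros Hr Hr' Hu.
  set (rho := m / (64 * L * M)).
  assert (Hrho : 0 < rho) by (apply Rdiv_lt_0_compat; [|repeat apply Rmult_lt_0_compat]; lra).
  pose proof (HUin r t Hr) as Hh.
  assert (H : linked (U r t) rho r t r' t').
  { apply all_levels_linked; auto; unfold rho in *; try lra. }
  clear Hu. induction H as [_ _|r1 t1 r2 t2 H1 IH H2 Hu2 Hd]; [reflexivity|].
  destruct (linked_on_level _ _ _ _ _ _ H1) as [Hr1 Hu1].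
  rewrite IH by (apply level_interior with t1; [exact Hr1|]; now rewrite Hu1).
  apply same_level_local with (U r t) rho; auto. unfold rho in *; lra.
Qed.

(** For levels at distance at most e0, the first point is moved to the second level by at most 4 M /
    m times the difference of levels; there [W] already has its second value. For levels further
    apart, the bound 2 M on the oscillation of [W] is enough, whence the term 2 M / e0. *)
Theorem lipschitz_function_of_level :
  exists K : R, 0 < K /\ forall r t r' t' : R, a < r < b -> a < r' < b ->
    Rabs (W r' t' - W r t) <= K * Rabs (U r' t' - U r t).
Proof.
  set (e0 := m ^ 2 / (16 * L * M ^ 2)).
  assert (He0 : 0 < e0) by (apply Rdiv_lt_0_compat; [nra|apply scale_pos]).
  assert (HK1 : 0 < M * (4 * M / m)) by (apply Rmult_lt_0_compat; [|apply Rdiv_lt_0_compat]; lra).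
  assert (HK2 : 0 < 2 * M / e0) by (apply Rdiv_lt_0_compat; lra).
  exists (M * (4 * M / m) + 2 * M / e0). split; [lra|].
  intros r t r' t' Hr Hr'.
  pose proof (HUin r t Hr). pose proof (HUin r' t' Hr').
  pose proof (Rabs_pos (U r' t' - U r t)) as Hp.
  destruct (Rle_dec (Rabs (U r' t' - U r t)) e0) as [Hle|Hgt].
  - destruct (reach_level r t (U r' t')) as (r1 & t1 & Hr1 & Hu1 & Hd); try lra; try exact Hle.
    assert (Hr1' : a < r1 < b) by (apply level_interior with t1; [exact Hr1|lra]).
    rewrite <- (constant_on_levels r1 t1 r' t') by assumption.
    apply Rle_trans with (1 := HWL r t r1 t1 Hr Hr1').
    apply Rle_trans with (M * (4 * M / m * Rabs (U r' t' - U r t))); [|nra].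
    apply Rmult_le_compat_l; lra.
  - pose proof (HWM r t Hr). pose proof (HWM r' t' Hr').
    apply Rle_trans with (2 * M).
    + apply Rle_trans with (1 := Rabs_triang _ _). rewrite Rabs_Ropp. lra.
    + apply Rle_trans with (2 * M / e0 * Rabs (U r' t' - U r t)); [|nra].
      apply Rmult_le_reg_r with (/ (2 * M / e0)); [now apply Rinv_0_lt_compat|].
      replace (2 * M / e0 * Rabs (U r' t' - U r t) * / (2 * M / e0)) with
        (Rabs (U r' t' - U r t)) by (field; lra).
      replace (2 * M * / (2 * M / e0)) with e0 by (field; lra). lra.
Qed.

End Levels.

(** * Moving planes in a ring *)

Definition ring_closed (a b x y : R) : Prop := a ^ 2 <= x ^ 2 + y ^ 2 <= b ^ 2.
Definition ring_open (a b x y : R) : Prop := a ^ 2 < x ^ 2 + y ^ 2 < b ^ 2.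

Lemma sum_squares_near (x y e : R) : 0 < e ->
  exists d : R, 0 < d /\ forall u v : R, Rabs (u - x) < d -> Rabs (v - y) < d ->
    Rabs ((u ^ 2 + v ^ 2) - (x ^ 2 + y ^ 2)) < e.
Proof.
  intros He. set (D := 2 * Rabs x + 2 * Rabs y + 2).
  assert (HD : 0 < D) by (unfold D; pose proof (Rabs_pos x); pose proof (Rabs_pos y); lra).
  exists (Rmin 1 (e / D)). split.
  { apply Rmin_glb_lt; [lra|now apply Rdiv_lt_0_compat]. }
  intros u v Hu Hv. pose proof (Rmin_l 1 (e / D)). pose proof (Rmin_r 1 (e / D)).
  assert (Hs : Rmin 1 (e / D) * D <= e).
  { apply Rle_trans with (e / D * D); [apply Rmult_le_compat_r; lra|right; field; lra]. }
  set (d := Rmin 1 (e / D)) in *.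
  replace (u ^ 2 + v ^ 2 - (x ^ 2 + y ^ 2)) with
    ((u - x) * (u - x + 2 * x) + (v - y) * (v - y + 2 * y)) by ring.
  apply Rle_lt_trans with (1 := Rabs_triang _ _). rewrite !Rabs_mult.
  pose proof (Rabs_triang (u - x) (2 * x)) as H1. pose proof (Rabs_triang (v - y) (2 * y)) as H2.
  rewrite Rabs_mult, (Rabs_pos_eq 2) in H1, H2 by lra.
  pose proof (Rabs_pos (u - x)). pose proof (Rabs_pos (v - y)).
  pose proof (Rabs_pos x). pose proof (Rabs_pos y).
  assert (Rabs (u - x) * Rabs (u - x + 2 * x) <= Rabs (u - x) * (1 + 2 * Rabs x))
    by (apply Rmult_le_compat_l; lra).
  assert (Rabs (v - y) * Rabs (v - y + 2 * y) <= Rabs (v - y) * (1 + 2 * Rabs y))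
    by (apply Rmult_le_compat_l; lra).
  unfold D in Hs. nra.
Qed.

Lemma compact_disk (x0 y0 r : R) : compact_2d (fun x y => (x - x0) ^ 2 + (y - y0) ^ 2 <= r ^ 2).
Proof.
  split.
  - exists (Rabs x0 + Rabs y0 + Rabs r). intros x y H.
    rewrite <- (pow2_abs r) in H.
    destruct (disk_coordinates _ _ _ (Rabs_pos r) H) as [Hx Hy].
    pose proof (Rabs_pos x0). pose proof (Rabs_pos y0).
    pose proof (Rle_abs x0). pose proof (Rle_abs y0).
    pose proof (Rle_abs (- x0)). pose proof (Rle_abs (- y0)). rewrite Rabs_Ropp in *.
    apply Rabs_le_between in Hx, Hy. lra.
  - intros x y H. apply Rnot_le_lt in H.
    destruct (sum_squares_near (x - x0) (y - y0) ((x - x0) ^ 2 + (y - y0) ^ 2 - r ^ 2) ltac:(lra))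
      as (d & Hd & Hn).
    exists d. split; [exact Hd|]. intros u v Hu Hv Hle.
    specialize (Hn (u - x0) (v - y0)).
    replace (u - x0 - (x - x0)) with (u - x) in Hn by ring.
    replace (v - y0 - (y - y0)) with (v - y) in Hn by ring.
    specialize (Hn Hu Hv). apply Rabs_def2 in Hn. lra.
Qed.

Lemma compact_ring (a b : R) : compact_2d (ring_closed a b).
Proof.
  split.
  - exists (Rabs b). intros x y [_ H].
    rewrite <- (pow2_abs b) in H.
    destruct (disk_coordinates _ _ _ (Rabs_pos b) H) as [Hx Hy].
    apply Rabs_le_between in Hx, Hy. lra.
  - intros x y H.
    assert (He : 0 < Rmax (a ^ 2 - (x ^ 2 + y ^ 2)) (x ^ 2 + y ^ 2 - b ^ 2)).
    { apply Rnot_le_lt. intros Hle. apply H.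
      pose proof (Rmax_l (a ^ 2 - (x ^ 2 + y ^ 2)) (x ^ 2 + y ^ 2 - b ^ 2)).
      pose proof (Rmax_r (a ^ 2 - (x ^ 2 + y ^ 2)) (x ^ 2 + y ^ 2 - b ^ 2)).
      unfold ring_closed. lra. }
    destruct (sum_squares_near x y _ He) as (d & Hd & Hn).
    exists d. split; [exact Hd|]. intros u v Hu Hv [H1 H2].
    specialize (Hn u v Hu Hv). apply Rabs_def2 in Hn. unfold Rmax in Hn.
    destruct (Rle_dec _ _); lra.
Qed.

Lemma continuous_2d_on_of_pt (K : R -> R -> Prop) (f : R -> R -> R) :
  (forall x y, K x y -> continuity_2d_pt f x y) -> continuous_2d_on K f.
Proof.
  intros H x y Hk e He. destruct (H x y Hk (mkposreal e He)) as [d Hd].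
  exists d. split; [apply cond_pos|]. intros u v _. apply Hd.
Qed.

Lemma continuous_2d_on_plus (K : R -> R -> Prop) (f g : R -> R -> R) :
  continuous_2d_on K f -> continuous_2d_on K g ->
  continuous_2d_on K (fun x y => f x y + g x y).
Proof.
  intros Hf Hg x y Hk e He.
  destruct (Hf x y Hk (e / 2) ltac:(lra)) as (d1 & Hd1 & H1).
  destruct (Hg x y Hk (e / 2) ltac:(lra)) as (d2 & Hd2 & H2).
  exists (Rmin d1 d2). split; [now apply Rmin_glb_lt|]. intros u v Huv Hu Hv.
  pose proof (Rmin_l d1 d2). pose proof (Rmin_r d1 d2).
  specialize (H1 u v Huv ltac:(lra) ltac:(lra)). specialize (H2 u v Huv ltac:(lra) ltac:(lra)).
  replace (f u v + g u v - (f x y + g x y)) with ((f u v - f x y) + (g u v - g x y)) by ring.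
  apply Rle_lt_trans with (1 := Rabs_triang _ _). lra.
Qed.

Lemma continuous_2d_on_comp (K : R -> R -> Prop) (g : R -> R) (f : R -> R -> R) :
  continuity g -> continuous_2d_on K f -> continuous_2d_on K (fun x y => g (f x y)).
Proof.
  intros Hg Hf x y Hk eps He. destruct (Hg (f x y) eps He) as (al & Hal & Hga).
  destruct (Hf x y Hk al Hal) as (d & Hd & H). exists d. split; [exact Hd|].
  intros u v Huv Hu Hv. specialize (H u v Huv Hu Hv).
  destruct (Req_dec (f u v) (f x y)) as [->|Hne]; [now rewrite Rminus_diag, Rabs_R0|].
  apply Hga. split; [split; [exact I|auto]|exact H].
Qed.

Lemma continuous_2d_on_scal (K : R -> R -> Prop) (p : R) (f : R -> R -> R) :
  continuous_2d_on K f -> continuous_2d_on K (fun x y => p * f x y).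
Proof.
  apply (continuous_2d_on_comp K (fun t => p * t)). intros t.
  apply derivable_continuous_pt. exists p. apply is_derive_Reals. auto_derive; [trivial|ring].
Qed.

Lemma locally_of_abs (x : R) (P : R -> Prop) (d : R) :
  0 < d -> (forall t, Rabs (t - x) < d -> P t) -> locally x P.
Proof. intros Hd H. exists (mkposreal d Hd). intros t Ht. apply H, Ht. Qed.

(* Comparison with Hopf's barrier [exp (- al |p - p0|^2) - exp (- al R^2)]. *)
Lemma hopf_barrier (w w1 w2 w11 w22 : R -> R -> R) (x0 y0 r C : R) :
  0 < r -> 0 <= C ->
  continuous_2d_on (fun x y => (x - x0) ^ 2 + (y - y0) ^ 2 <= r ^ 2) w ->
  (forall x y, (x - x0) ^ 2 + (y - y0) ^ 2 <= r ^ 2 -> 0 <= w x y) ->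
  (forall x y, (x - x0) ^ 2 + (y - y0) ^ 2 < r ^ 2 ->
     is_derive (fun t => w t y) x (w1 x y) /\ is_derive (fun t => w x t) y (w2 x y) /\
     is_derive (fun t => w1 t y) x (w11 x y) /\ is_derive (fun t => w2 x t) y (w22 x y) /\
     w11 x y + w22 x y <= C * w x y) ->
  0 < w x0 y0 ->
  exists k : R, 0 < k /\ forall x y, (x - x0) ^ 2 + (y - y0) ^ 2 <= r ^ 2 ->
    k * (r ^ 2 - ((x - x0) ^ 2 + (y - y0) ^ 2)) <= w x y.
Proof.
  intros Hr HC Hcont Hpos Hder Hw0.
  destruct (Hcont x0 y0 ltac:(cbv beta; rewrite !Rminus_diag; nra) (w x0 y0 / 2) ltac:(lra))
    as (d & Hd & Hnear).
  set (m0 := w x0 y0 / 2) in *.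
  (* With N the squared distance to the centre, al N >= 2 as soon as N >= d^2, hence 4 al^2 N - 4 al
     >= 4 al >= C + 1. *)
  set (al := 2 / d ^ 2 + C + 1).
  assert (Hd2 : 0 < d ^ 2) by (now apply pow_lt).
  assert (Hal2 : 0 < 2 / d ^ 2) by (apply Rdiv_lt_0_compat; lra).
  assert (Hald : 2 / d ^ 2 * d ^ 2 = 2) by (field; lra).
  assert (Hal : 0 < al) by (unfold al; lra).
  set (N := fun x y => (x - x0) ^ 2 + (y - y0) ^ 2) in *.
  set (E := fun x y => exp (- al * N x y)).
  set (E0 := exp (- al * r ^ 2)).
  assert (HE0 : 0 < E0) by apply exp_pos.
  set (phi := fun x y => w x y + - m0 * (E x y - E0)).
  assert (HNp : forall x y, 0 <= N x y).
  { intros x y. unfold N. pose proof (pow2_ge_0 (x - x0)). pose proof (pow2_ge_0 (y - y0)). lra. }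
  assert (HE1 : forall x y, E x y <= 1).
  { intros x y. unfold E. rewrite <- exp_0.
    assert (Hle : - al * N x y <= 0) by (pose proof (HNp x y); nra).
    destruct Hle as [Hlt| ->]; [left; now apply exp_increasing|right; reflexivity]. }
  assert (Hphi : forall x y, N x y <= r ^ 2 -> 0 <= phi x y).
  { destruct (compact_min (fun x y => N x y <= r ^ 2) phi) as (x & y & Hin & Hmin).
    - apply compact_disk.
    - apply continuous_2d_on_plus; [exact Hcont|]. apply continuous_2d_on_of_pt.
      intros x y _. apply continuity_2d_pt_mult; [apply continuity_2d_pt_const|].
      apply continuity_2d_pt_minus; [|apply continuity_2d_pt_const].
      apply continuity_1d_2d_pt_comp; [apply derivable_continuous_pt, derivable_pt_exp|].
      apply continuity_2d_pt_mult; [apply continuity_2d_pt_const|].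
      unfold N. simpl.
      repeat first [apply continuity_2d_pt_plus|apply continuity_2d_pt_mult
        |apply continuity_2d_pt_minus|apply continuity_2d_pt_const
        |apply continuity_2d_pt_id1|apply continuity_2d_pt_id2].
    - exists x0, y0. unfold N. rewrite !Rminus_diag. nra.
    - assert (Hm : 0 <= phi x y); [|intros x' y' H'; specialize (Hmin x' y' H'); lra].
      (* A negative minimum of [phi] lies neither on the boundary circle, where phi = w, nor in the
         disk of radius d, where w exceeds m0 and m0 bounds m0 E. *)
      apply Rnot_lt_le. intros Hneg.
      assert (Hmp : 0 < m0) by (unfold m0; lra).
      assert (Hrr : N x y < r ^ 2).
      { destruct (Req_dec (N x y) (r ^ 2)) as [He|]; [|lra]. exfalso.
        unfold phi, E in Hneg. rewrite He in Hneg. fold E0 in Hneg.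
        pose proof (Hpos x y Hin). lra. }
      assert (Hout : d ^ 2 <= N x y).
      { apply Rnot_lt_le. intros Hlt. unfold N in Hlt.
        assert (Hx : Rabs (x - x0) < d).
        { rewrite <- (Rabs_pos_eq d) by lra. apply Rsqr_lt_abs_0. rewrite !Rsqr_pow2.
          pose proof (pow2_ge_0 (y - y0)). lra. }
        assert (Hy : Rabs (y - y0) < d).
        { rewrite <- (Rabs_pos_eq d) by lra. apply Rsqr_lt_abs_0. rewrite !Rsqr_pow2.
          pose proof (pow2_ge_0 (x - x0)). lra. }
        specialize (Hnear x y Hin Hx Hy). apply Rabs_def2 in Hnear.
        assert (m0 * E x y <= m0 * 1) by (apply Rmult_le_compat_l; [lra|apply HE1]).
        unfold phi in Hneg. unfold m0 in *. nra. }
      destruct (sum_squares_near (x - x0) (y - y0) (r ^ 2 - N x y) ltac:(lra)) as (d1 & Hd1 & Hn).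
      assert (Hinx : forall t, Rabs (t - x) < d1 -> N t y < r ^ 2).
      { intros t Ht. specialize (Hn (t - x0) (y - y0)).
        replace (t - x0 - (x - x0)) with (t - x) in Hn by ring.
        rewrite Rminus_diag, Rabs_R0 in Hn. specialize (Hn Ht Hd1).
        apply Rabs_def2 in Hn. unfold N in *. lra. }
      assert (Hiny : forall t, Rabs (t - y) < d1 -> N x t < r ^ 2).
      { intros t Ht. specialize (Hn (x - x0) (t - y0)).
        replace (t - y0 - (y - y0)) with (t - y) in Hn by ring.
        rewrite Rminus_diag, Rabs_R0 in Hn. specialize (Hn Hd1 Ht).
        apply Rabs_def2 in Hn. unfold N in *. lra. }
      destruct (Hder x y Hrr) as (_ & _ & H11 & H22 & Hlap).
      destruct (second_derivative_at_min (fun t => phi t y)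
        (fun t => w1 t y + m0 * (2 * al * (t - x0) * E t y)) x
        (w11 x y + m0 * (2 * al - 4 * al ^ 2 * (x - x0) ^ 2) * E x y)) as [_ Hxx].
      { apply locally_of_abs with d1; [exact Hd1|]. intros t Ht. unfold phi.
        apply (is_derive_plus (fun t => w t y)); [apply Hder, Hinx, Ht|].
        unfold E, N. auto_derive; [trivial|]. unfold Rminus. simpl. ring. }
      { apply is_derive_ext with (fun t => plus (w1 t y) (m0 * (2 * al * (t - x0) * E t y)));
          [reflexivity|].
        replace (m0 * (2 * al - 4 * al ^ 2 * (x - x0) ^ 2) * E x y) with
          (m0 * (2 * al * E x y + 2 * al * (x - x0) * (- al * (2 * (x - x0)) * E x y))) by ring.
        apply (is_derive_plus (fun t => w1 t y)); [exact H11|].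
        unfold E, N. auto_derive; [trivial|]. unfold Rminus. simpl. ring. }
      { apply locally_of_abs with d1; [exact Hd1|]. intros t Ht. apply Hmin.
        specialize (Hinx t Ht). lra. }
      destruct (second_derivative_at_min (fun t => phi x t)
        (fun t => w2 x t + m0 * (2 * al * (t - y0) * E x t)) y
        (w22 x y + m0 * (2 * al - 4 * al ^ 2 * (y - y0) ^ 2) * E x y)) as [_ Hyy].
      { apply locally_of_abs with d1; [exact Hd1|]. intros t Ht. unfold phi.
        apply (is_derive_plus (fun t => w x t)); [apply Hder, Hiny, Ht|].
        unfold E, N. auto_derive; [trivial|]. unfold Rminus. simpl. ring. }
      { replace (m0 * (2 * al - 4 * al ^ 2 * (y - y0) ^ 2) * E x y) with
          (m0 * (2 * al * E x y + 2 * al * (y - y0) * (- al * (2 * (y - y0)) * E x y))) by ring.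
        apply (is_derive_plus (fun t => w2 x t)); [exact H22|].
        unfold E, N. auto_derive; [trivial|]. unfold Rminus. simpl. ring. }
      { apply locally_of_abs with d1; [exact Hd1|]. intros t Ht. apply Hmin.
        specialize (Hiny t Ht). lra. }
      assert (HE : 0 < E x y) by apply exp_pos.
      (* The Laplacian of [phi] is nonnegative at the minimum. This contradicts Delta w <= C w <= C
         m0 (E - E0) together with Delta E = (4 al^2 N - 4 al) E >= (C + 1) E. *)
      assert (Hsum : 0 <= w11 x y + w22 x y + m0 * (4 * al - 4 * al ^ 2 * N x y) * E x y).
      { unfold N at 1. nra. }
      assert (Hcw : C * w x y <= C * (m0 * (E x y - E0))).
      { apply Rmult_le_compat_l; [exact HC|]. unfold phi in Hneg. lra. }
      assert (HaN : 2 <= al * N x y).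
      { rewrite <- Hald. apply Rmult_le_compat; unfold al; lra. }
      assert (Hfac : C + 1 <= 4 * al ^ 2 * N x y - 4 * al).
      { replace (4 * al ^ 2 * N x y - 4 * al) with (4 * al * (al * N x y - 1)) by ring.
        assert (4 * al * 1 <= 4 * al * (al * N x y - 1)) by (apply Rmult_le_compat_l; lra).
        unfold al in *. lra. }
      assert (m0 * E x y * (C + 1) <= m0 * E x y * (4 * al ^ 2 * N x y - 4 * al)).
      { apply Rmult_le_compat_l; [|exact Hfac]. apply Rmult_le_pos; lra. }
      assert (0 < m0 * E x y) by now apply Rmult_lt_0_compat.
      assert (0 <= C * (m0 * E0)) by (apply Rmult_le_pos; [|apply Rmult_le_pos]; lra).
      nra. }
  exists (m0 * (E0 * al)). split; [repeat apply Rmult_lt_0_compat; unfold m0 in *; lra|].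
  intros x y Hin. pose proof (Hphi x y Hin) as Hp. unfold phi in Hp.
  fold (N x y).
  (* Convexity of the exponential bounds the barrier below by a multiple of r^2 - N. *)
  assert (HEE : E0 * (1 + al * (r ^ 2 - N x y)) <= E x y).
  { replace (E x y) with (E0 * exp (al * (r ^ 2 - N x y))).
    - apply Rmult_le_compat_l; [lra|]. apply exp_ineq1_le.
    - unfold E, E0. rewrite <- exp_plus. f_equal. ring. }
  assert (m0 * (E0 * (1 + al * (r ^ 2 - N x y))) <= m0 * E x y).
  { apply Rmult_le_compat_l; [unfold m0; lra|exact HEE]. }
  lra.
Qed.

(** * Reflections in the lines x = l *)

Section MovingPlanes.

Variables (a b c K : R) (u u1 u2 u11 u22 : R -> R -> R).
Hypotheses (Ha : 0 < a) (Hab : a < b) (Hc : 0 < c) (HK : 0 < K).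
Hypotheses (Hu : continuous_2d_on (ring_closed a b) u)
  (Hu1 : continuous_2d_on (ring_closed a b) u1).
Hypothesis Hder : forall x y, ring_open a b x y ->
  is_derive (fun t => u t y) x (u1 x y) /\ is_derive (fun t => u x t) y (u2 x y) /\
  is_derive (fun t => u1 t y) x (u11 x y) /\ is_derive (fun t => u2 x t) y (u22 x y).
Hypothesis Hlap : forall x y x' y', ring_open a b x y -> ring_open a b x' y' ->
  Rabs (u11 x' y' + u22 x' y' - (u11 x y + u22 x y)) <= K * Rabs (u x' y' - u x y).
Hypotheses (Hin : forall x y, x ^ 2 + y ^ 2 = a ^ 2 -> u x y = 0)
  (Hout : forall x y, x ^ 2 + y ^ 2 = b ^ 2 -> u x y = c)
  (Hmid : forall x y, ring_open a b x y -> 0 < u x y < c).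
Hypothesis Hbd : forall x y, x ^ 2 + y ^ 2 = a ^ 2 \/ x ^ 2 + y ^ 2 = b ^ 2 ->
  0 < x -> 0 < u1 x y.

(** The points beyond the line whose mirror image is not hidden in the hole. For l >= 0 a point and
    its image both lie in the closed ring, since the image is no farther from the origin. *)
Definition cap (l x y : R) : Prop :=
  l <= x /\ x ^ 2 + y ^ 2 <= b ^ 2 /\ a ^ 2 <= (2 * l - x) ^ 2 + y ^ 2.

Definition reflection_le (l : R) : Prop :=
  forall x y : R, cap l x y -> u (2 * l - x) y <= u x y.

Lemma reflection_norm (l x y : R) :
  0 <= l -> l <= x -> (2 * l - x) ^ 2 + y ^ 2 <= x ^ 2 + y ^ 2.
Proof. intros Hl Hx. nra. Qed.

Lemma reflection_norm_lt (l x y : R) :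
  0 < l -> l < x -> (2 * l - x) ^ 2 + y ^ 2 < x ^ 2 + y ^ 2.
Proof. intros Hl Hx. nra. Qed.

Lemma ring_value_range (x y : R) : ring_closed a b x y -> 0 <= u x y <= c.
Proof.
  intros [H1 H2]. destruct (Req_dec (x ^ 2 + y ^ 2) (a ^ 2)) as [He|Hn].
  { rewrite (Hin x y He). lra. }
  destruct (Req_dec (x ^ 2 + y ^ 2) (b ^ 2)) as [He|Hn'].
  { rewrite (Hout x y He). lra. }
  pose proof (Hmid x y ltac:(split; lra)). lra.
Qed.

Lemma reflection_lt_boundary (l x y : R) :
  0 < l -> l < x -> cap l x y ->
  x ^ 2 + y ^ 2 = b ^ 2 \/ (2 * l - x) ^ 2 + y ^ 2 = a ^ 2 ->
  u (2 * l - x) y < u x y.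
Proof.
  intros Hl Hx (_ & H1 & H2) He. pose proof (reflection_norm_lt l x y Hl Hx) as Hn.
  assert (Hab2 : a ^ 2 < b ^ 2) by nra.
  destruct He as [He|He].
  - rewrite (Hout x y He).
    destruct (Req_dec ((2 * l - x) ^ 2 + y ^ 2) (a ^ 2)) as [Hi|Hi].
    + rewrite (Hin _ _ Hi). lra.
    + apply Hmid. split; lra.
  - rewrite (Hin _ _ He).
    destruct (Req_dec (x ^ 2 + y ^ 2) (b ^ 2)) as [Ho|Ho].
    + rewrite (Hout x y Ho). lra.
    + apply Hmid. split; lra.
Qed.

Lemma reflected_near (l x y e : R) : 0 < e ->
  exists d : R, 0 < d /\ d <= e /\ forall l' u v : R,
    Rabs (l' - l) < d -> Rabs (u - x) < d -> Rabs (v - y) < d ->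
    Rabs ((u ^ 2 + v ^ 2) - (x ^ 2 + y ^ 2)) < e /\
    Rabs (((2 * l' - u) ^ 2 + v ^ 2) - ((2 * l - x) ^ 2 + y ^ 2)) < e /\
    Rabs (2 * l' - u - (2 * l - x)) < e.
Proof.
  intros He.
  destruct (sum_squares_near x y e He) as (d1 & Hd1 & H1).
  destruct (sum_squares_near (2 * l - x) y e He) as (d2 & Hd2 & H2).
  set (d := Rmin e (Rmin d1 d2)).
  assert (Hd : 0 < d /\ d <= e /\ d <= d1 /\ d <= d2).
  { unfold d. pose proof (Rmin_l e (Rmin d1 d2)). pose proof (Rmin_r e (Rmin d1 d2)).
    pose proof (Rmin_l d1 d2). pose proof (Rmin_r d1 d2).
    repeat split; try lra. repeat apply Rmin_glb_lt; lra. }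
  exists (d / 3). split; [lra|]. split; [lra|]. intros l' x' y' Hl Hx Hy.
  assert (Hr : Rabs (2 * l' - x' - (2 * l - x)) < d).
  { replace (2 * l' - x' - (2 * l - x)) with (2 * (l' - l) - (x' - x)) by ring.
    apply Rle_lt_trans with (1 := Rabs_triang _ _).
    rewrite Rabs_Ropp, Rabs_mult, (Rabs_pos_eq 2) by lra. lra. }
  split; [apply H1; lra|]. split; [apply H2; lra|lra].
Qed.

(** The difference w between u and its reflection is nonnegative on the disk, so the Lipschitz bound
    on the Laplacian reads Delta w <= K w, as Hopf's barrier requires. Differentiation in x changes
    the sign of the reflected term, whence the sum of the two values of u1. *)
Lemma reflection_hopf (l x0 y0 r : R) :
  0 <= l -> reflection_le l -> 0 < r ->
  (forall x y, (x - x0) ^ 2 + (y - y0) ^ 2 <= r ^ 2 ->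
     l <= x /\ x ^ 2 + y ^ 2 < b ^ 2 /\ a ^ 2 < (2 * l - x) ^ 2 + y ^ 2) ->
  0 < u x0 y0 - u (2 * l - x0) y0 ->
  exists k : R, 0 < k /\ forall x y, (x - x0) ^ 2 + (y - y0) ^ 2 <= r ^ 2 ->
    k * (r ^ 2 - ((x - x0) ^ 2 + (y - y0) ^ 2)) <= u x y - u (2 * l - x) y.
Proof.
  intros Hl HP Hr Hball H0.
  assert (Hring : forall x y, (x - x0) ^ 2 + (y - y0) ^ 2 <= r ^ 2 ->
    ring_open a b x y /\ ring_open a b (2 * l - x) y).
  { intros x y H. destruct (Hball x y H) as (H1 & H2 & H3).
    pose proof (reflection_norm l x y Hl H1). split; split; lra. }
  apply (hopf_barrier (fun x y => u x y - u (2 * l - x) y)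
    (fun x y => u1 x y + u1 (2 * l - x) y) (fun x y => u2 x y - u2 (2 * l - x) y)
    (fun x y => u11 x y - u11 (2 * l - x) y) (fun x y => u22 x y - u22 (2 * l - x) y)
    x0 y0 r K Hr); [lra| | | |exact H0].
  - intros x y H e He. destruct (Hring x y H) as [[H1 H2] [H3 H4]].
    destruct (Hu x y ltac:(split; lra) (e / 2) ltac:(lra)) as (d1 & Hd1 & Hc1).
    destruct (Hu (2 * l - x) y ltac:(split; lra) (e / 2) ltac:(lra)) as (d2 & Hd2 & Hc2).
    exists (Rmin d1 d2). split; [now apply Rmin_glb_lt|].
    intros x' y' H' Hx Hy. pose proof (Rmin_l d1 d2). pose proof (Rmin_r d1 d2).
    destruct (Hring x' y' H') as [[H1' H2'] [H3' H4']].
    specialize (Hc1 x' y' ltac:(split; lra) ltac:(lra) ltac:(lra)).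
    specialize (Hc2 (2 * l - x') y' ltac:(split; lra)).
    replace (2 * l - x' - (2 * l - x)) with (- (x' - x)) in Hc2 by ring.
    rewrite Rabs_Ropp in Hc2. specialize (Hc2 ltac:(lra) ltac:(lra)).
    apply Rabs_def2 in Hc1, Hc2. apply Rabs_def1; lra.
  - intros x y H. destruct (Hball x y H) as (H1 & H2 & H3).
    pose proof (HP x y ltac:(unfold cap; lra)). lra.
  - intros x y H. destruct (Hring x y ltac:(lra)) as [Hr1 Hr2].
    destruct (Hder _ _ Hr1) as (D1 & D2 & D11 & D22).
    destruct (Hder _ _ Hr2) as (E1 & E2 & E11 & E22).
    assert (Hrefl : forall f df, is_derive (fun t => f t y) (2 * l - x) df ->
      is_derive (fun t => f (2 * l - t) y) x (- df)).
    { intros f df Hf. replace (- df) with (scal (-1) df) by (unfold scal; simpl; unfold mult; simpl; ring).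
      apply (is_derive_comp (fun t => f t y) (fun t => 2 * l - t)); [exact Hf|].
      auto_derive; [trivial|ring]. }
    split; [|split; [|split; [|split]]].
    + replace (u1 x y + u1 (2 * l - x) y) with (minus (u1 x y) (- u1 (2 * l - x) y))
        by (unfold minus, plus, opp; simpl; ring).
      apply (is_derive_minus (fun t => u t y)); [exact D1|]. now apply Hrefl.
    + apply (is_derive_minus (fun t => u x t)); assumption.
    + apply (is_derive_plus (fun t => u1 t y)); [exact D11|]. now apply Hrefl.
    + apply (is_derive_minus (fun t => u2 x t)); assumption.
    + destruct (Hball x y ltac:(lra)) as (H1 & H2 & H3).
      pose proof (HP x y ltac:(unfold cap; lra)) as Hle.
      pose proof (Hlap _ _ _ _ Hr2 Hr1) as Hl'.
      rewrite (Rabs_pos_eq (u x y - _)) in Hl' by lra.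
      apply Rabs_le_between in Hl'. lra.
Qed.

(* A zero of the difference propagates along the ray in the direction [e1], up to the boundary of the cap, where the difference is positive. *)
Lemma reflection_lt (l x y : R) :
  0 < l -> reflection_le l -> l < x -> cap l x y -> u (2 * l - x) y < u x y.
Proof.
  intros Hl HP Hx Hcap.
  destruct (HP x y Hcap) as [|He]; [assumption|exfalso].
  (* [Z s] says that the difference vanishes on a whole horizontal segment of length s. The supremum
     is attained by continuity, it is an interior point of the cap because the inequality is strict
     at the boundary, and Hopf's barrier extends the segment beyond it. *)
  set (Z := fun s => 0 <= s /\ forall s', 0 <= s' <= s ->
    cap l (x + s') y /\ u (2 * l - (x + s')) y = u (x + s') y).
  assert (Hb0 : forall s, Z s -> s <= b).
  { intros s [Hs Hz]. destruct (Hz s ltac:(lra)) as [(_ & H1 & _) _].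
    apply Rnot_lt_le. intros Hlt. nra. }
  destruct (completeness Z) as [s [Hub Hlub]].
  { exists b. intros s Hs. now apply Hb0. }
  { exists 0. split; [lra|]. intros s' Hs'. replace s' with 0 by lra.
    rewrite Rplus_0_r. now split. }
  assert (Hs0 : 0 <= s).
  { apply Hub. split; [lra|]. intros s' Hs'. replace s' with 0 by lra.
    rewrite Rplus_0_r. now split. }
  assert (Hbelow : forall s', 0 <= s' < s ->
    cap l (x + s') y /\ u (2 * l - (x + s')) y = u (x + s') y).
  { intros s' Hs'. assert (exists s1, Z s1 /\ s' < s1) as (s1 & [_ H1] & Hlt).
    { apply NNPP. intros Hn. assert (s <= s'); [|lra]. apply Hlub. intros s1 H1.
      apply Rnot_lt_le. intros Hlt. apply Hn. now exists s1. }
    apply H1. lra. }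
  assert (Happr : forall e, 0 < e -> exists s', 0 <= s' <= s /\ s - s' < e /\
    cap l (x + s') y /\ u (2 * l - (x + s')) y = u (x + s') y).
  { intros e Hep. destruct (Req_dec s 0) as [Hz|Hz].
    - exists 0. rewrite Rplus_0_r. repeat split; try lra; apply Hcap || auto.
    - exists (Rmax 0 (s - e / 2)).
      assert (0 <= Rmax 0 (s - e / 2) < s /\ s - Rmax 0 (s - e / 2) < e)
        by (unfold Rmax; destruct (Rle_dec _ _); lra).
      split; [lra|]. split; [lra|]. apply Hbelow. lra. }
  assert (Hcs : cap l (x + s) y).
  { split; [lra|].
    split; apply Rnot_lt_le; intros Hlt.
    - destruct (reflected_near l (x + s) y ((x + s) ^ 2 + y ^ 2 - b ^ 2) ltac:(lra))
        as (d & Hd & _ & Hn).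
      destruct (Happr d Hd) as (s' & Hs' & Hsd & (_ & Hcap1 & _) & _).
      destruct (Hn l (x + s') y) as (H1 & _ & _).
      { now apply Rabs_self_lt. }
      { apply Rabs_def1; lra. }
      { now apply Rabs_self_lt. }
      apply Rabs_def2 in H1. lra.
    - destruct (reflected_near l (x + s) y (a ^ 2 - ((2 * l - (x + s)) ^ 2 + y ^ 2)) ltac:(lra))
        as (d & Hd & _ & Hn).
      destruct (Happr d Hd) as (s' & Hs' & Hsd & (_ & _ & Hcap1) & _).
      destruct (Hn l (x + s') y) as (_ & H1 & _).
      { now apply Rabs_self_lt. }
      { apply Rabs_def1; lra. }
      { now apply Rabs_self_lt. }
      apply Rabs_def2 in H1. lra. }
  assert (Hring : forall z, l <= z -> cap l z y ->
    ring_closed a b z y /\ ring_closed a b (2 * l - z) y).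
  { intros z Hz (_ & H1 & H2). pose proof (reflection_norm l z y ltac:(lra) Hz).
    split; split; lra. }
  assert (Hws : u (2 * l - (x + s)) y = u (x + s) y).
  { apply Rminus_diag_uniq. apply NNPP. intros Hne.
    set (e := Rabs (u (2 * l - (x + s)) y - u (x + s) y)).
    assert (Hep : 0 < e) by now apply Rabs_pos_lt.
    destruct (Hring (x + s) ltac:(lra) Hcs) as [Hr1 Hr2].
    destruct (Hu _ _ Hr1 (e / 2) ltac:(lra)) as (d1 & Hd1 & Hc1).
    destruct (Hu _ _ Hr2 (e / 2) ltac:(lra)) as (d2 & Hd2 & Hc2).
    destruct (Happr (Rmin d1 d2)) as (s' & Hs' & Hsd & Hcap1 & Heq).
    { now apply Rmin_glb_lt. }
    pose proof (Rmin_l d1 d2). pose proof (Rmin_r d1 d2).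
    destruct (Hring (x + s') ltac:(lra) Hcap1) as [Hr1' Hr2'].
    specialize (Hc1 _ _ Hr1'). specialize (Hc2 _ _ Hr2').
    rewrite Rminus_diag, Rabs_R0 in Hc1, Hc2.
    specialize (Hc1 ltac:(apply Rabs_def1; lra) Hd1).
    specialize (Hc2 ltac:(apply Rabs_def1; lra) Hd2).
    rewrite Heq in Hc2.
    assert (e < e); [|lra]. unfold e at 1.
    replace (u (2 * l - (x + s)) y - u (x + s) y) with
      ((u (x + s') y - u (x + s) y) - (u (x + s') y - u (2 * l - (x + s)) y)) by ring.
    apply Rle_lt_trans with (1 := Rabs_triang _ _). rewrite Rabs_Ropp. lra. }
  assert (Hint : (x + s) ^ 2 + y ^ 2 < b ^ 2 /\ a ^ 2 < (2 * l - (x + s)) ^ 2 + y ^ 2).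
  { destruct Hcs as (H1 & H2 & H3).
    split; apply Rnot_le_lt; intros Hle;
      pose proof (reflection_lt_boundary l (x + s) y Hl ltac:(lra) ltac:(unfold cap; lra)
        ltac:(first [left; lra|right; lra])); lra. }
  set (e := Rmin (x - l) (Rmin (b ^ 2 - ((x + s) ^ 2 + y ^ 2))
    ((2 * l - (x + s)) ^ 2 + y ^ 2 - a ^ 2))).
  assert (Hep : 0 < e /\ e <= x - l /\ e <= b ^ 2 - ((x + s) ^ 2 + y ^ 2) /\
    e <= (2 * l - (x + s)) ^ 2 + y ^ 2 - a ^ 2).
  { unfold e. destruct Hint. repeat split; repeat apply Rmin_glb_lt; try lra.
    - apply Rmin_l.
    - apply Rle_trans with (1 := Rmin_r _ _), Rmin_l.
    - apply Rle_trans with (1 := Rmin_r _ _), Rmin_r. }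
  destruct (reflected_near l (x + s) y e ltac:(lra)) as (d & Hd & Hde & Hn).
  assert (Hball : forall x0, Rabs (x0 - (x + s)) < d / 2 ->
    forall x' y', (x' - x0) ^ 2 + (y' - y) ^ 2 <= (d / 2) ^ 2 ->
    l < x' /\ x' ^ 2 + y' ^ 2 < b ^ 2 /\ a ^ 2 < (2 * l - x') ^ 2 + y' ^ 2).
  { intros x0 Hx0 x' y' H.
    destruct (disk_coordinates _ _ (d / 2) ltac:(lra) H) as [H1 H2].
    assert (H3 : Rabs (x' - (x + s)) < d).
    { replace (x' - (x + s)) with ((x' - x0) + (x0 - (x + s))) by ring.
      apply Rle_lt_trans with (1 := Rabs_triang _ _). lra. }
    destruct (Hn l x' y') as (H4 & H5 & _); try assumption; try lra.
    { now apply Rabs_self_lt. }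
    apply Rabs_def2 in H3, H4, H5. lra. }
  assert (HZ : Z (s + d / 4)); [|specialize (Hub _ HZ); lra].
  split; [lra|]. intros s' Hs'.
  destruct (Rlt_le_dec s' s) as [Hlt|Hge]; [apply Hbelow; lra|].
  assert (Hx0 : Rabs (x + s' - (x + s)) < d / 2) by (apply Rabs_def1; lra).
  assert (Hcap' : cap l (x + s') y).
  { destruct (Hball _ Hx0 (x + s') y) as (H1 & H2 & H3); [rewrite !Rminus_diag; nra|].
    unfold cap; lra. }
  split; [exact Hcap'|].
  apply Rle_antisym; [now apply HP|]. apply Rnot_lt_le. intros Hlt.
  (* A positive value at x + s' would spread, by the barrier, to the whole open disk of radius d /
     2, which contains the zero at x + s. *)
  destruct (reflection_hopf l (x + s') y (d / 2)) as (k & Hk & Hkb); try lra; auto.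
  { intros x' y' H'. destruct (Hball _ Hx0 x' y' H') as (H1 & H2 & H3). lra. }
  specialize (Hkb (x + s) y).
  replace (x + s - (x + s')) with (- (s' - s)) in Hkb by ring.
  rewrite Rminus_diag, Hws in Hkb.
  assert (Hsq : (- (s' - s)) ^ 2 + 0 ^ 2 < (d / 2) ^ 2).
  { replace ((- (s' - s)) ^ 2 + 0 ^ 2) with ((s' - s) ^ 2) by ring. nra. }
  specialize (Hkb ltac:(lra)).
  assert (0 < k * ((d / 2) ^ 2 - ((- (s' - s)) ^ 2 + 0 ^ 2))) by (apply Rmult_lt_0_compat; lra).
  lra.
Qed.

(** The difference vanishes on the axis. On a disk of radius r tangent to the axis at (l, y), the
    barrier bounds it below by k h (2 r - h) >= k r h at distance h, while its derivative there is 2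
    u1. On the boundary circles [Hbd] applies. *)
Lemma reflection_derivative_pos (l y : R) :
  0 < l -> reflection_le l -> cap l l y -> 0 < u1 l y.
Proof.
  intros Hl HP (_ & Hc1 & Hc2). replace (2 * l - l) with l in Hc2 by ring.
  destruct (Req_dec (l ^ 2 + y ^ 2) (a ^ 2)) as [He|Hn1]; [apply Hbd; tauto|].
  destruct (Req_dec (l ^ 2 + y ^ 2) (b ^ 2)) as [He|Hn2]; [apply Hbd; tauto|].
  set (e := Rmin (b ^ 2 - (l ^ 2 + y ^ 2)) (l ^ 2 + y ^ 2 - a ^ 2)).
  assert (Hep : 0 < e /\ e <= b ^ 2 - (l ^ 2 + y ^ 2) /\ e <= l ^ 2 + y ^ 2 - a ^ 2).
  { unfold e. repeat split; [apply Rmin_glb_lt; lra|apply Rmin_l|apply Rmin_r]. }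
  destruct (reflected_near l l y e ltac:(lra)) as (d & Hd & _ & Hn).
  set (r := d / 3).
  assert (Hball : forall x' y', (x' - (l + r)) ^ 2 + (y' - y) ^ 2 <= r ^ 2 ->
    l <= x' /\ x' ^ 2 + y' ^ 2 < b ^ 2 /\ a ^ 2 < (2 * l - x') ^ 2 + y' ^ 2).
  { intros x' y' H. assert (Hr : 0 < r) by (unfold r; lra).
    destruct (disk_coordinates _ _ r ltac:(lra) H) as [H1 H2].
    apply Rabs_le_between in H1.
    destruct (Hn l x' y') as (H4 & H5 & _).
    { now apply Rabs_self_lt. }
    { unfold r in *. apply Rabs_def1; lra. }
    { unfold r in *. lra. }
    replace (2 * l - l) with l in H5 by ring.
    apply Rabs_def2 in H4, H5. lra. }
  assert (Hr : 0 < r) by (unfold r; lra).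
  destruct (reflection_hopf l (l + r) y r) as (k & Hk & Hkb); try lra; auto.
  { destruct (Hball (l + r) y) as (H1 & H2 & H3); [rewrite !Rminus_diag; nra|].
    pose proof (reflection_lt l (l + r) y Hl HP ltac:(lra) ltac:(unfold cap; lra)). lra. }
  assert (Hgrow : forall h, 0 < h < r -> k * r * h <= u (l + h) y - u (2 * l - (l + h)) y).
  { intros h Hh. specialize (Hkb (l + h) y).
    replace (l + h - (l + r)) with (h - r) in Hkb by ring. rewrite Rminus_diag in Hkb.
    specialize (Hkb ltac:(nra)).
    apply Rle_trans with (2 := Hkb). rewrite Rmult_assoc. apply Rmult_le_compat_l; [lra|]. nra. }
  assert (Hring : ring_open a b l y) by (split; lra).
  destruct (Hder _ _ Hring) as (D1 & _).
  assert (D : is_derive (fun t => u t y - u (2 * l - t) y) l (2 * u1 l y)).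
  { replace (2 * u1 l y) with (minus (u1 l y) (scal (-1) (u1 l y)))
      by (unfold minus, plus, opp, scal; simpl; unfold mult; simpl; ring).
    apply (is_derive_minus (fun t => u t y)); [exact D1|].
    apply (is_derive_comp (fun t => u t y) (fun t => 2 * l - t)).
    - replace (2 * l - l) with l by ring. exact D1.
    - auto_derive; [trivial|ring]. }
  apply is_derive_Reals in D.
  assert (Hkr : 0 < k * r) by now apply Rmult_lt_0_compat.
  destruct (D (k * r / 2) ltac:(lra)) as [d' Hd'].
  set (h := Rmin d' r / 2).
  assert (Hh : 0 < h /\ h < d' /\ h < r).
  { unfold h. pose proof (cond_pos d'). pose proof (Rmin_l d' r). pose proof (Rmin_r d' r).
    assert (0 < Rmin d' r) by (apply Rmin_glb_lt; lra). lra. }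
  specialize (Hd' h ltac:(lra) ltac:(rewrite Rabs_pos_eq; lra)).
  replace (2 * l - l) with l in Hd' by ring.
  specialize (Hgrow h ltac:(lra)).
  apply Rabs_def2 in Hd'.
  assert (Hq : k * r <= (u (l + h) y - u (2 * l - (l + h)) y - (u l y - u l y)) / h).
  { apply Rmult_le_reg_r with h; [lra|].
    replace ((u (l + h) y - u (2 * l - (l + h)) y - (u l y - u l y)) / h * h) with
      (u (l + h) y - u (2 * l - (l + h)) y) by (field; lra). exact Hgrow. }
  lra.
Qed.

(** Near each point of the square either the cap is avoided, or the strict inequality of
    [reflection_lt] persists, or the point is on the axis. There u1 is positive nearby, and the mean
    value theorem between the two mirror points concludes. Compactness makes the step uniform. *)
Lemma reflection_step (l : R) :
  0 < l <= b -> reflection_le l ->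
  exists d : R, 0 < d /\ forall l', l - d < l' <= l -> reflection_le l'.
Proof.
  intros [Hl Hlb] HP.
  destruct (local_to_uniform_2d (-b) b (-b) b
    (fun e x y => forall l', 0 < l' -> l - e < l' <= l -> cap l' x y ->
       u (2 * l' - x) y <= u x y)) as (e & He & H).
  - intros e e' x y Hle H l' Hl' Hle'. apply H; lra.
  - intros x y _ _.
    destruct (Rlt_le_dec (b ^ 2) (x ^ 2 + y ^ 2)) as [Hb1|Hb1].
    { destruct (reflected_near l x y (x ^ 2 + y ^ 2 - b ^ 2) ltac:(lra)) as (d & Hd & _ & Hn).
      exists d. split; [exact Hd|]. intros x' y' Hx Hy l' _ Hl' (_ & Hc1 & _). exfalso.
      destruct (Hn l' x' y') as (H1 & _); try assumption; [apply Rabs_def1; lra|].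
      apply Rabs_def2 in H1. lra. }
    destruct (Rlt_le_dec ((2 * l - x) ^ 2 + y ^ 2) (a ^ 2)) as [Ha1|Ha1].
    { destruct (reflected_near l x y (a ^ 2 - ((2 * l - x) ^ 2 + y ^ 2)) ltac:(lra))
        as (d & Hd & _ & Hn).
      exists d. split; [exact Hd|]. intros x' y' Hx Hy l' _ Hl' (_ & _ & Hc1). exfalso.
      destruct (Hn l' x' y') as (_ & H1 & _); try assumption; [apply Rabs_def1; lra|].
      apply Rabs_def2 in H1. lra. }
    destruct (Rtotal_order x l) as [Hx|[Hx|Hx]].
    + exists ((l - x) / 2). split; [lra|]. intros x' y' Hx' _ l' _ Hl' (Hc1 & _). exfalso.
      apply Rabs_def2 in Hx'. lra.
    + subst x. assert (Hcap : cap l l y) by (unfold cap; lra).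
      pose proof (reflection_derivative_pos l y Hl HP Hcap) as Hp.
      replace (2 * l - l) with l in Ha1 by ring.
      destruct (Hu1 l y ltac:(split; lra) (u1 l y) Hp) as (d & Hd & Hn).
      (* The condition 4 e <= l keeps the segment between mirror points in the half-plane x > 0,
         where z^2 is monotone, so that the segment stays in the ring. *)
      set (e := Rmin l d / 4).
      assert (He : 0 < e /\ 4 * e <= l /\ 4 * e <= d).
      { unfold e. pose proof (Rmin_l l d). pose proof (Rmin_r l d).
        assert (0 < Rmin l d) by now apply Rmin_glb_lt. lra. }
      exists e. split; [lra|]. intros x' y' Hx' Hy' l' Hl'0 Hl' (Hc1 & Hc2 & Hc3).
      destruct (Req_dec x' l') as [->|Hne].
      { replace (2 * l' - l') with l' by ring. lra. }
      apply Rabs_def2 in Hx'.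
      assert (Hz : forall z, 2 * l' - x' <= z <= x' -> ring_closed a b z y').
      { intros z Hz. split; nra. }
      assert (Hzo : forall z, 2 * l' - x' < z < x' -> ring_open a b z y').
      { intros z Hz'. split; nra. }
      destruct (MVT_within (fun t => u t y') (fun t => u1 t y') (2 * l' - x') x')
        as (z & Hz1 & Hz2); try lra.
      * intros z Hz'. now apply Hder, Hzo.
      * intros z Hz' eps Heps.
        destruct (Hu z y' ltac:(apply Hz; lra) eps Heps) as (d1 & Hd1 & Hn1).
        exists d1. split; [exact Hd1|]. intros t Ht Htz. apply Hn1; [now apply Hz|exact Htz|].
        now apply Rabs_self_lt.
      * assert (Hpos : 0 < u1 z y').
        { pose proof (Hzo z Hz1) as [Ho1 Ho2].
          specialize (Hn z y' ltac:(split; lra) ltac:(apply Rabs_def1; lra) ltac:(lra)).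
          apply Rabs_def2 in Hn. lra. }
        assert (0 <= u1 z y' * (x' - (2 * l' - x'))) by (apply Rmult_le_pos; lra). lra.
    + assert (Hcap : cap l x y) by (unfold cap; lra).
      pose proof (reflection_lt l x y Hl HP Hx Hcap) as Hlt.
      pose proof (reflection_norm l x y ltac:(lra) ltac:(lra)).
      set (g := u x y - u (2 * l - x) y).
      destruct (Hu x y ltac:(split; lra) (g / 2) ltac:(unfold g; lra)) as (d1 & Hd1 & H1).
      destruct (Hu (2 * l - x) y ltac:(split; lra) (g / 2) ltac:(unfold g; lra))
        as (d2 & Hd2 & H2).
      destruct (reflected_near l x y (Rmin d1 d2)) as (d & Hd & Hde & Hn).
      { now apply Rmin_glb_lt. }
      pose proof (Rmin_l d1 d2). pose proof (Rmin_r d1 d2).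
      exists d. split; [exact Hd|]. intros x' y' Hx' Hy' l' Hl'0 Hl' (Hc1 & Hc2 & Hc3).
      destruct (Hn l' x' y') as (_ & _ & Hrd); try assumption; [apply Rabs_def1; lra|].
      pose proof (reflection_norm l' x' y' ltac:(lra) Hc1).
      specialize (H1 x' y' ltac:(split; lra) ltac:(lra) ltac:(lra)).
      specialize (H2 (2 * l' - x') y' ltac:(split; lra) ltac:(lra) ltac:(lra)).
      apply Rabs_def2 in H1, H2. unfold g in *. lra.
  - exists (Rmin e l). split; [now apply Rmin_glb_lt|].
    intros l' Hl' x y Hcap.
    pose proof (Rmin_l e l). pose proof (Rmin_r e l).
    destruct Hcap as (Hc1 & Hc2 & Hc3).
    pose proof (pow2_ge_0 y). pose proof (pow2_ge_0 x).
    assert (x <= b) by (apply Rnot_lt_le; intros Hlt; nra).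
    assert (-b <= y <= b) by (split; apply Rnot_lt_le; intros Hlt; nra).
    apply (H x y ltac:(lra) ltac:(lra) l'); [lra|lra|]. unfold cap; lra.
Qed.

(** With (x, y) fixed, let l' decrease to l. If the mirror image lies on the inner circle, its value
    0 is the least one. Otherwise it is strictly outside the hole, (x, y) belongs to the caps of all
    l' slightly above l, and continuity concludes. *)
Lemma reflection_closed (l : R) :
  0 <= l <= b -> (forall l', l < l' <= b -> reflection_le l') -> reflection_le l.
Proof.
  intros [Hl Hlb] HP x y (Hc1 & Hc2 & Hc3).
  destruct (Req_dec l x) as [->|Hne].
  { replace (2 * x - x) with x by ring. lra. }
  pose proof (reflection_norm l x y Hl Hc1) as Hn.
  destruct (Req_dec ((2 * l - x) ^ 2 + y ^ 2) (a ^ 2)) as [He|Hne'].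
  { rewrite (Hin _ _ He). apply ring_value_range. split; lra. }
  apply Rnot_lt_le. intros Hlt.
  assert (Hxb : x <= b).
  { pose proof (pow2_ge_0 y). apply Rnot_lt_le. intros Hlt'. nra. }
  destruct (Hu (2 * l - x) y ltac:(split; lra) (u (2 * l - x) y - u x y) ltac:(lra))
    as (d1 & Hd1 & H1).
  destruct (reflected_near l x y (Rmin d1 ((2 * l - x) ^ 2 + y ^ 2 - a ^ 2))) as (d & Hd & _ & Hnr).
  { apply Rmin_glb_lt; lra. }
  set (l' := Rmin x (l + d / 2)).
  assert (Hl' : l < l' /\ l' <= x /\ l' < l + d).
  { unfold l'. pose proof (Rmin_l x (l + d / 2)). pose proof (Rmin_r x (l + d / 2)).
    split; [apply Rmin_glb_lt|]; lra. }
  destruct (Hnr l' x y) as (_ & H2 & H3).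
  { apply Rabs_def1; lra. }
  { now apply Rabs_self_lt. }
  { now apply Rabs_self_lt. }
  pose proof (Rmin_l d1 ((2 * l - x) ^ 2 + y ^ 2 - a ^ 2)).
  pose proof (Rmin_r d1 ((2 * l - x) ^ 2 + y ^ 2 - a ^ 2)).
  apply Rabs_def2 in H2.
  pose proof (reflection_norm l' x y ltac:(lra) ltac:(lra)).
  specialize (H1 (2 * l' - x) y ltac:(split; lra) ltac:(lra)).
  rewrite Rminus_diag, Rabs_R0 in H1. specialize (H1 Hd1). apply Rabs_def2 in H1.
  pose proof (HP l' ltac:(lra) x y ltac:(unfold cap; lra)). lra.
Qed.

(** The supremum of the bad positions would be good by [reflection_closed], and so would all
    positions just below it by [reflection_step]. The start l = b is covered, as [reflection_closed]
    has nothing to assume there. *)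
Lemma reflection_le_all (l : R) : 0 < l <= b -> reflection_le l.
Proof.
  intros Hl. apply NNPP. intros Hbad.
  destruct (completeness (fun s => l <= s <= b /\ ~ reflection_le s)) as [s [Hub Hlub]].
  { exists b. intros s Hs. lra. }
  { exists l. split; [lra|exact Hbad]. }
  assert (Hs : l <= s) by (apply Hub; split; [lra|exact Hbad]).
  assert (Hsb : s <= b) by (apply Hlub; intros s' Hs'; lra).
  assert (Habove : forall s', s < s' <= b -> reflection_le s').
  { intros s' Hs'. apply NNPP. intros Hn.
    assert (s' <= s) by (apply Hub; split; [lra|exact Hn]). lra. }
  destruct (reflection_step s) as (d & Hd & Hstep); [lra| |].
  { apply reflection_closed; [lra|exact Habove]. }
  assert (s <= s - d / 2); [|lra].
  apply Hlub. intros s' [Hs1 Hs2]. apply Rnot_lt_le. intros Hlt. apply Hs2.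
  destruct (Rle_dec s' s); [apply Hstep; lra|apply Habove; lra].
Qed.

Theorem reflection_inequality (x y : R) :
  0 <= x -> ring_closed a b x y -> u (- x) y <= u x y.
Proof.
  intros Hx [H1 H2].
  assert (H0 : reflection_le 0).
  { apply reflection_closed; [lra|]. intros l Hl. now apply reflection_le_all. }
  replace (- x) with (2 * 0 - x) by ring. apply H0. unfold cap.
  split; [lra|]. split; [lra|]. replace ((2 * 0 - x) ^ 2) with (x ^ 2) by ring. lra.
Qed.

End MovingPlanes.

(** * Polar coordinates *)

Lemma differentiable_const (k x y : R) : differentiable_pt_lim (fun _ _ => k) x y 0 0.
Proof.
  intros eps. exists eps. intros u v _ _.
  replace (k - k - (0 * (u - x) + 0 * (v - y))) with 0 by ring. rewrite Rabs_R0.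
  apply Rmult_le_pos; [apply Rlt_le, cond_pos|].
  apply Rle_trans with (2 := Rmax_l _ _), Rabs_pos.
Qed.

Lemma differentiable_fst (f : R -> R) (x y l : R) :
  is_derive f x l -> differentiable_pt_lim (fun u _ => f u) x y l 0.
Proof. intros H. now apply differentiable_pt_lim_proj1_0, is_derive_Reals. Qed.

Lemma differentiable_eq (f : R -> R -> R) (x y l1 l2 k1 k2 : R) :
  differentiable_pt_lim f x y l1 l2 -> l1 = k1 -> l2 = k2 ->
  differentiable_pt_lim f x y k1 k2.
Proof. now intros H <- <-. Qed.

Lemma differentiable_mult_pt (x y : R) : differentiable_pt_lim Rmult x y y x.
Proof.
  intros eps. exists eps. intros u v Hu _.
  replace (u * v - x * y - (y * (u - x) + x * (v - y))) with ((u - x) * (v - y)) by ring.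
  rewrite Rabs_mult. apply Rmult_le_compat; auto using Rabs_pos; [lra|apply Rmax_r].
Qed.

Lemma differentiable_plus_pt (x y : R) : differentiable_pt_lim Rplus x y 1 1.
Proof.
  intros eps. exists eps. intros u v _ _.
  replace (u + v - (x + y) - (1 * (u - x) + 1 * (v - y))) with 0 by ring. rewrite Rabs_R0.
  apply Rmult_le_pos; [apply Rlt_le, cond_pos|].
  apply Rle_trans with (2 := Rmax_l _ _), Rabs_pos.
Qed.

Lemma differentiable_id_fst (x y : R) : differentiable_pt_lim (fun u _ => u) x y 1 0.
Proof. apply (differentiable_fst (fun u => u)). auto_derive; trivial. Qed.

Lemma differentiable_id_snd (x y : R) : differentiable_pt_lim (fun _ v => v) x y 0 1.
Proof.
  intros eps. exists eps. intros u v _ _.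
  replace (v - y - (0 * (u - x) + 1 * (v - y))) with 0 by ring. rewrite Rabs_R0.
  apply Rmult_le_pos; [apply Rlt_le, cond_pos|].
  apply Rle_trans with (2 := Rmax_l _ _), Rabs_pos.
Qed.

Lemma differentiable_comp1 (g : R -> R) (f : R -> R -> R) (x y l l1 l2 : R) :
  is_derive g (f x y) l -> differentiable_pt_lim f x y l1 l2 ->
  differentiable_pt_lim (fun u v => g (f u v)) x y (l * l1) (l * l2).
Proof.
  intros Hg Hf.
  apply differentiable_eq with (l * l1 + 0 * 0) (l * l2 + 0 * 0); try ring.
  apply (differentiable_pt_lim_comp (fun p _ => g p) f (fun _ _ => 0)).
  - now apply differentiable_fst.
  - exact Hf.
  - apply differentiable_const.
Qed.

Lemma differentiable_mult (f g : R -> R -> R) (x y f1 f2 g1 g2 : R) :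
  differentiable_pt_lim f x y f1 f2 -> differentiable_pt_lim g x y g1 g2 ->
  differentiable_pt_lim (fun u v => f u v * g u v) x y
    (g x y * f1 + f x y * g1) (g x y * f2 + f x y * g2).
Proof.
  intros Hf Hg. apply (differentiable_pt_lim_comp Rmult f g); auto.
  apply differentiable_mult_pt.
Qed.

Lemma differentiable_plus (f g : R -> R -> R) (x y f1 f2 g1 g2 : R) :
  differentiable_pt_lim f x y f1 f2 -> differentiable_pt_lim g x y g1 g2 ->
  differentiable_pt_lim (fun u v => f u v + g u v) x y (f1 + g1) (f2 + g2).
Proof.
  intros Hf Hg.
  apply differentiable_eq with (1 * f1 + 1 * g1) (1 * f2 + 1 * g2); try ring.
  apply (differentiable_pt_lim_comp Rplus f g); auto. apply differentiable_plus_pt.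
Qed.

Lemma differentiable_scal (k : R) (f : R -> R -> R) (x y f1 f2 : R) :
  differentiable_pt_lim f x y f1 f2 ->
  differentiable_pt_lim (fun u v => k * f u v) x y (k * f1) (k * f2).
Proof.
  intros Hf. apply (differentiable_comp1 (fun t => k * t) f); [|exact Hf].
  auto_derive; [trivial|ring].
Qed.

Lemma differentiable_partials (f : R -> R -> R) (x y l1 l2 : R) :
  differentiable_pt_lim f x y l1 l2 ->
  is_derive (fun t => f t y) x l1 /\ is_derive (fun t => f x t) y l2.
Proof.
  intros H. split.
  - apply is_derive_Reals. replace l1 with (l1 * 1 + l2 * 0) by ring.
    apply (derivable_pt_lim_comp_2d f (fun t => t) (fun _ => y)); auto.
    + apply derivable_pt_lim_id.
    + apply derivable_pt_lim_const.
  - apply is_derive_Reals. replace l2 with (l1 * 0 + l2 * 1) by ring.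
    apply (derivable_pt_lim_comp_2d f (fun _ => x) (fun t => t)); auto.
    + apply derivable_pt_lim_const.
    + apply derivable_pt_lim_id.
Qed.

Lemma lipschitz_of_derive (f df : R -> R) (D x y : R) :
  (forall t, Rmin x y <= t <= Rmax x y -> is_derive f t (df t) /\ Rabs (df t) <= D) ->
  Rabs (f y - f x) <= D * Rabs (y - x).
Proof.
  intros H. destruct (MVT_gen f x y df) as (z & Hz & ->).
  - intros t Ht. apply H. lra.
  - intros t Ht. apply derivable_continuous_pt. exists (df t).
    now apply is_derive_Reals, H.
  - rewrite Rabs_mult. apply Rmult_le_compat_r; [apply Rabs_pos|]. now apply H.
Qed.

Lemma cos_lipschitz (s t : R) : Rabs (cos t - cos s) <= Rabs (t - s).
Proof.
  rewrite <- (Rmult_1_l (Rabs (t - s))).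
  apply lipschitz_of_derive with (fun x => - sin x). intros x _. split.
  - auto_derive; [trivial|ring].
  - rewrite Rabs_Ropp. apply Rabs_le, SIN_bound.
Qed.

Lemma sin_lipschitz (s t : R) : Rabs (sin t - sin s) <= Rabs (t - s).
Proof.
  rewrite <- (Rmult_1_l (Rabs (t - s))).
  apply lipschitz_of_derive with (fun x => cos x). intros x _. split.
  - auto_derive; [trivial|ring].
  - apply Rabs_le, COS_bound.
Qed.

Lemma polar_norm (r t : R) : (r * cos t) ^ 2 + (r * sin t) ^ 2 = r ^ 2.
Proof.
  replace ((r * cos t) ^ 2 + (r * sin t) ^ 2) with (r ^ 2 * (Rsqr (sin t) + Rsqr (cos t)))
    by (unfold Rsqr; ring).
  rewrite sin2_cos2. ring.
Qed.

(** The angle is the arc cosine of x / r, with the sign of y; at the origin it is arbitrary. *)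
Lemma polar_form (x y : R) : exists t : R,
  x = sqrt (x ^ 2 + y ^ 2) * cos t /\ y = sqrt (x ^ 2 + y ^ 2) * sin t.
Proof.
  set (r := sqrt (x ^ 2 + y ^ 2)).
  pose proof (pow2_ge_0 x) as Hx2. pose proof (pow2_ge_0 y) as Hy2.
  assert (Hr : 0 <= r) by apply sqrt_pos.
  assert (Hr2 : r ^ 2 = x ^ 2 + y ^ 2) by (unfold r; rewrite pow2_sqrt; lra).
  destruct (Req_dec r 0) as [Hz|Hnz].
  { exists 0. rewrite Hz in *. split; nra. }
  assert (Hz : -1 <= x / r <= 1).
  { split; apply Rmult_le_reg_r with r; try lra; unfold Rdiv; rewrite Rmult_assoc, Rinv_l by lra; nra. }
  assert (Hs : r * sqrt (1 - (x / r)²) = Rabs y).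
  { rewrite <- (sqrt_pow2 r Hr) at 1. rewrite <- sqrt_mult_alt by (apply pow2_ge_0).
    rewrite <- sqrt_Rsqr_abs. f_equal. unfold Rsqr. field_simplify; lra. }
  destruct (Rle_dec 0 y) as [Hy|Hy].
  - exists (acos (x / r)). rewrite cos_acos, sin_acos by exact Hz.
    split; [field; lra|]. rewrite Hs, Rabs_pos_eq; lra.
  - exists (- acos (x / r)). rewrite cos_neg, sin_neg, cos_acos, sin_acos by exact Hz.
    split; [field; lra|].
    replace (r * - sqrt (1 - (x / r)²)) with (- (r * sqrt (1 - (x / r)²))) by ring.
    rewrite Hs, Rabs_left; lra.
Qed.

Definition polar (f : R -> R -> R) (r t : R) : R := f (r * cos t) (r * sin t).

Lemma polar_ring_open (a b r t : R) : 0 < a -> a < r < b -> ring_open a b (r * cos t) (r * sin t).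
Proof. intros Ha Hr. unfold ring_open. rewrite polar_norm. nra. Qed.

Lemma polar_ring_closed (a b r t : R) :
  0 < a -> a <= r <= b -> ring_closed a b (r * cos t) (r * sin t).
Proof. intros Ha Hr. unfold ring_closed. rewrite polar_norm. nra. Qed.

Lemma differentiable_polar (f : R -> R -> R) (r t f1 f2 : R) :
  differentiable_pt_lim f (r * cos t) (r * sin t) f1 f2 ->
  differentiable_pt_lim (polar f) r t (f1 * cos t + f2 * sin t)
    (r * (- f1 * sin t + f2 * cos t)).
Proof.
  intros H. unfold polar.
  apply differentiable_eq with (f1 * cos t + f2 * sin t)
    (f1 * (r * - sin t) + f2 * (r * cos t)); [|reflexivity|ring].
  apply (differentiable_pt_lim_comp f (fun r t => r * cos t) (fun r t => r * sin t)); [exact H| |].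
  - apply differentiable_eq with (cos t * 1 + r * (- sin t * 0)) (cos t * 0 + r * (- sin t * 1)); try ring.
    apply (differentiable_mult (fun r _ => r) (fun _ t => cos t)); [apply differentiable_id_fst|].
    apply (differentiable_comp1 cos (fun _ t => t)); [|apply differentiable_id_snd].
    auto_derive; [trivial|ring].
  - apply differentiable_eq with (sin t * 1 + r * (cos t * 0)) (sin t * 0 + r * (cos t * 1)); try ring.
    apply (differentiable_mult (fun r _ => r) (fun _ t => sin t)); [apply differentiable_id_fst|].
    apply (differentiable_comp1 sin (fun _ t => t)); [|apply differentiable_id_snd].
    auto_derive; [trivial|ring].
Qed.

(** Boundedness is part of the notion so that the class is closed under products. The strip is open
    because derivatives are available only there. *)
Definition bounded_lipschitz (a b : R) (f : R -> R -> R) : Prop :=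
  exists B : R, 0 < B /\
    (forall r t, a < r < b -> Rabs (f r t) <= B) /\
    (forall r t r' t', a < r < b -> a < r' < b ->
       Rabs (f r' t' - f r t) <= B * (Rabs (r' - r) + Rabs (t' - t))).

Lemma bounded_lipschitz_ext (a b : R) (f g : R -> R -> R) :
  (forall r t, f r t = g r t) -> bounded_lipschitz a b f -> bounded_lipschitz a b g.
Proof.
  intros He (B & HB & H1 & H2). exists B. split; [exact HB|].
  split; intros; rewrite <- !He; auto.
Qed.

Lemma bounded_lipschitz_const (a b k : R) : bounded_lipschitz a b (fun _ _ => k).
Proof.
  exists (Rabs k + 1). pose proof (Rabs_pos k). split; [lra|]. split; [intros; lra|].
  intros. rewrite Rminus_diag, Rabs_R0. apply Rmult_le_pos; [lra|].
  pose proof (Rabs_pos (r' - r)). pose proof (Rabs_pos (t' - t)). lra.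
Qed.

Lemma bounded_lipschitz_fst (a b : R) : bounded_lipschitz a b (fun r _ => r).
Proof.
  exists (Rabs a + Rabs b + 1). pose proof (Rabs_pos a). pose proof (Rabs_pos b).
  split; [lra|]. split.
  - intros r _ Hr. pose proof (Rle_abs b). pose proof (Rle_abs (- a)).
    rewrite Rabs_Ropp in *. apply Rabs_le. lra.
  - intros. pose proof (Rabs_pos (r' - r)). pose proof (Rabs_pos (t' - t)). nra.
Qed.

Lemma bounded_lipschitz_trig (a b : R) :
  bounded_lipschitz a b (fun _ t => cos t) /\ bounded_lipschitz a b (fun _ t => sin t).
Proof.
  split; (exists 1; split; [lra|]; split;
    [intros; apply Rabs_le; first [apply COS_bound|apply SIN_bound]|]);
    intros r t r' t' _ _; pose proof (cos_lipschitz t t'); pose proof (sin_lipschitz t t');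
    pose proof (Rabs_pos (r' - r)); lra.
Qed.

Lemma bounded_lipschitz_plus (a b : R) (f g : R -> R -> R) :
  bounded_lipschitz a b f -> bounded_lipschitz a b g ->
  bounded_lipschitz a b (fun r t => f r t + g r t).
Proof.
  intros (B & HB & Hf1 & Hf2) (B' & HB' & Hg1 & Hg2). exists (B + B'). split; [lra|]. split.
  - intros r t Hr. apply Rle_trans with (1 := Rabs_triang _ _).
    apply Rplus_le_compat; auto.
  - intros r t r' t' Hr Hr'.
    replace (f r' t' + g r' t' - (f r t + g r t)) with ((f r' t' - f r t) + (g r' t' - g r t)) by ring.
    apply Rle_trans with (1 := Rabs_triang _ _). rewrite Rmult_plus_distr_r.
    apply Rplus_le_compat; auto.
Qed.

Lemma bounded_lipschitz_mult (a b : R) (f g : R -> R -> R) :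
  bounded_lipschitz a b f -> bounded_lipschitz a b g ->
  bounded_lipschitz a b (fun r t => f r t * g r t).
Proof.
  intros (B & HB & Hf1 & Hf2) (B' & HB' & Hg1 & Hg2).
  assert (HBB : 0 < B * B') by now apply Rmult_lt_0_compat.
  exists (2 * (B * B')). split; [lra|]. split.
  - intros r t Hr. rewrite Rabs_mult. apply Rle_trans with (B * B'); [|lra].
    apply Rmult_le_compat; auto using Rabs_pos.
  - intros r t r' t' Hr Hr'.
    replace (f r' t' * g r' t' - f r t * g r t) with
      ((f r' t' - f r t) * g r' t' + f r t * (g r' t' - g r t)) by ring.
    apply Rle_trans with (1 := Rabs_triang _ _). rewrite !Rabs_mult.
    set (n := Rabs (r' - r) + Rabs (t' - t)).
    assert (Rabs (f r' t' - f r t) * Rabs (g r' t') <= (B * n) * B')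
      by (apply Rmult_le_compat; auto using Rabs_pos; now apply Hf2).
    assert (Rabs (f r t) * Rabs (g r' t' - g r t) <= B * (B' * n))
      by (apply Rmult_le_compat; auto using Rabs_pos; now apply Hg2).
    lra.
Qed.

(** The increment is split into a radial and an angular one, and the mean value theorem is applied
    to each; the angular derivative carries the factor r, whence the constant b * (2 * M). *)
Lemma bounded_lipschitz_polar (a b M : R) (f f1 f2 : R -> R -> R) :
  0 < a -> a < b ->
  (forall x y, ring_open a b x y -> differentiable_pt_lim f x y (f1 x y) (f2 x y) /\
     Rabs (f x y) <= M /\ Rabs (f1 x y) <= M /\ Rabs (f2 x y) <= M) ->
  bounded_lipschitz a b (polar f).
Proof.
  intros Ha Hab H.
  assert (HM : 0 <= M).
  { destruct (H _ _ (polar_ring_open a b ((a + b) / 2) 0 Ha ltac:(lra))) as (_ & H0 & _).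
    apply Rle_trans with (2 := H0), Rabs_pos. }
  assert (Hlin : forall p q k s, Rabs p <= M -> Rabs q <= M -> Rabs k <= 1 -> Rabs s <= 1 ->
    Rabs (p * k + q * s) <= 2 * M).
  { intros p q k s Hp Hq Hk Hs. apply Rle_trans with (1 := Rabs_triang _ _). rewrite !Rabs_mult.
    assert (Rabs p * Rabs k <= M * 1) by (apply Rmult_le_compat; auto using Rabs_pos).
    assert (Rabs q * Rabs s <= M * 1) by (apply Rmult_le_compat; auto using Rabs_pos). lra. }
  assert (Htrig : forall t, Rabs (cos t) <= 1 /\ Rabs (sin t) <= 1).
  { intros t. split; apply Rabs_le; [apply COS_bound|apply SIN_bound]. }
  exists (2 * M + b * (2 * M) + 1). split; [nra|]. split.
  - intros r t Hr. destruct (H _ _ (polar_ring_open a b r t Ha Hr)) as (_ & H0 & _).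
    unfold polar. nra.
  - intros r t r' t' Hr Hr'.
    assert (Hd : forall r t, a < r < b -> differentiable_pt_lim (polar f) r t
      (f1 (r * cos t) (r * sin t) * cos t + f2 (r * cos t) (r * sin t) * sin t)
      (r * (- f1 (r * cos t) (r * sin t) * sin t + f2 (r * cos t) (r * sin t) * cos t))).
    { intros r0 t0 H0. apply differentiable_polar, H, (polar_ring_open a b); assumption. }
    assert (H1 : Rabs (polar f r' t' - polar f r t') <= 2 * M * Rabs (r' - r)).
    { apply (lipschitz_of_derive (fun z => polar f z t') (fun z =>
       f1 (z * cos t') (z * sin t') * cos t' + f2 (z * cos t') (z * sin t') * sin t')).
      intros z Hz.
      assert (Hz' : a < z < b).
      { unfold Rmin, Rmax in Hz. destruct (Rle_dec r r'); lra. }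
      split; [apply (differentiable_partials _ _ _ _ _ (Hd z t' Hz'))|].
      destruct (H _ _ (polar_ring_open a b z t' Ha Hz')) as (_ & _ & H1 & H2).
      destruct (Htrig t'). now apply Hlin. }
    assert (H2 : Rabs (polar f r t' - polar f r t) <= b * (2 * M) * Rabs (t' - t)).
    { apply (lipschitz_of_derive (fun z => polar f r z) (fun z =>
       r * (- f1 (r * cos z) (r * sin z) * sin z + f2 (r * cos z) (r * sin z) * cos z))).
      intros z _.
      split; [apply (differentiable_partials _ _ _ _ _ (Hd r z Hr))|].
      destruct (H _ _ (polar_ring_open a b r z Ha Hr)) as (_ & _ & H1' & H2').
      destruct (Htrig z). rewrite Rabs_mult, (Rabs_pos_eq r) by lra.
      apply Rmult_le_compat; auto using Rabs_pos; try lra.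
      apply Hlin; auto. now rewrite Rabs_Ropp. }
    replace (polar f r' t' - polar f r t) with
      ((polar f r' t' - polar f r t') + (polar f r t' - polar f r t)) by ring.
    apply Rle_trans with (1 := Rabs_triang _ _).
    pose proof (Rabs_pos (r' - r)). pose proof (Rabs_pos (t' - t)).
    assert (0 <= M * Rabs (t' - t)) by (apply Rmult_le_pos; lra).
    assert (0 <= b * (2 * M) * Rabs (r' - r)) by (repeat apply Rmult_le_pos; lra).
    lra.
Qed.

(** Continuity in r alone is all that is needed to carry estimates from the open strip to its
    boundary lines. *)
Definition radially_continuous (a b : R) (f : R -> R -> R) : Prop :=
  forall r t, a <= r <= b -> forall eps, 0 < eps -> exists d, 0 < d /\
    forall r', a <= r' <= b -> Rabs (r' - r) < d -> Rabs (f r' t - f r t) < eps.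

Lemma radially_continuous_polar (a b : R) (f : R -> R -> R) :
  0 < a -> continuous_2d_on (ring_closed a b) f -> radially_continuous a b (polar f).
Proof.
  intros Ha Hf r t Hr eps He.
  destruct (Hf _ _ (polar_ring_closed a b r t Ha Hr) eps He) as (d & Hd & H).
  exists d. split; [exact Hd|]. intros r' Hr' Hd'.
  assert (Hx : forall k, Rabs k <= 1 -> Rabs (r' * k - r * k) < d).
  { intros k Hk. replace (r' * k - r * k) with ((r' - r) * k) by ring. rewrite Rabs_mult.
    apply Rle_lt_trans with (Rabs (r' - r) * 1); [|lra].
    apply Rmult_le_compat_l; [apply Rabs_pos|exact Hk]. }
  apply H; [now apply polar_ring_closed| |]; apply Hx, Rabs_le;
    [apply COS_bound|apply SIN_bound].
Qed.

Lemma radially_continuous_plus (a b : R) (f g : R -> R -> R) :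
  radially_continuous a b f -> radially_continuous a b g ->
  radially_continuous a b (fun r t => f r t + g r t).
Proof.
  intros Hf Hg r t Hr eps He.
  destruct (Hf r t Hr (eps / 2) ltac:(lra)) as (d1 & Hd1 & H1).
  destruct (Hg r t Hr (eps / 2) ltac:(lra)) as (d2 & Hd2 & H2).
  exists (Rmin d1 d2). split; [now apply Rmin_glb_lt|]. intros r' Hr' Hd.
  pose proof (Rmin_l d1 d2). pose proof (Rmin_r d1 d2).
  specialize (H1 r' Hr' ltac:(lra)). specialize (H2 r' Hr' ltac:(lra)).
  apply Rabs_def2 in H1, H2. apply Rabs_def1; lra.
Qed.

Lemma radially_continuous_scal (a b : R) (k : R -> R) (f : R -> R -> R) :
  radially_continuous a b f -> radially_continuous a b (fun r t => k t * f r t).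
Proof.
  intros Hf r t Hr eps He. pose proof (Rabs_pos (k t)) as Hk.
  destruct (Hf r t Hr (eps / (Rabs (k t) + 1))) as (d1 & Hd1 & H1).
  { apply Rdiv_lt_0_compat; lra. }
  exists d1. split; [exact Hd1|]. intros r' Hr' Hd. specialize (H1 r' Hr' Hd).
  replace (k t * f r' t - k t * f r t) with (k t * (f r' t - f r t)) by ring.
  rewrite Rabs_mult.
  apply Rle_lt_trans with (Rabs (k t) * (eps / (Rabs (k t) + 1))).
  { apply Rmult_le_compat_l; lra. }
  apply Rmult_lt_reg_r with (Rabs (k t) + 1); [lra|].
  replace (Rabs (k t) * (eps / (Rabs (k t) + 1)) * (Rabs (k t) + 1)) with (Rabs (k t) * eps)
    by (field; lra). nra.
Qed.

Lemma radially_continuous_mult_fst (a b : R) (f : R -> R -> R) :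
  0 < a < b -> radially_continuous a b f -> radially_continuous a b (fun r t => r * f r t).
Proof.
  intros Ha Hf r t Hr eps He. pose proof (Rabs_pos (f r t)) as Hp.
  destruct (Hf r t Hr (eps / (2 * b)) ltac:(apply Rdiv_lt_0_compat; lra)) as (d1 & Hd1 & H1).
  set (d2 := eps / (2 * (Rabs (f r t) + 1))).
  assert (Hd2 : 0 < d2) by (apply Rdiv_lt_0_compat; lra).
  exists (Rmin d1 d2). split; [now apply Rmin_glb_lt|]. intros r' Hr' Hd.
  pose proof (Rmin_l d1 d2). pose proof (Rmin_r d1 d2).
  specialize (H1 r' Hr' ltac:(lra)).
  replace (r' * f r' t - r * f r t) with (r' * (f r' t - f r t) + (r' - r) * f r t) by ring.
  apply Rle_lt_trans with (1 := Rabs_triang _ _). rewrite !Rabs_mult, (Rabs_pos_eq r') by lra.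
  assert (r' * Rabs (f r' t - f r t) <= b * (eps / (2 * b))).
  { apply Rmult_le_compat; try lra; apply Rabs_pos. }
  replace (b * (eps / (2 * b))) with (eps / 2) in * by (field; lra).
  assert (Rabs (r' - r) * Rabs (f r t) <= d2 * Rabs (f r t)) by (apply Rmult_le_compat_r; lra).
  assert (d2 * (Rabs (f r t) + 1) = eps / 2) by (unfold d2; field; lra). lra.
Qed.

(** The radius is moved slightly towards the middle radius (a + b) / 2, which also leaves the
    boundary when r = a or r = b. *)
Lemma radial_approximation (a b : R) (f : R -> R -> R) (r t e : R) :
  a < b -> radially_continuous a b f -> a <= r <= b -> 0 < e ->
  exists r', a < r' < b /\ Rabs (r' - r) < e /\ Rabs (f r' t - f r t) < e.
Proof.
  intros Hab Hc Hr He. destruct (Hc r t Hr e He) as (d & Hd & H).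
  set (s := Rmin (1 / 2) (Rmin e d / (b - a))).
  assert (Hm : 0 < Rmin e d) by now apply Rmin_glb_lt.
  assert (Hs : 0 < s <= 1 / 2).
  { split; [apply Rmin_glb_lt; [lra|apply Rdiv_lt_0_compat; lra]|apply Rmin_l]. }
  assert (Hs2 : s * (b - a) <= Rmin e d).
  { apply Rle_trans with (Rmin e d / (b - a) * (b - a)); [|right; field; lra].
    apply Rmult_le_compat_r; [lra|apply Rmin_r]. }
  pose proof (Rmin_l e d). pose proof (Rmin_r e d).
  exists (r + s * ((a + b) / 2 - r)).
  assert (Hin : a < r + s * ((a + b) / 2 - r) < b) by (split; nra).
  assert (Hd' : Rabs (r + s * ((a + b) / 2 - r) - r) < Rmin e d).
  { replace (r + s * ((a + b) / 2 - r) - r) with (s * ((a + b) / 2 - r)) by ring.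
    apply Rabs_def1; nra. }
  split; [exact Hin|]. split; [lra|]. apply H; lra.
Qed.

Lemma bounded_lipschitz_closure (a b : R) (f : R -> R -> R) :
  a < b -> bounded_lipschitz a b f -> radially_continuous a b f ->
  exists B, 0 < B /\
    (forall r t, a <= r <= b -> Rabs (f r t) <= B) /\
    (forall r t r' t', a <= r <= b -> a <= r' <= b ->
       Rabs (f r' t' - f r t) <= B * (Rabs (r' - r) + Rabs (t' - t))).
Proof.
  intros Hab (B & HB & H1 & H2) Hc. exists B. split; [exact HB|].
  split.
  - intros r t Hr. apply le_epsilon. intros e He.
    destruct (radial_approximation a b f r t e Hab Hc Hr He) as (r1 & Hr1 & _ & Hd). specialize (H1 r1 t Hr1).
    pose proof (Rabs_triang_inv (f r t) (f r1 t)).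
    rewrite (Rabs_minus_sym (f r t)) in *. lra.
  - intros r t r' t' Hr Hr'. apply le_epsilon. intros e He.
    set (e' := e / (2 * B + 2)).
    assert (He' : 0 < e') by (apply Rdiv_lt_0_compat; lra).
    assert (Hee : e' * (2 * B + 2) = e) by (unfold e'; field; lra).
    destruct (radial_approximation a b f r t e' Hab Hc Hr He') as (r1 & Hr1 & Hn & Hd).
    destruct (radial_approximation a b f r' t' e' Hab Hc Hr' He') as (r2 & Hr2 & Hn' & Hd').
    specialize (H2 r1 t r2 t' Hr1 Hr2).
    assert (Hrr : Rabs (r2 - r1) <= Rabs (r' - r) + 2 * e').
    { replace (r2 - r1) with ((r' - r) + ((r2 - r') - (r1 - r))) by ring.
      apply Rle_trans with (1 := Rabs_triang _ _). apply Rplus_le_compat_l.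
      apply Rle_trans with (1 := Rabs_triang _ _). rewrite Rabs_Ropp. lra. }
    assert (Hb : B * (Rabs (r2 - r1) + Rabs (t' - t)) <=
      B * (Rabs (r' - r) + Rabs (t' - t)) + B * (2 * e')).
    { rewrite <- Rmult_plus_distr_l. apply Rmult_le_compat_l; lra. }
    apply Rabs_le_between in H2. apply Rabs_def2 in Hd, Hd'. apply Rabs_le. lra.
Qed.

(** The increment is split at (r, t'), and each half is treated by the mean value theorem and the
    Lipschitz bounds on P and Q. If r is a boundary radius, the angular half is zero, since U is
    constant and Q = 0 there. *)
Lemma strip_taylor (a b L : R) (U P Q : R -> R -> R) :
  a < b -> 0 <= L ->
  (forall r t, a < r < b -> is_derive (fun z => U z t) r (P r t)) ->
  (forall r t, a < r < b -> is_derive (fun z => U r z) t (Q r t)) ->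
  radially_continuous a b U ->
  (forall r t, r = a \/ r = b -> Q r t = 0 /\ U r t = U r 0) ->
  (forall r t r' t', a <= r <= b -> a <= r' <= b ->
     Rabs (P r' t' - P r t) <= L * (Rabs (r' - r) + Rabs (t' - t)) /\
     Rabs (Q r' t' - Q r t) <= L * (Rabs (r' - r) + Rabs (t' - t))) ->
  taylor_on a b L U P Q.
Proof.
  intros Hab HL HP HQ Hcont Hbd Hlip r t r' t' Hr Hr'.
  set (n := Rabs (r' - r) + Rabs (t' - t)).
  assert (H1 : Rabs (U r' t' - U r t' - P r t * (r' - r)) <= L * n * Rabs (r' - r)).
  { assert (Hmv : forall x y, a <= x -> x < y -> y <= b -> exists z, x < z < y /\
      U y t' - U x t' = P z t' * (y - x)).
    { intros x y Hx Hxy Hy. apply (MVT_within (fun z => U z t') (fun z => P z t')); auto.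
      - intros z Hz. apply HP. lra.
      - intros z Hz eps He. destruct (Hcont z t' ltac:(lra) eps He) as (d & Hd & H).
        exists d. split; [exact Hd|]. intros z' Hz'. apply H. lra. }
    assert (Hz : exists z, Rmin r r' <= z <= Rmax r r' /\ U r' t' - U r t' = P z t' * (r' - r)).
    { destruct (Rtotal_order r r') as [Hlt|[Heq|Hgt]].
      - destruct (Hmv r r') as (z & Hz & He); try lra. exists z.
        rewrite Rmin_left, Rmax_right by lra. split; [lra|exact He].
      - subst r'. exists r. rewrite Rmin_left, Rmax_left by lra. split; [lra|ring].
      - destruct (Hmv r' r) as (z & Hz & He); try lra. exists z.
        rewrite Rmin_right, Rmax_left by lra. split; [lra|].
        replace (U r' t' - U r t') with (- (U r t' - U r' t')) by ring. rewrite He. ring. }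
    destruct Hz as (z & Hz & He). rewrite He.
    replace (P z t' * (r' - r) - P r t * (r' - r)) with ((P z t' - P r t) * (r' - r)) by ring.
    rewrite Rabs_mult. apply Rmult_le_compat_r; [apply Rabs_pos|].
    assert (Hzr : a <= z <= b /\ Rabs (z - r) <= Rabs (r' - r)).
    { unfold Rmin, Rmax in Hz. unfold Rabs.
      destruct (Rle_dec r r'); repeat destruct (Rcase_abs _); lra. }
    destruct (Hlip r t z t' Hr ltac:(lra)) as [Hl _].
    apply Rle_trans with (1 := Hl). apply Rmult_le_compat_l; unfold n; lra. }
  assert (H2 : Rabs (U r t' - U r t - Q r t * (t' - t)) <= L * n * Rabs (t' - t)).
  { destruct (Req_dec r a) as [Hra|Hra]; [|destruct (Req_dec r b) as [Hrb|Hrb]].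
    1,2: destruct (Hbd r t ltac:(tauto)) as [-> ->];
      destruct (Hbd r t' ltac:(tauto)) as [_ ->];
      replace (U r 0 - U r 0 - 0 * (t' - t)) with 0 by ring; rewrite Rabs_R0;
      repeat apply Rmult_le_pos; auto using Rabs_pos; unfold n;
      pose proof (Rabs_pos (r' - r)); pose proof (Rabs_pos (t' - t)); lra.
    destruct (MVT_gen (fun z => U r z) t t' (fun z => Q r z)) as (z & Hz & He).
    { intros z _. apply HQ. lra. }
    { intros z _. apply derivable_continuous_pt. exists (Q r z). apply is_derive_Reals, HQ. lra. }
    rewrite He.
    replace (Q r z * (t' - t) - Q r t * (t' - t)) with ((Q r z - Q r t) * (t' - t)) by ring.
    rewrite Rabs_mult. apply Rmult_le_compat_r; [apply Rabs_pos|].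
    assert (Hzt : Rabs (z - t) <= Rabs (t' - t)).
    { unfold Rmin, Rmax in Hz. unfold Rabs.
      destruct (Rle_dec t t'); repeat destruct (Rcase_abs _); lra. }
    destruct (Hlip r t r z Hr Hr) as [_ Hl]. apply Rle_trans with (1 := Hl).
    rewrite Rminus_diag, Rabs_R0. pose proof (Rabs_pos (r' - r)).
    apply Rmult_le_compat_l; unfold n; lra. }
  replace (U r' t' - U r t - (P r t * (r' - r) + Q r t * (t' - t))) with
    ((U r' t' - U r t' - P r t * (r' - r)) + (U r t' - U r t - Q r t * (t' - t))) by ring.
  apply Rle_trans with (1 := Rabs_triang _ _).
  replace (L * n ^ 2) with (L * n * Rabs (r' - r) + L * n * Rabs (t' - t)) by (unfold n; ring).
  lra.
Qed.

(** * Radial symmetry of the stream function *)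

Lemma radius_interior (a b x y : R) : 0 < a < b ->
  ring_open a b x y -> a < sqrt (x ^ 2 + y ^ 2) < b.
Proof.
  intros Ha [H4 H5]. rewrite <- (sqrt_pow2 a), <- (sqrt_pow2 b) by lra.
  split; apply sqrt_lt_1_alt; pose proof (pow2_ge_0 a); lra.
Qed.

Lemma rotation_norm (al x y : R) :
  (cos al * x + - sin al * y) ^ 2 + (sin al * x + cos al * y) ^ 2 = x ^ 2 + y ^ 2.
Proof.
  replace ((cos al * x + - sin al * y) ^ 2 + (sin al * x + cos al * y) ^ 2) with
    ((Rsqr (sin al) + Rsqr (cos al)) * (x ^ 2 + y ^ 2)) by (unfold Rsqr; ring).
  rewrite sin2_cos2. ring.
Qed.

Definition rotated (al : R) (f : R -> R -> R) (x y : R) : R :=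
  f (cos al * x + - sin al * y) (sin al * x + cos al * y).

Lemma differentiable_linear (p q x y : R) :
  differentiable_pt_lim (fun x y => p * x + q * y) x y p q.
Proof.
  apply differentiable_eq with (p * 1 + q * 0) (p * 0 + q * 1); try ring.
  apply (differentiable_plus (fun x _ => p * x) (fun _ y => q * y)).
  - apply (differentiable_scal p (fun x _ => x)), differentiable_id_fst.
  - apply (differentiable_scal q (fun _ y => y)), differentiable_id_snd.
Qed.

Lemma differentiable_rotated (al : R) (f f1 f2 : R -> R -> R) (x y : R) :
  differentiable_pt_lim f (cos al * x + - sin al * y) (sin al * x + cos al * y)
    (rotated al f1 x y) (rotated al f2 x y) ->
  differentiable_pt_lim (rotated al f) x y
    (cos al * rotated al f1 x y + sin al * rotated al f2 x y)
    (- sin al * rotated al f1 x y + cos al * rotated al f2 x y).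
Proof.
  intros H.
  apply differentiable_eq with
    (rotated al f1 x y * cos al + rotated al f2 x y * sin al)
    (rotated al f1 x y * - sin al + rotated al f2 x y * cos al); try ring.
  apply (differentiable_pt_lim_comp f (fun x y => cos al * x + - sin al * y)
    (fun x y => sin al * x + cos al * y)); [exact H| |]; apply differentiable_linear.
Qed.

Lemma continuous_rotated (a b al : R) (f : R -> R -> R) :
  continuous_2d_on (ring_closed a b) f -> continuous_2d_on (ring_closed a b) (rotated al f).
Proof.
  intros Hf x y Hr eps He.
  assert (Hrot : forall x y, ring_closed a b x y ->
    ring_closed a b (cos al * x + - sin al * y) (sin al * x + cos al * y)).
  { intros x0 y0 H0. unfold ring_closed. rewrite rotation_norm. exact H0. }
  destruct (Hf _ _ (Hrot x y Hr) eps He) as (d & Hd & H).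
  assert (Hlin : forall p q s t, Rabs p <= 1 -> Rabs q <= 1 -> Rabs s < d / 2 -> Rabs t < d / 2 ->
    Rabs (p * s + q * t) < d).
  { intros p q s t Hp Hq Hs Ht. apply Rle_lt_trans with (1 := Rabs_triang _ _).
    rewrite !Rabs_mult.
    assert (Rabs p * Rabs s <= 1 * Rabs s) by (apply Rmult_le_compat_r; auto using Rabs_pos).
    assert (Rabs q * Rabs t <= 1 * Rabs t) by (apply Rmult_le_compat_r; auto using Rabs_pos).
    lra. }
  assert (Hc : Rabs (cos al) <= 1) by (apply Rabs_le, COS_bound).
  assert (Hs : Rabs (sin al) <= 1) by (apply Rabs_le, SIN_bound).
  exists (d / 2). split; [lra|]. intros x' y' Hr' Hx Hy.
  apply H; [now apply Hrot| |].
  - replace (cos al * x' + - sin al * y' - (cos al * x + - sin al * y)) with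
      (cos al * (x' - x) + - sin al * (y' - y)) by ring.
    apply Hlin; auto. now rewrite Rabs_Ropp.
  - replace (sin al * x' + cos al * y' - (sin al * x + cos al * y)) with
      (sin al * (x' - x) + cos al * (y' - y)) by ring.
    now apply Hlin.
Qed.

Lemma continuous_2d_on_lin (K : R -> R -> Prop) (p q : R) (f g : R -> R -> R) :
  continuous_2d_on K f -> continuous_2d_on K g ->
  continuous_2d_on K (fun x y => p * f x y + q * g x y).
Proof.
  intros Hf Hg. apply (continuous_2d_on_plus K (fun x y => p * f x y) (fun x y => q * g x y));
    now apply continuous_2d_on_scal.
Qed.

Lemma bounded_lipschitz_polar_of_gradient (a b M : R) (f f1 f2 : R -> R -> R) :
  0 < a -> a < b -> continuous_2d_on (ring_closed a b) f ->
  (forall x y, ring_open a b x y -> differentiable_pt_lim f x y (f1 x y) (f2 x y)) ->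
  (forall x y, ring_open a b x y -> Rabs (f1 x y) <= M /\ Rabs (f2 x y) <= M) ->
  bounded_lipschitz a b (polar f).
Proof.
  intros Ha Hab Hf Hd Hb.
  destruct (compact_bounded _ f (compact_ring a b) Hf) as (B & HB & Hfb).
  apply (bounded_lipschitz_polar a b (Rmax M B) f f1 f2); auto. intros x y Hr.
  destruct (Hb x y Hr). pose proof (Rmax_l M B). pose proof (Rmax_r M B).
  pose proof (Hfb x y ltac:(destruct Hr; split; lra)).
  split; [now apply Hd|]. lra.
Qed.

(** The two combinations are the radial and the angular derivative in polar coordinates of a
    function with gradient (u1, u2). They are built by sums and products in the open strip, and the
    bounds then pass to the closed one. *)
Lemma polar_field_lipschitz (a b M : R) (u1 u2 u11 u12 u21 u22 : R -> R -> R) :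
  0 < a -> a < b ->
  continuous_2d_on (ring_closed a b) u1 -> continuous_2d_on (ring_closed a b) u2 ->
  (forall x y, ring_open a b x y -> differentiable_pt_lim u1 x y (u11 x y) (u12 x y)) ->
  (forall x y, ring_open a b x y -> differentiable_pt_lim u2 x y (u21 x y) (u22 x y)) ->
  (forall x y, ring_open a b x y ->
    Rabs (u11 x y) <= M /\ Rabs (u12 x y) <= M /\ Rabs (u21 x y) <= M /\ Rabs (u22 x y) <= M) ->
  exists L : R, 0 < L /\
    (forall r t, a <= r <= b ->
       Rabs (cos t * polar u1 r t + sin t * polar u2 r t) <= L /\
       Rabs (r * (cos t * polar u2 r t + - sin t * polar u1 r t)) <= L) /\
    (forall r t r' t', a <= r <= b -> a <= r' <= b ->
       Rabs (cos t' * polar u1 r' t' + sin t' * polar u2 r' t' -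
             (cos t * polar u1 r t + sin t * polar u2 r t))
         <= L * (Rabs (r' - r) + Rabs (t' - t)) /\
       Rabs (r' * (cos t' * polar u2 r' t' + - sin t' * polar u1 r' t') -
             r * (cos t * polar u2 r t + - sin t * polar u1 r t))
         <= L * (Rabs (r' - r) + Rabs (t' - t))).
Proof.
  intros Ha Hab Hu1 Hu2 H1 H2 HM.
  assert (Hbl1 : bounded_lipschitz a b (polar u1)).
  { apply (bounded_lipschitz_polar_of_gradient a b M u1 u11 u12); auto.
    intros x y Hr. destruct (HM x y Hr). tauto. }
  assert (Hbl2 : bounded_lipschitz a b (polar u2)).
  { apply (bounded_lipschitz_polar_of_gradient a b M u2 u21 u22); auto.
    intros x y Hr. destruct (HM x y Hr). tauto. }
  destruct (bounded_lipschitz_trig a b) as [Hcos Hsin].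
  assert (Hmsin : bounded_lipschitz a b (fun _ t => - sin t)).
  { apply bounded_lipschitz_ext with (fun _ t => -1 * sin t); [intros; ring|].
    apply bounded_lipschitz_mult; [apply bounded_lipschitz_const|exact Hsin]. }
  pose proof (radially_continuous_polar a b u1 Ha Hu1) as Hr1.
  pose proof (radially_continuous_polar a b u2 Ha Hu2) as Hr2.
  destruct (bounded_lipschitz_closure a b (fun r t => cos t * polar u1 r t + sin t * polar u2 r t) Hab) as (LP & HLP & HP1 & HP2).
  { apply bounded_lipschitz_plus; now apply bounded_lipschitz_mult. }
  { apply radially_continuous_plus; now apply radially_continuous_scal. }
  destruct (bounded_lipschitz_closure
    a b (fun r t => r * (cos t * polar u2 r t + - sin t * polar u1 r t)) Hab) as (LQ & HLQ & HQ1 & HQ2).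
  { apply bounded_lipschitz_mult; [apply bounded_lipschitz_fst|].
    apply bounded_lipschitz_plus; now apply bounded_lipschitz_mult. }
  { apply radially_continuous_mult_fst; [lra|].
    apply radially_continuous_plus; apply (radially_continuous_scal a b); assumption. }
  exists (LP + LQ). split; [lra|]. split.
  - intros r t Hr. specialize (HP1 r t Hr). specialize (HQ1 r t Hr). lra.
  - intros r t r' t' Hr Hr'. specialize (HP2 r t r' t' Hr Hr'). specialize (HQ2 r t r' t' Hr Hr').
    pose proof (Rabs_pos (r' - r)). pose proof (Rabs_pos (t' - t)). split; nra.
Qed.

Section Radial.

Variables (a b c M m : R) (u u1 u2 u11 u12 u21 u22 w1 w2 : R -> R -> R).
Hypotheses (Ha : 0 < a) (Hab : a < b) (Hc : 0 < c) (Hm : 0 < m).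
Hypotheses (Hu : continuous_2d_on (ring_closed a b) u)
  (Hu1 : continuous_2d_on (ring_closed a b) u1)
  (Hu2 : continuous_2d_on (ring_closed a b) u2).
Hypothesis HD : forall x y, ring_open a b x y ->
  differentiable_pt_lim u x y (u1 x y) (u2 x y) /\
  differentiable_pt_lim u1 x y (u11 x y) (u12 x y) /\
  differentiable_pt_lim u2 x y (u21 x y) (u22 x y) /\
  differentiable_pt_lim (fun x y => u11 x y + u22 x y) x y (w1 x y) (w2 x y).
Hypothesis HM : forall x y, ring_open a b x y ->
  Rabs (u11 x y) <= M /\ Rabs (u12 x y) <= M /\ Rabs (u21 x y) <= M /\ Rabs (u22 x y) <= M /\
  Rabs (w1 x y) <= M /\ Rabs (w2 x y) <= M.
Hypothesis HJ : forall x y, ring_open a b x y -> u1 x y * w2 x y - u2 x y * w1 x y = 0.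
Hypotheses (Hin : forall x y, x ^ 2 + y ^ 2 = a ^ 2 -> u x y = 0)
  (Hout : forall x y, x ^ 2 + y ^ 2 = b ^ 2 -> u x y = c)
  (Hmid : forall x y, ring_open a b x y -> 0 < u x y < c).
Hypothesis Htan : forall x y, x ^ 2 + y ^ 2 = a ^ 2 \/ x ^ 2 + y ^ 2 = b ^ 2 ->
  x * u2 x y - y * u1 x y = 0.
Hypothesis Hlow : forall x y, ring_closed a b x y -> m <= u1 x y ^ 2 + u2 x y ^ 2.

Let P (r t : R) : R := cos t * polar u1 r t + sin t * polar u2 r t.
Let Q (r t : R) : R := r * (cos t * polar u2 r t + - sin t * polar u1 r t).

Lemma polar_gradient (r t : R) : a < r < b ->
  differentiable_pt_lim (polar u) r t (P r t) (Q r t).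
Proof.
  intros Hr. apply differentiable_eq with
    (u1 (r * cos t) (r * sin t) * cos t + u2 (r * cos t) (r * sin t) * sin t)
    (r * (- u1 (r * cos t) (r * sin t) * sin t + u2 (r * cos t) (r * sin t) * cos t));
    [|unfold P, polar; ring|unfold Q, polar; ring].
  now apply differentiable_polar, HD, polar_ring_open.
Qed.

Lemma polar_boundary (r t : R) : r = a \/ r = b -> Q r t = 0 /\ polar u r t = polar u r 0.
Proof.
  intros Hr. split.
  - assert (H : r * cos t * u2 (r * cos t) (r * sin t) - r * sin t * u1 (r * cos t) (r * sin t) = 0).
    { apply Htan. rewrite polar_norm. destruct Hr as [-> | ->]; tauto. }
    unfold Q, polar. rewrite <- H. ring.
  - unfold polar. destruct Hr as [-> | ->];
      [rewrite !Hin by apply polar_norm|rewrite !Hout by apply polar_norm]; reflexivity.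
Qed.

Lemma polar_regularity : exists L B k : R, 0 < L /\ 0 < B /\ 0 < k /\
  taylor_on a b L (polar u) P Q /\
  (forall r t r' t', a <= r <= b -> a <= r' <= b ->
     Rabs (P r' t' - P r t) <= L * (Rabs (r' - r) + Rabs (t' - t)) /\
     Rabs (Q r' t' - Q r t) <= L * (Rabs (r' - r) + Rabs (t' - t))) /\
  (forall r t, a <= r <= b ->
     Rabs (P r t) <= B /\ Rabs (Q r t) <= B /\ k <= P r t ^ 2 + Q r t ^ 2).
Proof.
  destruct (polar_field_lipschitz a b M u1 u2 u11 u12 u21 u22) as (L & HL & Hbnd & Hlip); auto.
  { intros x y Hr. now apply HD. }
  { intros x y Hr. now apply HD. }
  { intros x y Hr. destruct (HM x y Hr). tauto. }
  exists L, L, (Rmin 1 (a ^ 2) * m).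
  assert (Ha2 : 0 < a ^ 2) by now apply pow_lt.
  split; [lra|]. split; [lra|]. split; [apply Rmult_lt_0_compat; [apply Rmin_glb_lt; lra|lra]|].
  split; [|split; [exact Hlip|]].
  - apply strip_taylor; auto; [lra| | |now apply radially_continuous_polar|apply polar_boundary].
    + intros r t Hr. apply (differentiable_partials _ _ _ _ _ (polar_gradient r t Hr)).
    + intros r t Hr. apply (differentiable_partials _ _ _ _ _ (polar_gradient r t Hr)).
  - intros r t Hr. destruct (Hbnd r t Hr) as [HP1 HQ1].
    split; [exact HP1|]. split; [exact HQ1|].
    pose proof (Hlow _ _ (polar_ring_closed a b r t Ha Hr)) as Hl.
    (* [Q] carries a factor r >= a, so the squared Cartesian gradient survives only with the weight
       min(1, a^2). *)
    assert (He : P r t ^ 2 + Q r t ^ 2 - Rmin 1 (a ^ 2) *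
      (polar u1 r t ^ 2 + polar u2 r t ^ 2) >= 0).
    { set (g1 := P r t). set (g2 := cos t * polar u2 r t + - sin t * polar u1 r t).
      assert (Hs : polar u1 r t ^ 2 + polar u2 r t ^ 2 = g1 ^ 2 + g2 ^ 2).
      { replace (g1 ^ 2 + g2 ^ 2) with
          ((Rsqr (sin t) + Rsqr (cos t)) * (polar u1 r t ^ 2 + polar u2 r t ^ 2))
          by (unfold g1, g2, P, Rsqr; ring). rewrite sin2_cos2. ring. }
      rewrite Hs. replace (Q r t) with (r * g2) by reflexivity.
      pose proof (Rmin_l 1 (a ^ 2)). pose proof (Rmin_r 1 (a ^ 2)).
      pose proof (pow2_ge_0 g1). pose proof (pow2_ge_0 g2).
      assert (Rmin 1 (a ^ 2) * g1 ^ 2 <= 1 * g1 ^ 2) by (apply Rmult_le_compat_r; lra).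
      assert (Rmin 1 (a ^ 2) * g2 ^ 2 <= r ^ 2 * g2 ^ 2).
      { apply Rmult_le_compat_r; [lra|]. assert (a ^ 2 <= r ^ 2) by (apply pow_incr; lra). lra. }
      rewrite Rpow_mult_distr. lra. }
    assert (Rmin 1 (a ^ 2) * m <= Rmin 1 (a ^ 2) * (polar u1 r t ^ 2 + polar u2 r t ^ 2)).
    { apply Rmult_le_compat_l; [|exact Hl]. apply Rlt_le, Rmin_glb_lt; lra. }
    lra.
Qed.

Lemma polar_levels :
  (forall t, polar u a t = 0) /\ (forall t, polar u b t = c) /\
  (forall r t, a < r < b -> 0 < polar u r t < c).
Proof.
  split; [intros t; apply Hin, polar_norm|]. split; [intros t; apply Hout, polar_norm|].
  intros r t Hr. now apply Hmid, polar_ring_open.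
Qed.

Lemma polar_normal_derivative (t : R) : 0 < P a t /\ 0 < P b t.
Proof.
  destruct polar_regularity as (L & B & k & HL & HB & Hk & HT & Hlip & HPQ).
  destruct polar_levels as (H1 & H2 & H3).
  apply (normal_derivative_pos a b c L B k (polar u) P Q); auto.
  intros t'. split; apply polar_boundary; tauto.
Qed.

Lemma laplacian_lipschitz : exists K : R, 0 < K /\ forall x y x' y',
  ring_open a b x y -> ring_open a b x' y' ->
  Rabs (u11 x' y' + u22 x' y' - (u11 x y + u22 x y)) <= K * Rabs (u x' y' - u x y).
Proof.
  destruct polar_regularity as (L & B & k & HL & HB & Hk & HT & Hlip & HPQ).
  destruct polar_levels as (H1 & H2 & H3).
  assert (HWb : bounded_lipschitz a b (polar (fun x y => u11 x y + u22 x y))).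
  { apply (bounded_lipschitz_polar a b (2 * M) _ w1 w2); auto. intros x y Hr.
    destruct (HM x y Hr) as (H11 & _ & _ & H22 & Hw1 & Hw2).
    pose proof (Rabs_pos (w1 x y)). pose proof (Rabs_triang (u11 x y) (u22 x y)).
    split; [now apply HD|]. lra. }
  destruct HWb as (B' & HB' & HW1 & HW2).
  destruct (lipschitz_function_of_level a b c L (B + B') k (polar u) P Q
    (polar (fun x y => u11 x y + u22 x y))) as (K & HK & HKl); auto; try lra.
  - intros r t Hr. destruct (HPQ r t Hr). lra.
  - intros t. split; apply polar_boundary; tauto.
  - intros r t Hr. specialize (HW1 r t Hr). lra.
  - intros r t r' t' Hr Hr'. specialize (HW2 r t r' t' Hr Hr').
    pose proof (Rabs_pos (r' - r)). pose proof (Rabs_pos (t' - t)).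
    assert (0 <= B * (Rabs (r' - r) + Rabs (t' - t))) by (apply Rmult_le_pos; lra). lra.
  - intros r t Hr. pose proof (polar_ring_open a b r t Ha Hr) as Hro.
    exists (w1 (r * cos t) (r * sin t) * cos t + w2 (r * cos t) (r * sin t) * sin t),
      (r * (- w1 (r * cos t) (r * sin t) * sin t + w2 (r * cos t) (r * sin t) * cos t)).
    split; [now apply differentiable_polar, HD|].
    pose proof (HJ _ _ Hro) as Hj. unfold P, Q, polar.
    set (x := r * cos t) in *. set (y := r * sin t) in *.
    (* Under polar coordinates the Jacobian of u and its Laplacian is multiplied by r. *)
    transitivity (r * (Rsqr (sin t) + Rsqr (cos t)) * (u1 x y * w2 x y - u2 x y * w1 x y)).
    + unfold Rsqr. ring.
    + rewrite Hj. ring.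
  - exists K. split; [exact HK|]. intros x y x' y' Hr Hr'.
    destruct (polar_form x y) as (t & Hx & Hy). destruct (polar_form x' y') as (t' & Hx' & Hy').
    pose proof (HKl _ t _ t' (radius_interior a b x y ltac:(lra) Hr)
      (radius_interior a b x' y' ltac:(lra) Hr')) as H.
    unfold polar in H. rewrite <- Hx, <- Hy, <- Hx', <- Hy' in H. exact H.
Qed.

(** The rotation by [al] takes the second axis to the bisector of be1 and be2. Then be1 corresponds
    to the point (r sin ga, r cos ga) and be2 to its mirror image, with sin ga >= 0 since ga lies in
    [0, PI]. *)
Lemma polar_reflection (r be1 be2 : R) :
  a <= r <= b -> 0 <= be2 - be1 <= 2 * PI -> polar u r be2 <= polar u r be1.
Proof.
  intros Hr Hbe. destruct laplacian_lipschitz as (K & HK & HKl).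
  set (al := (be1 + be2) / 2 - PI / 2). set (ga := (be2 - be1) / 2).
  assert (Hrot : forall x y, ring_open a b x y ->
    ring_open a b (cos al * x + - sin al * y) (sin al * x + cos al * y)).
  { intros x y H. unfold ring_open. rewrite rotation_norm. exact H. }
  (* The Laplacian is invariant under rotation: the mixed terms cancel. *)
  assert (Hlap : forall x y,
    cos al * (cos al * rotated al u11 x y + sin al * rotated al u21 x y) +
    sin al * (cos al * rotated al u12 x y + sin al * rotated al u22 x y) +
    (- sin al * (- sin al * rotated al u11 x y + cos al * rotated al u21 x y) +
     cos al * (- sin al * rotated al u12 x y + cos al * rotated al u22 x y))
    = rotated al u11 x y + rotated al u22 x y).
  { intros x y. transitivity ((Rsqr (sin al) + Rsqr (cos al)) *
      (rotated al u11 x y + rotated al u22 x y)); [unfold Rsqr; ring|].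
    rewrite sin2_cos2. ring. }
  pose proof (reflection_inequality a b c K (rotated al u)
    (fun x y => cos al * rotated al u1 x y + sin al * rotated al u2 x y)
    (fun x y => - sin al * rotated al u1 x y + cos al * rotated al u2 x y)
    (fun x y => cos al * (cos al * rotated al u11 x y + sin al * rotated al u21 x y) +
                sin al * (cos al * rotated al u12 x y + sin al * rotated al u22 x y))
    (fun x y => - sin al * (- sin al * rotated al u11 x y + cos al * rotated al u21 x y) +
                cos al * (- sin al * rotated al u12 x y + cos al * rotated al u22 x y)))
    as Hmain.
  specialize (Hmain Ha Hab Hc HK).
  specialize (Hmain (continuous_rotated a b al u Hu)).
  specialize (Hmain (continuous_2d_on_lin _ _ _ _ _ (continuous_rotated a b al u1 Hu1)
    (continuous_rotated a b al u2 Hu2))).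
  assert (Hfinal : polar u r be1 = rotated al u (r * sin ga) (r * cos ga) /\
    polar u r be2 = rotated al u (- (r * sin ga)) (r * cos ga)).
  { assert (H1 : be1 = al + (PI / 2 - ga)) by (unfold al, ga; field).
    assert (H2 : be2 = al + (PI / 2 + ga)) by (unfold al, ga; field).
    unfold polar, rotated. rewrite H1, H2.
    rewrite !sin_plus, !cos_plus, !sin_plus, !cos_minus, !sin_minus, cos_PI2, sin_PI2.
    split; f_equal; ring. }
  destruct Hfinal as [-> ->]. apply Hmain; clear Hmain.
  - intros x y Hxy. pose proof (Hrot x y Hxy) as Hr'.
    destruct (HD _ _ Hr') as (D0 & D1 & D2 & _).
    apply differentiable_rotated in D0, D1, D2.
    pose proof (differentiable_plus _ _ _ _ _ _ _ _
      (differentiable_scal (cos al) _ _ _ _ _ D1) (differentiable_scal (sin al) _ _ _ _ _ D2)) as E1.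
    pose proof (differentiable_plus _ _ _ _ _ _ _ _
      (differentiable_scal (- sin al) _ _ _ _ _ D1) (differentiable_scal (cos al) _ _ _ _ _ D2)) as E2.
    apply differentiable_partials in D0, E1, E2.
    split; [apply D0|]. split; [apply D0|]. split.
    + destruct E1 as [E1 _].
      match type of E1 with is_derive _ _ ?l => match goal with |- is_derive _ _ ?k =>
        replace k with l by ring end end. exact E1.
    + destruct E2 as [_ E2].
      match type of E2 with is_derive _ _ ?l => match goal with |- is_derive _ _ ?k =>
        replace k with l by ring end end. exact E2.
  - intros x y x' y' Hxy Hxy'. rewrite !Hlap. apply HKl; now apply Hrot.
  - intros x y Hxy. apply Hin. now rewrite rotation_norm.
  - intros x y Hxy. apply Hout. now rewrite rotation_norm.
  - intros x y Hxy. now apply Hmid, Hrot.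
  - intros x y Hxy Hx.
    unfold rotated. set (X := cos al * x + - sin al * y). set (Y := sin al * x + cos al * y).
    assert (HXY : X ^ 2 + Y ^ 2 = x ^ 2 + y ^ 2) by apply rotation_norm.
    assert (Hx' : x = cos al * X + sin al * Y).
    { unfold X, Y. transitivity ((Rsqr (sin al) + Rsqr (cos al)) * x);
        [rewrite sin2_cos2|unfold Rsqr]; ring. }
    rewrite <- HXY in Hxy.
    assert (Hxp : 0 < cos al * X + sin al * Y) by (rewrite <- Hx'; exact Hx).
    clearbody X Y. clear HXY Hx'.
    destruct (polar_form X Y) as (t & HX & HY).
    assert (Hcase : exists s, (s = a \/ s = b) /\ sqrt (X ^ 2 + Y ^ 2) = s).
    { destruct Hxy as [-> | ->]; [exists a|exists b]; (split; [tauto|apply sqrt_pow2; lra]). }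
    destruct Hcase as (s & Hs & Hse). rewrite Hse in HX, HY.
    assert (Hs0 : 0 < s) by (destruct Hs; lra).
    assert (HPs : 0 < P s t).
    { destruct Hs as [-> | ->]; apply polar_normal_derivative. }
    assert (HQs : Q s t = 0) by (apply polar_boundary; exact Hs).
    (* On a boundary circle the gradient is a positive multiple of the outward normal, so its
       component along the rotated first axis has the sign of x. *)
    assert (HPQ1 : u1 X Y = P s t * cos t /\ u2 X Y = P s t * sin t).
    { assert (HQ0 : cos t * polar u2 s t + - sin t * polar u1 s t = 0).
      { unfold Q in HQs. apply Rmult_integral in HQs. destruct HQs; lra. }
      unfold polar in HQ0. rewrite <- HX, <- HY in HQ0.
      unfold P, polar. rewrite <- HX, <- HY.
      pose proof (sin2_cos2 t) as Hsc. unfold Rsqr in Hsc.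
      split.
      - transitivity ((sin t * sin t + cos t * cos t) * u1 X Y
          + sin t * (cos t * u2 X Y + - sin t * u1 X Y)); [rewrite Hsc, HQ0|]; ring.
      - transitivity ((sin t * sin t + cos t * cos t) * u2 X Y
          - cos t * (cos t * u2 X Y + - sin t * u1 X Y)); [rewrite Hsc, HQ0|]; ring. }
    destruct HPQ1 as [-> ->].
    replace (cos al * (P s t * cos t) + sin al * (P s t * sin t)) with
      (P s t * ((cos al * (s * cos t) + sin al * (s * sin t)) / s)) by (field; lra).
    rewrite <- HX, <- HY. apply Rmult_lt_0_compat; [exact HPs|].
    now apply Rdiv_lt_0_compat.
  - apply Rmult_le_pos; [lra|]. apply sin_ge_0; unfold ga; lra.
  - unfold ring_closed. replace ((r * sin ga) ^ 2 + (r * cos ga) ^ 2) with (r ^ 2).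
    + split; apply pow_incr; lra.
    + rewrite <- (polar_norm r ga). ring.
Qed.

Theorem radial_symmetry (x y : R) : ring_open a b x y -> x * u2 x y - y * u1 x y = 0.
Proof.
  intros Hr. destruct (polar_form x y) as (t & Hx & Hy).
  pose proof (radius_interior a b x y ltac:(lra) Hr) as Hr'.
  set (r := sqrt (x ^ 2 + y ^ 2)) in *.
  pose proof PI_RGT_0 as Hpi.
  assert (Hper : forall s, polar u r (s + 2 * PI) = polar u r s).
  { intros s. unfold polar. rewrite cos_plus, sin_plus, cos_2PI, sin_2PI.
    f_equal; ring. }
  (* The reverse inequality compares s' with s + 2 PI, which is the same point as s. *)
  assert (Hconst : forall s s', 0 <= s' - s <= 2 * PI -> polar u r s' = polar u r s).
  { intros s s' Hs. apply Rle_antisym.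
    - apply polar_reflection; lra.
    - rewrite <- Hper. apply polar_reflection; lra. }
  destruct (differentiable_partials _ _ _ _ _ (polar_gradient r t Hr')) as [_ HQ'].
  assert (H0 : Q r t = 0).
  { apply is_derive_unique in HQ'. rewrite <- HQ'.
    apply is_derive_unique. apply is_derive_ext_loc with (fun _ => polar u r t).
    - apply locally_of_abs with PI; [exact Hpi|]. intros s Hs. apply Rabs_def2 in Hs.
      destruct (Rle_dec t s); [symmetry|]; apply Hconst; lra.
    - apply (is_derive_const (polar u r t)). }
  rewrite <- H0. unfold Q, polar. rewrite <- Hx, <- Hy.
  transitivity (r * cos t * u2 x y - r * sin t * u1 x y); [|ring].
  rewrite <- Hx, <- Hy. reflexivity.
Qed.

End Radial.

(** * The stream function *)

Lemma continuity_2d_of_differentiable (f : R -> R -> R) (x y l1 l2 : R) :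
  differentiable_pt_lim f x y l1 l2 -> continuity_2d_pt f x y.
Proof. intros H. apply differentiable_continuity_pt. now exists l1, l2. Qed.

Lemma radius_closed (a b x y : R) : 0 < a < b ->
  ring_closed a b x y -> a <= sqrt (x ^ 2 + y ^ 2) <= b.
Proof.
  intros Ha [H4 H5]. rewrite <- (sqrt_pow2 a), <- (sqrt_pow2 b) by lra.
  split; apply sqrt_le_1_alt; lra.
Qed.

(** * Integration of a closed field along rays *)

Section Potential.

Variables (a b M : R) (u1 u2 u11 u12 u22 : R -> R -> R).
Hypotheses (Ha : 0 < a) (Hab : a < b).
Hypotheses (Hu1 : continuous_2d_on (ring_closed a b) u1)
  (Hu2 : continuous_2d_on (ring_closed a b) u2).
Hypothesis HD1 : forall x y, ring_open a b x y -> differentiable_pt_lim u1 x y (u11 x y) (u12 x y).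
Hypothesis HD2 : forall x y, ring_open a b x y -> differentiable_pt_lim u2 x y (u12 x y) (u22 x y).
Hypothesis HM : forall x y, ring_open a b x y ->
  Rabs (u11 x y) <= M /\ Rabs (u12 x y) <= M /\ Rabs (u22 x y) <= M.
Hypotheses (HB11 : bounded_lipschitz a b (polar u11)) (HB12 : bounded_lipschitz a b (polar u12))
  (HB22 : bounded_lipschitz a b (polar u22)).
Hypothesis Htan : forall x y, x ^ 2 + y ^ 2 = a ^ 2 \/ x ^ 2 + y ^ 2 = b ^ 2 ->
  x * u2 x y - y * u1 x y = 0.

Let P (r t : R) : R := cos t * polar u1 r t + sin t * polar u2 r t.
Let Q (r t : R) : R := r * (cos t * polar u2 r t + - sin t * polar u1 r t).
Let U (r t : R) : R := RInt (fun s => P (clamp a b s) t) a r.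

(* The line integral of the field along the ray from the inner circle; [clamp] only keeps the integrand continuous outside the annulus. *)
Definition ray_potential (x y : R) : R :=
  RInt (fun s => let k := clamp a b s / sqrt (x ^ 2 + y ^ 2) in
    x / sqrt (x ^ 2 + y ^ 2) * u1 (k * x) (k * y) +
    y / sqrt (x ^ 2 + y ^ 2) * u2 (k * x) (k * y)) a (sqrt (x ^ 2 + y ^ 2)).

Lemma polar_ray_potential (r t : R) : 0 < r -> polar ray_potential r t = U r t.
Proof.
  intros Hr. unfold polar, ray_potential. rewrite polar_norm, sqrt_pow2 by lra.
  unfold U. apply RInt_ext. intros s _. cbv zeta. unfold P, polar.
  replace (clamp a b s / r * (r * cos t)) with (clamp a b s * cos t) by (field; lra).
  replace (clamp a b s / r * (r * sin t)) with (clamp a b s * sin t) by (field; lra).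
  replace (r * cos t / r) with (cos t) by (field; lra).
  replace (r * sin t / r) with (sin t) by (field; lra). reflexivity.
Qed.

Lemma potential_at_inner (t : R) : U a t = 0.
Proof. unfold U. apply (RInt_point (V := R_CompleteNormedModule)). Qed.

Lemma radial_component_continuous : radially_continuous a b P.
Proof.
  apply radially_continuous_plus; apply (radially_continuous_scal a b);
    now apply radially_continuous_polar.
Qed.

Lemma potential_radial_derivative (r t : R) : is_derive (fun s => U s t) r (P (clamp a b r) t).
Proof.
  assert (Hcont : forall s, continuous (fun s => P (clamp a b s) t) s).
  { intros s. apply continuity_pt_filterlim. intros eps He.
    destruct (radial_component_continuous (clamp a b s) t ltac:(apply clamp_in; lra) eps He)
      as (d & Hd & H).
    exists d. split; [exact Hd|]. intros s' [_ Hs']. simpl in *. unfold Rdist in *.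
    apply H; [apply clamp_in; lra|].
    apply Rle_lt_trans with (2 := Hs'), clamp_lipschitz. }
  apply (is_derive_RInt (V := R_NormedModule) (fun s => P (clamp a b s) t) _ a); [|apply Hcont].
  apply filter_forall. intros s. apply (RInt_correct (V := R_CompleteNormedModule)).
  apply (ex_RInt_continuous (V := R_CompleteNormedModule)). intros; apply Hcont.
Qed.

Lemma potential_radially_continuous (r t eps : R) : 0 < eps -> exists d, 0 < d /\
  forall r', Rabs (r' - r) < d -> Rabs (U r' t - U r t) < eps.
Proof.
  intros He.
  assert (Hc : continuity_pt (fun s => U s t) r).
  { apply derivable_continuous_pt. exists (P (clamp a b r) t).
    apply is_derive_Reals, potential_radial_derivative. }
  destruct (Hc eps He) as (d & Hd & H). exists d. split; [exact Hd|].
  intros r' Hr'. destruct (Req_dec r' r) as [->|Hn]; [now rewrite Rminus_diag, Rabs_R0|].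
  apply H. split; [split; [exact I|auto]|exact Hr'].
Qed.

(** The common value of the angular derivative of [P] and the radial derivative of [Q]. They agree
    because the field is closed: u12 is the derivative of u1 in y and of u2 in x. *)
Let Pt (r t : R) : R := - sin t * polar u1 r t + cos t * polar u2 r t +
  r * (- cos t * sin t * polar u11 r t + (cos t * cos t + - sin t * sin t) * polar u12 r t
       + cos t * sin t * polar u22 r t).

Lemma polar_component_derivatives (r t : R) : a < r < b ->
  is_derive (fun s => P r s) t (Pt r t) /\ is_derive (fun s => Q s t) r (Pt r t).
Proof.
  intros Hr. pose proof (polar_ring_open a b r t Ha Hr) as Ho.
  pose proof (differentiable_polar _ _ _ _ _ (HD1 _ _ Ho)) as E1.
  pose proof (differentiable_polar _ _ _ _ _ (HD2 _ _ Ho)) as E2.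
  fold (polar u11 r t) in E1. fold (polar u12 r t) in E1, E2. fold (polar u22 r t) in E2.
  apply differentiable_partials in E1, E2. destruct E1 as [E1r E1t]. destruct E2 as [E2r E2t].
  split.
  - unfold P. evar_last.
    + apply (is_derive_plus (fun s => cos s * polar u1 r s) (fun s => sin s * polar u2 r s)).
      * apply (is_derive_mult cos (fun s => polar u1 r s)); [|exact E1t|exact Rmult_comm].
        auto_derive; [trivial|reflexivity].
      * apply (is_derive_mult sin (fun s => polar u2 r s)); [|exact E2t|exact Rmult_comm].
        auto_derive; [trivial|reflexivity].
    + unfold Pt, plus, mult; simpl. ring.
  - unfold Q. evar_last.
    + apply (is_derive_mult (fun s => s)
        (fun s => cos t * polar u2 s t + - sin t * polar u1 s t)); [| |exact Rmult_comm].
      * auto_derive; trivial.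
      * apply (is_derive_plus (fun s => cos t * polar u2 s t) (fun s => - sin t * polar u1 s t)).
        -- apply (is_derive_scal (fun s => polar u2 s t)). exact E2r.
        -- apply (is_derive_scal (fun s => polar u1 s t)). exact E1r.
    + unfold Pt, plus, mult, scal; simpl. unfold mult; simpl. ring.
Qed.

Lemma tangential_component_boundary (r t : R) : r = a \/ r = b -> Q r t = 0.
Proof.
  intros Hr.
  assert (H : r * cos t * u2 (r * cos t) (r * sin t) - r * sin t * u1 (r * cos t) (r * sin t) = 0).
  { apply Htan. rewrite polar_norm. destruct Hr as [-> | ->]; tauto. }
  unfold Q, polar. rewrite <- H. ring.
Qed.

(* [U r t' - U r t - (t' - t) Q r t] vanishes at [r = a], and its radial derivative is the first-order Taylor remainder of [P r], because the field is closed. *)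
Lemma potential_angular_increment : exists B : R, 0 < B /\ forall r t t' : R, a <= r <= b ->
  Rabs (U r t' - U r t - (t' - t) * Q r t) <= B * (t' - t) ^ 2.
Proof.
  assert (HBL : bounded_lipschitz a b Pt).
  { destruct (bounded_lipschitz_trig a b) as [Hcos Hsin].
    assert (Hp1 : bounded_lipschitz a b (polar u1)).
    { apply (bounded_lipschitz_polar_of_gradient a b M u1 u11 u12); auto. intros x y Hr. destruct (HM x y Hr). tauto. }
    assert (Hp2 : bounded_lipschitz a b (polar u2)).
    { apply (bounded_lipschitz_polar_of_gradient a b M u2 u12 u22); auto. intros x y Hr. destruct (HM x y Hr). tauto. }
    pose proof (bounded_lipschitz_fst a b) as Hfst.
    assert (Hneg : forall f, bounded_lipschitz a b f -> bounded_lipschitz a b (fun r t => - f r t)).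
    { intros f Hf. apply bounded_lipschitz_ext with (fun r t => -1 * f r t); [intros; ring|].
      apply bounded_lipschitz_mult; [apply bounded_lipschitz_const|exact Hf]. }
    pose proof (Hneg _ Hcos) as Hmcos. pose proof (Hneg _ Hsin) as Hmsin.
    unfold Pt.
    repeat first [assumption | apply bounded_lipschitz_plus | apply bounded_lipschitz_mult]. }
  destruct HBL as (B & HB & _ & HBl).
  exists (B * (b - a)). split; [apply Rmult_lt_0_compat; lra|].
  intros r t t' Hr.
  destruct (Req_dec r a) as [->|Hra].
  { rewrite !potential_at_inner, tangential_component_boundary by tauto.
    replace (0 - 0 - (t' - t) * 0) with 0 by ring. rewrite Rabs_R0.
    apply Rmult_le_pos; [apply Rmult_le_pos; lra|apply pow2_ge_0]. }
  destruct (MVT_within (fun s => U s t' - U s t - (t' - t) * Q s t)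
    (fun s => P s t' - P s t - (t' - t) * Pt s t) a r) as (s & Hs & He); [lra| | |].
  - intros s Hs.
    pose proof (potential_radial_derivative s t) as D1.
    pose proof (potential_radial_derivative s t') as D2.
    rewrite clamp_id in D1, D2 by lra.
    apply (is_derive_minus (fun s => U s t' - U s t) (fun s => (t' - t) * Q s t)).
    + now apply (is_derive_minus (fun s => U s t')).
    + apply (is_derive_scal (fun s => Q s t)). apply polar_component_derivatives. lra.
  - intros s Hs eps Heps.
    destruct (potential_radially_continuous s t (eps / 3) ltac:(lra)) as (d1 & Hd1 & H1).
    destruct (potential_radially_continuous s t' (eps / 3) ltac:(lra)) as (d2 & Hd2 & H2).
    assert (HQc : radially_continuous a b (fun r t => (t' - t) * Q r t)).
    { apply (radially_continuous_scal a b (fun t => t' - t)).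
      apply radially_continuous_mult_fst; [lra|].
      apply radially_continuous_plus; apply (radially_continuous_scal a b);
        now apply radially_continuous_polar. }
    destruct (HQc s t ltac:(destruct Hs; lra) (eps / 3) ltac:(lra)) as (d3 & Hd3 & H3).
    exists (Rmin d1 (Rmin d2 d3)). split; [repeat apply Rmin_glb_lt; assumption|].
    intros s' Hs' Hd.
    pose proof (Rmin_l d1 (Rmin d2 d3)). pose proof (Rmin_r d1 (Rmin d2 d3)).
    pose proof (Rmin_l d2 d3). pose proof (Rmin_r d2 d3).
    specialize (H1 s' ltac:(lra)). specialize (H2 s' ltac:(lra)).
    specialize (H3 s' ltac:(lra) ltac:(lra)).
    apply Rabs_def2 in H1, H2, H3. apply Rabs_def1; lra.
  - rewrite !potential_at_inner, (tangential_component_boundary a t) in He by tauto.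
    replace (U r t' - U r t - (t' - t) * Q r t) with
      ((P s t' - P s t - (t' - t) * Pt s t) * (r - a)) by lra.
    assert (Hs' : a < s < b) by lra.
    destruct (MVT_gen (fun z => P s z) t t' (fun z => Pt s z)) as (z & Hz & Hze).
    { intros z _. now apply polar_component_derivatives. }
    { intros z _. apply derivable_continuous_pt. exists (Pt s z).
      now apply is_derive_Reals, polar_component_derivatives. }
    rewrite Hze.
    replace (Pt s z * (t' - t) - (t' - t) * Pt s t) with ((Pt s z - Pt s t) * (t' - t)) by ring.
    rewrite !Rabs_mult, (Rabs_pos_eq (r - a)) by lra.
    assert (Hzt : Rabs (z - t) <= Rabs (t' - t)).
    { unfold Rmin, Rmax in Hz. unfold Rabs.
      destruct (Rle_dec t t'); repeat destruct (Rcase_abs _); lra. }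
    pose proof (HBl s t s z Hs' Hs') as Hb. rewrite Rminus_diag, Rabs_R0, Rplus_0_l in Hb.
    rewrite <- (pow2_abs (t' - t)).
    replace (B * (b - a) * Rabs (t' - t) ^ 2) with
      (B * Rabs (t' - t) * Rabs (t' - t) * (b - a)) by ring.
    pose proof (Rabs_pos (t' - t)).
    apply Rmult_le_compat; try lra.
    { apply Rmult_le_pos; apply Rabs_pos. }
    apply Rmult_le_compat_r; [lra|]. apply Rle_trans with (1 := Hb).
    apply Rmult_le_compat_l; lra.
Qed.

(** The quadratic bound on increments is uniform in r, so the derivative exists on the two boundary
    circles as well. *)
Lemma potential_angular_derivative (r t : R) : a <= r <= b ->
  is_derive (fun s => U r s) t (Q r t).
Proof.
  intros Hr. destruct potential_angular_increment as (B & HB & H).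
  apply is_derive_Reals. intros eps He.
  assert (Hd : 0 < eps / B) by now apply Rdiv_lt_0_compat.
  exists (mkposreal _ Hd). intros h Hh Hhd. simpl in Hhd.
  specialize (H r t (t + h) Hr). replace (t + h - t) with h in H by ring.
  replace ((U r (t + h) - U r t) / h - Q r t) with ((U r (t + h) - U r t - h * Q r t) / h)
    by (field; exact Hh).
  pose proof (Rabs_pos_lt h Hh) as Hp.
  unfold Rdiv. rewrite Rabs_mult, Rabs_inv.
  apply Rmult_lt_reg_r with (Rabs h); [exact Hp|].
  rewrite Rmult_assoc, Rinv_l, Rmult_1_r by lra.
  apply Rle_lt_trans with (1 := H). rewrite <- (pow2_abs h).
  replace (B * Rabs h ^ 2) with (B * Rabs h * Rabs h) by ring.
  apply Rmult_lt_compat_r; [exact Hp|].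
  apply Rmult_lt_reg_r with (/ B); [now apply Rinv_0_lt_compat|].
  replace (B * Rabs h * / B) with (Rabs h) by (field; lra). exact Hhd.
Qed.

(** On both circles the field is normal, so the angular derivative [Q] vanishes there. *)
Lemma potential_boundary (r t : R) : r = a \/ r = b -> U r t = U r 0.
Proof.
  intros Hr.
  assert (H : Rabs (U r t - U r 0) <= 0 * Rabs (t - 0)).
  { apply (lipschitz_of_derive (fun s => U r s) (fun s => Q r s)). intros s _. split.
    - apply potential_angular_derivative. destruct Hr; lra.
    - rewrite tangential_component_boundary, Rabs_R0 by exact Hr. lra. }
  pose proof (Rabs_pos (U r t - U r 0)).
  apply Rminus_diag_uniq, NNPP. intros Hn. apply Rabs_pos_lt in Hn. lra.
Qed.

Lemma potential_taylor : exists L : R, 0 < L /\ taylor_on a b L U P Q /\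
  forall r t, a <= r <= b -> Rabs (P r t) <= L.
Proof.
  destruct (polar_field_lipschitz a b M u1 u2 u11 u12 u12 u22) as (L & HL & Hbnd & Hlip); auto.
  { intros x y Hr. destruct (HM x y Hr). tauto. }
  exists L. split; [exact HL|]. split.
  - apply strip_taylor; auto; [lra| | | |].
    + intros r t Hr. rewrite <- (clamp_id a b r) at 2 by lra.
      apply potential_radial_derivative.
    + intros r t Hr. apply potential_angular_derivative. lra.
    + intros r t Hr eps He. destruct (potential_radially_continuous r t eps He) as (d & Hd & H).
      exists d. split; [exact Hd|]. intros r' _. apply H.
    + intros r t Hr. split; [now apply tangential_component_boundary|now apply potential_boundary].
  - intros r t Hr. now apply Hbnd.
Qed.

Lemma potential_differentiable (r t : R) : a < r < b ->
  differentiable_pt_lim U r t (P r t) (Q r t).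
Proof.
  intros Hr. destruct potential_taylor as (L & HL & HT & _). intros eps.
  set (d := Rmin (Rmin (r - a) (b - r)) (eps / (4 * L))).
  assert (Hd : 0 < d).
  { repeat apply Rmin_glb_lt; try lra. apply Rdiv_lt_0_compat; [apply cond_pos|lra]. }
  exists (mkposreal d Hd). simpl. intros r' t' Hr' Ht'.
  pose proof (Rmin_l (Rmin (r - a) (b - r)) (eps / (4 * L))) as Hd1.
  pose proof (Rmin_r (Rmin (r - a) (b - r)) (eps / (4 * L))) as Hd2. fold d in Hd1, Hd2.
  pose proof (Rmin_l (r - a) (b - r)). pose proof (Rmin_r (r - a) (b - r)).
  assert (Hin : a <= r' <= b) by (apply Rabs_def2 in Hr'; lra).
  apply Rle_trans with (1 := HT r t r' t' ltac:(lra) Hin).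
  set (n := Rmax (Rabs (r' - r)) (Rabs (t' - t))).
  pose proof (Rmax_l (Rabs (r' - r)) (Rabs (t' - t))) as Hn1.
  pose proof (Rmax_r (Rabs (r' - r)) (Rabs (t' - t))) as Hn2. fold n in Hn1, Hn2.
  assert (Hn : n <= d) by (apply Rmax_lub; lra).
  pose proof (Rabs_pos (r' - r)). pose proof (Rabs_pos (t' - t)).
  apply Rle_trans with (L * (2 * n) ^ 2).
  { apply Rmult_le_compat_l; [lra|]. apply pow_incr. lra. }
  replace (L * (2 * n) ^ 2) with (4 * L * n * n) by ring.
  apply Rmult_le_compat_r; [lra|].
  apply Rle_trans with (4 * L * (eps / (4 * L))); [|right; field; lra].
  apply Rmult_le_compat_l; lra.
Qed.

Lemma ray_potential_inner (x y : R) : x ^ 2 + y ^ 2 = a ^ 2 -> ray_potential x y = 0.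
Proof.
  intros H. destruct (polar_form x y) as (t & Hx & Hy).
  rewrite H, sqrt_pow2 in Hx, Hy by lra.
  rewrite <- (potential_at_inner t), <- polar_ray_potential by lra.
  unfold polar. now rewrite <- Hx, <- Hy.
Qed.

Lemma ray_potential_outer (x y : R) : x ^ 2 + y ^ 2 = b ^ 2 -> ray_potential x y = U b 0.
Proof.
  intros H. destruct (polar_form x y) as (t & Hx & Hy).
  rewrite H, sqrt_pow2 in Hx, Hy by lra.
  rewrite <- (potential_boundary b t), <- polar_ray_potential by (tauto || lra).
  unfold polar. now rewrite <- Hx, <- Hy.
Qed.

(** In the frame rotated by t, the arc tangent of the slope gives an angle that is differentiable on
    a whole half-plane around the direction t. *)
Lemma local_polar_coordinates (t x y : R) :
  0 < cos t * x + sin t * y ->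
  let rho := sqrt (x ^ 2 + y ^ 2) in
  let tau := t + atan ((- sin t * x + cos t * y) * / (cos t * x + sin t * y)) in
  rho * cos tau = x /\ rho * sin tau = y.
Proof.
  intros Hxi. cbv zeta. set (xi := cos t * x + sin t * y) in *. set (eta := - sin t * x + cos t * y).
  pose proof (sin2_cos2 t) as Hsc. unfold Rsqr in Hsc.
  assert (Hx : x = cos t * xi - sin t * eta).
  { transitivity ((sin t * sin t + cos t * cos t) * x); [rewrite Hsc|unfold xi, eta]; ring. }
  assert (Hy : y = sin t * xi + cos t * eta).
  { transitivity ((sin t * sin t + cos t * cos t) * y); [rewrite Hsc|unfold xi, eta]; ring. }
  assert (Hn : x ^ 2 + y ^ 2 = xi ^ 2 * (1 + (eta * / xi)²)).
  { rewrite Hx, Hy. transitivity ((sin t * sin t + cos t * cos t) * (xi ^ 2 + eta ^ 2)); [ring|].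
    rewrite Hsc. unfold Rsqr. field. lra. }
  assert (Hpos : 0 < 1 + (eta * / xi)²) by (pose proof (Rle_0_sqr (eta * / xi)); lra).
  pose proof (sqrt_lt_R0 _ Hpos) as Hs.
  rewrite Hn, sqrt_mult_alt, sqrt_pow2 by (try apply pow2_ge_0; lra).
  rewrite cos_plus, sin_plus, cos_atan, sin_atan.
  set (q := sqrt (1 + (eta * / xi)²)) in *.
  split; [rewrite Hx at 1|rewrite Hy at 1]; field; lra.
Qed.

(** Near the point, [ray_potential] is U composed with the local coordinates [rho] and [tau], whose
    gradients are (cos t, sin t) and (- sin t, cos t) / r. Orthonormality of this frame turns (P, Q)
    back into (u1, u2). *)
Lemma ray_potential_differentiable (x y : R) : ring_open a b x y ->
  differentiable_pt_lim ray_potential x y (u1 x y) (u2 x y).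
Proof.
  intros Ho. destruct (polar_form x y) as (t & Hx & Hy).
  pose proof (radius_interior a b x y ltac:(lra) Ho) as Hr.
  set (r := sqrt (x ^ 2 + y ^ 2)) in *.
  pose proof (sin2_cos2 t) as Hsc. unfold Rsqr in Hsc.
  assert (Hxi : cos t * x + sin t * y = r).
  { rewrite Hx, Hy. transitivity ((sin t * sin t + cos t * cos t) * r); [ring|]. rewrite Hsc. ring. }
  assert (Heta : - sin t * x + cos t * y = 0) by (rewrite Hx, Hy; ring).
  set (tau := fun x y => t + atan ((- sin t * x + cos t * y) * / (cos t * x + sin t * y))).
  set (rho := fun x y : R => sqrt (x ^ 2 + y ^ 2)).
  assert (Htau0 : tau x y = t).
  { unfold tau. rewrite Heta, Rmult_0_l, atan_0. ring. }
  pose proof (differentiable_linear (- sin t) (cos t) x y) as Deta.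
  pose proof (differentiable_linear (cos t) (sin t) x y) as Dxi.
  assert (Dtau : differentiable_pt_lim tau x y (- sin t / r) (cos t / r)).
  { assert (Dinv : differentiable_pt_lim (fun x y => / (cos t * x + sin t * y)) x y
      (- / r ^ 2 * cos t) (- / r ^ 2 * sin t)).
    { apply (differentiable_comp1 (fun z => / z)); [|exact Dxi]. rewrite Hxi.
      auto_derive; [lra|field; lra]. }
    pose proof (differentiable_mult _ _ _ _ _ _ _ _ Deta Dinv) as Dq.
    cbv beta in Dq. rewrite Heta, Hxi in Dq.
    apply differentiable_eq with (0 + 1 * (/ r * - sin t + 0 * (- / r ^ 2 * cos t)))
      (0 + 1 * (/ r * cos t + 0 * (- / r ^ 2 * sin t))); [|field; lra|field; lra].
    apply (differentiable_plus (fun _ _ => t)); [apply differentiable_const|].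
    apply (differentiable_comp1 atan); [|exact Dq].
    rewrite Heta, Rmult_0_l. apply is_derive_Reals.
    replace 1 with (/ (1 + 0 ^ 2)) by field. apply derivable_pt_lim_atan. }
  assert (Drho : differentiable_pt_lim rho x y (cos t) (sin t)).
  { assert (Dsq : differentiable_pt_lim (fun x y => x ^ 2 + y ^ 2) x y (2 * x) (2 * y)).
    { apply differentiable_eq with (2 * x * 1 + 2 * y * 0) (2 * x * 0 + 2 * y * 1); try ring.
      apply (differentiable_plus (fun x _ => x ^ 2) (fun _ y => y ^ 2)).
      - apply (differentiable_comp1 (fun z => z ^ 2) (fun x _ => x)); [|apply differentiable_id_fst].
        auto_derive; [trivial|ring].
      - apply (differentiable_comp1 (fun z => z ^ 2) (fun _ y => y)); [|apply differentiable_id_snd].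
        auto_derive; [trivial|ring]. }
    assert (Hp : 0 < x ^ 2 + y ^ 2) by (destruct Ho; pose proof (pow_lt a 2 Ha); lra).
    apply differentiable_eq with (/ (2 * r) * (2 * x)) (/ (2 * r) * (2 * y)).
    - apply (differentiable_comp1 sqrt); [|exact Dsq].
      apply is_derive_Reals, derivable_pt_lim_sqrt. exact Hp.
    - rewrite Hx at 1. field. lra.
    - rewrite Hy at 1. field. lra. }
  apply differentiable_pt_lim_ext with (fun x y => U (rho x y) (tau x y)).
  - destruct (continuity_2d_of_differentiable _ _ _ _ _ Dxi (mkposreal r ltac:(lra))) as [d Hd].
    destruct (sum_squares_near x y (x ^ 2 + y ^ 2)) as (d' & Hd' & Hn).
    { destruct Ho. pose proof (pow_lt a 2 Ha). lra. }
    assert (Hm : 0 < Rmin d d') by (apply Rmin_glb_lt; [apply cond_pos|exact Hd']).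
    exists (mkposreal _ Hm). simpl. intros x' y' Hx' Hy'.
    pose proof (Rmin_l d d'). pose proof (Rmin_r d d').
    specialize (Hd x' y' ltac:(lra) ltac:(lra)). simpl in Hd. rewrite Hxi in Hd.
    specialize (Hn x' y' ltac:(lra) ltac:(lra)). apply Rabs_def2 in Hd, Hn.
    destruct (local_polar_coordinates t x' y' ltac:(lra)) as [H1 H2].
    rewrite <- polar_ray_potential by (apply sqrt_lt_R0; lra).
    unfold polar. fold (rho x' y') in H1, H2. fold (tau x' y') in H1, H2. now rewrite H1, H2.
  - apply differentiable_eq with (P r t * cos t + Q r t * (- sin t / r))
      (P r t * sin t + Q r t * (cos t / r)).
    + apply (differentiable_pt_lim_comp U rho tau); auto.
      rewrite Htau0. now apply potential_differentiable.
    + unfold P, Q, polar. rewrite <- Hx, <- Hy.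
      transitivity ((sin t * sin t + cos t * cos t) * u1 x y); [field; lra|rewrite Hsc; ring].
    + unfold P, Q, polar. rewrite <- Hx, <- Hy.
      transitivity ((sin t * sin t + cos t * cos t) * u2 x y); [field; lra|rewrite Hsc; ring].
Qed.

(** At a boundary point, U is constant along the circle and Lipschitz along rays, so only the
    difference of radii counts. That difference is controlled by the difference of squares, since
    the sum of the radii is at least a. *)
Lemma ray_potential_continuous : continuous_2d_on (ring_closed a b) ray_potential.
Proof.
  destruct potential_taylor as (L & HL & _ & HPL).
  assert (Hbdry : forall s x y, s = a \/ s = b -> x ^ 2 + y ^ 2 = s ^ 2 ->
    forall eps, 0 < eps -> exists d, 0 < d /\ forall x' y', ring_closed a b x' y' ->
      Rabs (x' - x) < d -> Rabs (y' - y) < d ->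
      Rabs (ray_potential x' y' - ray_potential x y) < eps).
  { intros s x y Hs Hxy eps He.
    destruct (sum_squares_near x y (a * eps / L)) as (d & Hd & Hn).
    { apply Rdiv_lt_0_compat; [apply Rmult_lt_0_compat|]; lra. }
    exists d. split; [exact Hd|]. intros x' y' Hc Hx Hy. specialize (Hn x' y' Hx Hy).
    pose proof (radius_closed a b x' y' ltac:(lra) Hc) as Hr.
    destruct (polar_form x' y') as (t & Hx' & Hy').
    assert (Hval : ray_potential x y = U s t).
    { destruct Hs as [-> | ->].
      - rewrite ray_potential_inner, potential_at_inner by exact Hxy. reflexivity.
      - rewrite ray_potential_outer by exact Hxy. symmetry. apply potential_boundary. tauto. }
    assert (Hr2 : sqrt (x' ^ 2 + y' ^ 2) ^ 2 = x' ^ 2 + y' ^ 2).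
    { apply pow2_sqrt. pose proof (pow2_ge_0 x'). pose proof (pow2_ge_0 y'). lra. }
    set (r := sqrt (x' ^ 2 + y' ^ 2)) in *.
    assert (Hval' : ray_potential x' y' = U r t).
    { rewrite <- polar_ray_potential by lra. unfold polar. now rewrite <- Hx', <- Hy'. }
    rewrite Hval, Hval'.
    assert (Hl : Rabs (U r t - U s t) <= L * Rabs (r - s)).
    { apply (lipschitz_of_derive (fun z => U z t) (fun z => P (clamp a b z) t)).
      intros z _. split; [apply potential_radial_derivative|].
      apply HPL, clamp_in. lra. }
    assert (Hs0 : a <= s <= b) by (destruct Hs; lra).
    rewrite <- Hr2, Hxy in Hn.
    replace (r ^ 2 - s ^ 2) with ((r + s) * (r - s)) in Hn by ring.
    rewrite Rabs_mult, (Rabs_pos_eq (r + s)) in Hn by lra.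
    pose proof (Rabs_pos (r - s)).
    assert (Hn2 : a * Rabs (r - s) < a * eps / L).
    { apply Rle_lt_trans with (2 := Hn). apply Rmult_le_compat_r; lra. }
    apply Rle_lt_trans with (1 := Hl).
    apply Rmult_lt_reg_r with (a / L); [apply Rdiv_lt_0_compat; lra|].
    replace (L * Rabs (r - s) * (a / L)) with (a * Rabs (r - s)) by (field; lra).
    replace (eps * (a / L)) with (a * eps / L) by (field; lra). exact Hn2. }
  intros x y Hc eps He.
  destruct (Req_dec (x ^ 2 + y ^ 2) (a ^ 2)) as [Hi|Hi]; [apply (Hbdry a); tauto|].
  destruct (Req_dec (x ^ 2 + y ^ 2) (b ^ 2)) as [Ho|Ho]; [apply (Hbdry b); tauto|].
  assert (Hopen : ring_open a b x y) by (destruct Hc; split; lra).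
  destruct (continuity_2d_of_differentiable _ _ _ _ _ (ray_potential_differentiable x y Hopen)
    (mkposreal eps He)) as [d Hd].
  exists d. split; [apply cond_pos|]. intros x' y' _. apply Hd.
Qed.

(** A closed field on an annulus may fail to be a gradient. Here [Htan] makes its circulation along
    the inner circle zero, and gives one value on the outer circle. *)
Theorem potential_exists : exists (c : R) (u : R -> R -> R),
  continuous_2d_on (ring_closed a b) u /\
  (forall x y, ring_open a b x y -> differentiable_pt_lim u x y (u1 x y) (u2 x y)) /\
  (forall x y, x ^ 2 + y ^ 2 = a ^ 2 -> u x y = 0) /\
  (forall x y, x ^ 2 + y ^ 2 = b ^ 2 -> u x y = c).
Proof.
  exists (U b 0), ray_potential. split; [apply ray_potential_continuous|].
  split; [apply ray_potential_differentiable|].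
  split; [apply ray_potential_inner|apply ray_potential_outer].
Qed.

End Potential.

(** * Steady flows without stagnation points *)

(** Made for functions such as the pressure, whose second derivatives are known only through an
    equation for the gradient. *)
Lemma schwarz_of_gradient (f A B Ay Bx : R -> R -> R) (x y d : R) :
  0 < d ->
  (forall u v, Rabs (u - x) < d -> Rabs (v - y) < d ->
     is_derive (fun z => f z v) u (A u v) /\ is_derive (fun z => f u z) v (B u v) /\
     is_derive (fun z => A u z) v (Ay u v) /\ is_derive (fun z => B z v) u (Bx u v)) ->
  continuity_2d_pt Ay x y -> continuity_2d_pt Bx x y -> Ay x y = Bx x y.
Proof.
  intros Hd H HAy HBx.
  assert (Hnear : forall u v, Rabs (u - x) < d -> Rabs (v - y) < d ->
    locally u (fun z => Rabs (z - x) < d) /\ locally v (fun z => Rabs (z - y) < d)).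
  { intros u v Hu Hv. split.
    - apply locally_of_abs with (d - Rabs (u - x)); [lra|]. intros t Ht.
      replace (t - x) with ((t - u) + (u - x)) by ring.
      apply Rle_lt_trans with (1 := Rabs_triang _ _). lra.
    - apply locally_of_abs with (d - Rabs (v - y)); [lra|]. intros t Ht.
      replace (t - y) with ((t - v) + (v - y)) by ring.
      apply Rle_lt_trans with (1 := Rabs_triang _ _). lra. }
  assert (Ext1 : forall u v, Rabs (u - x) < d -> Rabs (v - y) < d ->
    is_derive (fun z => Derive (fun t => f z t) v) u (Bx u v)).
  { intros u v Hu Hv. apply is_derive_ext_loc with (fun z => B z v); [|now apply H].
    apply filter_imp with (2 := proj1 (Hnear u v Hu Hv)). intros z Hz.
    symmetry. now apply is_derive_unique, H. }
  assert (Ext2 : forall u v, Rabs (u - x) < d -> Rabs (v - y) < d ->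
    is_derive (fun z => Derive (fun t => f t z) u) v (Ay u v)).
  { intros u v Hu Hv. apply is_derive_ext_loc with (fun z => A u z); [|now apply H].
    apply filter_imp with (2 := proj2 (Hnear u v Hu Hv)). intros z Hz.
    symmetry. now apply is_derive_unique, H. }
  assert (H0 : Rabs (x - x) < d /\ Rabs (y - y) < d) by (split; now apply Rabs_self_lt).
  rewrite <- (is_derive_unique _ _ _ (Ext1 x y (proj1 H0) (proj2 H0))).
  rewrite <- (is_derive_unique _ _ _ (Ext2 x y (proj1 H0) (proj2 H0))).
  symmetry. apply Schwarz.
  - exists (mkposreal d Hd). simpl. intros u v Hu Hv. destruct (H u v Hu Hv) as (D1 & D2 & _).
    split; [now exists (A u v)|]. split; [now exists (B u v)|].
    split; [exists (Bx u v); now apply Ext1|exists (Ay u v); now apply Ext2].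
  - apply continuity_2d_pt_ext_loc with Bx; [|exact HBx].
    exists (mkposreal d Hd). simpl. intros u v Hu Hv. symmetry. now apply is_derive_unique, Ext1.
  - apply continuity_2d_pt_ext_loc with Ay; [|exact HAy].
    exists (mkposreal d Hd). simpl. intros u v Hu Hv. symmetry. now apply is_derive_unique, Ext2.
Qed.

Lemma ring_open_near (a b x y : R) : ring_open a b x y ->
  exists d, 0 < d /\ forall u v, Rabs (u - x) < d -> Rabs (v - y) < d -> ring_open a b u v.
Proof.
  intros [H1 H2].
  destruct (sum_squares_near x y (Rmin (x ^ 2 + y ^ 2 - a ^ 2) (b ^ 2 - (x ^ 2 + y ^ 2))))
    as (d & Hd & Hn); [apply Rmin_glb_lt; lra|].
  exists d. split; [exact Hd|]. intros u v Hu Hv. specialize (Hn u v Hu Hv).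
  pose proof (Rmin_l (x ^ 2 + y ^ 2 - a ^ 2) (b ^ 2 - (x ^ 2 + y ^ 2))).
  pose proof (Rmin_r (x ^ 2 + y ^ 2 - a ^ 2) (b ^ 2 - (x ^ 2 + y ^ 2))).
  apply Rabs_def2 in Hn. split; lra.
Qed.

Lemma ring_open_closed (a b x y : R) : ring_open a b x y -> ring_closed a b x y.
Proof. intros [H1 H2]. split; lra. Qed.

Lemma continuity_interior (a b : R) (f : R -> R -> R) (x y : R) :
  continuous_2d_on (ring_closed a b) f -> ring_open a b x y -> continuity_2d_pt f x y.
Proof.
  intros Hf Ho eps. destruct (Hf x y (ring_open_closed _ _ _ _ Ho) eps (cond_pos eps))
    as (d & Hd & H).
  destruct (ring_open_near a b x y Ho) as (d' & Hd' & H').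
  exists (mkposreal _ (Rmin_glb_lt _ _ _ Hd Hd')). simpl. intros u v Hu Hv.
  pose proof (Rmin_l d d'). pose proof (Rmin_r d d').
  apply H; [apply ring_open_closed, H'| |]; lra.
Qed.

Lemma annulus_ring (a b x y : R) : 0 < a < b ->
  (annulus a b (x, y) <-> ring_open a b x y) /\
  (closed_annulus a b (x, y) <-> ring_closed a b x y).
Proof.
  intros Ha. unfold annulus, closed_annulus. rewrite norm_plane. simpl fst; simpl snd.
  assert (H : sqrt (x ^ 2 + y ^ 2) ^ 2 = x ^ 2 + y ^ 2).
  { apply pow2_sqrt. pose proof (pow2_ge_0 x). pose proof (pow2_ge_0 y). lra. }
  pose proof (sqrt_pos (x ^ 2 + y ^ 2)) as Hp.
  split; split; intros Hr.
  - unfold ring_open. rewrite <- H. nra.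
  - now apply radius_interior.
  - unfold ring_closed. rewrite <- H. nra.
  - now apply radius_closed.
Qed.

Lemma Ck_continuous (a b : R) (k : nat) (f : R * R -> R) : 0 < a < b ->
  Ck (annulus a b) (closed_annulus a b) k f ->
  continuous_2d_on (ring_closed a b) (fun x y => f (x, y)).
Proof.
  intros Ha H.
  assert (Hc : continuous_on (closed_annulus a b) f) by (destruct k; apply H).
  intros x y Hr eps He.
  assert (Hk : closed_annulus a b (x, y)) by (now apply annulus_ring).
  destruct (Hc (x, y) Hk (ball (f (x, y)) eps)) as [d Hd].
  { now exists (mkposreal eps He). }
  exists d. split; [apply cond_pos|]. intros u v Huv Hu Hv.
  apply (Hd (u, v)); [split; assumption|]. now apply annulus_ring.
Qed.

(** Continuity of the first partial derivative, together with existence of the second one at the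
    point, gives joint differentiability. *)
Lemma Ck_differentiable (a b : R) (k : nat) (f : R * R -> R) : 0 < a < b ->
  Ck (annulus a b) (closed_annulus a b) (S k) f ->
  exists g1 g2 : R * R -> R,
    Ck (annulus a b) (closed_annulus a b) k g1 /\
    Ck (annulus a b) (closed_annulus a b) k g2 /\
    forall x y, ring_open a b x y ->
      differentiable_pt_lim (fun x y => f (x, y)) x y (g1 (x, y)) (g2 (x, y)).
Proof.
  intros Ha [_ (g1 & g2 & Hd & H1 & H2)]. exists g1, g2. split; [exact H1|]. split; [exact H2|].
  intros x y Ho. apply filterdiff_differentiable_pt_lim.
  pose proof (continuity_interior a b _ x y (Ck_continuous a b k g1 Ha H1) Ho) as Hc.
  apply continuity_2d_pt_filterlim in Hc.
  apply (filterdiff_ext_lin _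
    (fun u : R * R => plus (scal (fst u) (g1 (x, y))) (scal (snd u) (g2 (x, y))))); [|reflexivity].
  apply (is_derive_filterdiff (fun x y => f (x, y)) x y (fun x y => g1 (x, y))).
  - destruct (ring_open_near a b x y Ho) as (d & Hdp & Hn).
    exists (mkposreal d Hdp). intros [u v] [Hu Hv].
    apply (Hd (u, v)). now apply annulus_ring, Hn.
  - apply (Hd (x, y)). now apply annulus_ring.
  - exact Hc.
Qed.

(** A minimum over the closed ring cannot be interior, as the gradient would vanish there. If an
    interior value were at most k, the minimum, being on the boundary, would be at least k, and the
    interior point would itself be a minimum. *)
Lemma interior_above_boundary_min (a b k : R) (u u1 u2 u11 u12 u21 u22 : R -> R -> R) :
  continuous_2d_on (ring_closed a b) u ->
  (forall x y, ring_open a b x y ->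
     differentiable_pt_lim u x y (u1 x y) (u2 x y) /\
     differentiable_pt_lim u1 x y (u11 x y) (u12 x y) /\
     differentiable_pt_lim u2 x y (u21 x y) (u22 x y) /\
     0 < u1 x y ^ 2 + u2 x y ^ 2) ->
  (forall x y, x ^ 2 + y ^ 2 = a ^ 2 \/ x ^ 2 + y ^ 2 = b ^ 2 -> k <= u x y) ->
  forall x y, ring_open a b x y -> k < u x y.
Proof.
  intros Hu HD Hb.
  assert (Hno : forall x y, ring_open a b x y ->
    ~ (forall x' y', ring_closed a b x' y' -> u x y <= u x' y')).
  { intros x y Ho Hmin. destruct (HD x y Ho) as (_ & D1 & D2 & Hne).
    destruct (ring_open_near a b x y Ho) as (d & Hd & Hn).
    assert (H0 : Rabs (x - x) < d /\ Rabs (y - y) < d) by (split; now apply Rabs_self_lt).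
    apply differentiable_partials in D1, D2.
    destruct (second_derivative_at_min (fun t => u t y) (fun t => u1 t y) x (u11 x y)) as [Hz1 _].
    { apply locally_of_abs with d; [exact Hd|]. intros t Ht.
      apply (differentiable_partials u t y (u1 t y) (u2 t y)), HD, Hn; tauto. }
    { apply D1. }
    { apply locally_of_abs with d; [exact Hd|]. intros t Ht.
      apply Hmin, ring_open_closed, Hn; tauto. }
    destruct (second_derivative_at_min (fun t => u x t) (fun t => u2 x t) y (u22 x y)) as [Hz2 _].
    { apply locally_of_abs with d; [exact Hd|]. intros t Ht.
      apply (differentiable_partials u x t (u1 x t) (u2 x t)), HD, Hn; tauto. }
    { apply D2. }
    { apply locally_of_abs with d; [exact Hd|]. intros t Ht.
      apply Hmin, ring_open_closed, Hn; tauto. }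
    rewrite Hz1, Hz2 in Hne. lra. }
  intros x y Ho. apply Rnot_le_lt. intros Hle.
  destruct (compact_min _ u (compact_ring a b) Hu) as (x0 & y0 & Hc0 & Hmin).
  { exists x, y. now apply ring_open_closed. }
  destruct (classic (ring_open a b x0 y0)) as [Ho0|Hn0]; [exact (Hno x0 y0 Ho0 Hmin)|].
  apply (Hno x y Ho). intros x' y' Hc'. specialize (Hmin x' y' Hc').
  assert (Hbd : k <= u x0 y0); [|lra].
  apply Hb. destruct (Req_dec (x0 ^ 2 + y0 ^ 2) (a ^ 2)) as [|Hna]; [tauto|].
  destruct (Req_dec (x0 ^ 2 + y0 ^ 2) (b ^ 2)) as [|Hnb]; [tauto|].
  exfalso. apply Hn0. destruct Hc0. split; lra.
Qed.

Lemma bounded_on_open (a b : R) (f : R -> R -> R) :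
  continuous_2d_on (ring_closed a b) f ->
  exists B, 0 < B /\ forall x y, ring_open a b x y -> Rabs (f x y) <= B.
Proof.
  intros Hf. destruct (compact_bounded _ f (compact_ring a b) Hf) as (B & HB & H).
  exists B. split; [exact HB|]. intros x y Ho. now apply H, ring_open_closed.
Qed.

Lemma bounded_lipschitz_polar_C1 (a b : R) (f f1 f2 : R -> R -> R) : 0 < a < b ->
  continuous_2d_on (ring_closed a b) f -> continuous_2d_on (ring_closed a b) f1 ->
  continuous_2d_on (ring_closed a b) f2 ->
  (forall x y, ring_open a b x y -> differentiable_pt_lim f x y (f1 x y) (f2 x y)) ->
  bounded_lipschitz a b (polar f).
Proof.
  intros Ha Hf Hf1 Hf2 Hd.
  destruct (bounded_on_open a b f1 Hf1) as (B1 & HB1 & H1).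
  destruct (bounded_on_open a b f2 Hf2) as (B2 & HB2 & H2).
  apply (bounded_lipschitz_polar_of_gradient a b (B1 + B2) f f1 f2); auto; try lra.
  intros x y Ho. specialize (H1 x y Ho). specialize (H2 x y Ho). lra.
Qed.

(** * From the Euler equations to circular streamlines *)

Section Flow.

Variables (a b : R) (v1 v2 p1 p2 p11 p12 p21 p22 q1 q2 q11 q12 q21 q22 : R -> R -> R).
Hypothesis Ha : 0 < a < b.
Hypotheses (Hv1 : continuous_2d_on (ring_closed a b) v1)
  (Hv2 : continuous_2d_on (ring_closed a b) v2)
  (Hp1 : continuous_2d_on (ring_closed a b) p1) (Hp2 : continuous_2d_on (ring_closed a b) p2)
  (Hq1 : continuous_2d_on (ring_closed a b) q1) (Hq2 : continuous_2d_on (ring_closed a b) q2)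
  (Hp11 : continuous_2d_on (ring_closed a b) p11) (Hp12 : continuous_2d_on (ring_closed a b) p12)
  (Hp21 : continuous_2d_on (ring_closed a b) p21) (Hp22 : continuous_2d_on (ring_closed a b) p22)
  (Hq11 : continuous_2d_on (ring_closed a b) q11) (Hq12 : continuous_2d_on (ring_closed a b) q12)
  (Hq21 : continuous_2d_on (ring_closed a b) q21) (Hq22 : continuous_2d_on (ring_closed a b) q22).
Hypothesis HD : forall x y, ring_open a b x y ->
  differentiable_pt_lim v1 x y (p1 x y) (p2 x y) /\
  differentiable_pt_lim v2 x y (q1 x y) (q2 x y) /\
  differentiable_pt_lim p1 x y (p11 x y) (p12 x y) /\
  differentiable_pt_lim p2 x y (p21 x y) (p22 x y) /\
  differentiable_pt_lim q1 x y (q11 x y) (q12 x y) /\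
  differentiable_pt_lim q2 x y (q21 x y) (q22 x y).
Hypothesis Hdiv : forall x y, ring_open a b x y -> p1 x y + q2 x y = 0.
Variable p : R -> R -> R.
Hypothesis Heuler : forall x y, ring_open a b x y ->
  is_derive (fun t => p t y) x (- (v1 x y * p1 x y + v2 x y * p2 x y)) /\
  is_derive (fun t => p x t) y (- (v1 x y * q1 x y + v2 x y * q2 x y)).
Hypothesis Htan : forall x y, x ^ 2 + y ^ 2 = a ^ 2 \/ x ^ 2 + y ^ 2 = b ^ 2 ->
  x * v1 x y + y * v2 x y = 0.
Hypothesis Hnz : forall x y, ring_closed a b x y -> 0 < v1 x y ^ 2 + v2 x y ^ 2.

Lemma mixed_partials (x y : R) : ring_open a b x y -> p12 x y = p21 x y /\ q12 x y = q21 x y.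
Proof.
  intros Ho. destruct (ring_open_near a b x y Ho) as (d & Hd & Hn). split.
  - apply (schwarz_of_gradient v1 p1 p2 p12 p21 x y d Hd);
      [|now apply (continuity_interior a b)|now apply (continuity_interior a b)].
    intros u v Hu Hv. destruct (HD u v (Hn u v Hu Hv)) as (D1 & _ & D3 & D4 & _).
    apply differentiable_partials in D1, D3, D4. tauto.
  - apply (schwarz_of_gradient v2 q1 q2 q12 q21 x y d Hd);
      [|now apply (continuity_interior a b)|now apply (continuity_interior a b)].
    intros u v Hu Hv. destruct (HD u v (Hn u v Hu Hv)) as (_ & D1 & _ & _ & D3 & D4).
    apply differentiable_partials in D1, D3, D4. tauto.
Qed.

(** This is the curl of the momentum equation: the mixed derivatives of the pressure agree. The
    vorticity is q1 - p2. *)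
Lemma vorticity_transport (x y : R) : ring_open a b x y ->
  v1 x y * (q11 x y - p21 x y) + v2 x y * (q12 x y - p22 x y) = 0.
Proof.
  intros Ho. destruct (ring_open_near a b x y Ho) as (d & Hd & Hn).
  destruct (mixed_partials x y Ho) as [Hm1 Hm2].
  assert (Hs : - (p2 x y * p1 x y + v1 x y * p12 x y + (q2 x y * p2 x y + v2 x y * p22 x y)) =
    - (p1 x y * q1 x y + v1 x y * q11 x y + (q1 x y * q2 x y + v2 x y * q21 x y))).
  { apply (schwarz_of_gradient p
      (fun x y => - (v1 x y * p1 x y + v2 x y * p2 x y))
      (fun x y => - (v1 x y * q1 x y + v2 x y * q2 x y))
      (fun x y => - (p2 x y * p1 x y + v1 x y * p12 x y + (q2 x y * p2 x y + v2 x y * p22 x y)))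
      (fun x y => - (p1 x y * q1 x y + v1 x y * q11 x y + (q1 x y * q2 x y + v2 x y * q21 x y)))
      x y d Hd).
    - intros u v Hu Hv. pose proof (Hn u v Hu Hv) as Ho'.
      destruct (Heuler u v Ho') as [E1 E2].
      destruct (HD u v Ho') as (D1 & D2 & D3 & D4 & D5 & D6).
      split; [exact E1|]. split; [exact E2|]. split.
      + pose proof (differentiable_scal (-1) _ _ _ _ _ (differentiable_plus _ _ _ _ _ _ _ _
          (differentiable_mult _ _ _ _ _ _ _ _ D1 D3) (differentiable_mult _ _ _ _ _ _ _ _ D2 D4))) as D.
        apply differentiable_partials in D. destruct D as [_ D].
        eapply is_derive_ext; [|evar_last; [exact D|ring]]. intros t. simpl. ring.
      + pose proof (differentiable_scal (-1) _ _ _ _ _ (differentiable_plus _ _ _ _ _ _ _ _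
          (differentiable_mult _ _ _ _ _ _ _ _ D1 D5) (differentiable_mult _ _ _ _ _ _ _ _ D2 D6))) as D.
        apply differentiable_partials in D. destruct D as [D _].
        eapply is_derive_ext; [|evar_last; [exact D|ring]]. intros t. simpl. ring.
    - apply continuity_2d_pt_opp.
      repeat first [apply continuity_2d_pt_plus|apply continuity_2d_pt_mult];
        now apply (continuity_interior a b).
    - apply continuity_2d_pt_opp.
      repeat first [apply continuity_2d_pt_plus|apply continuity_2d_pt_mult];
        now apply (continuity_interior a b). }
  (* The products of first derivatives add up to p2 and q1 times the divergence, hence vanish. *)
  pose proof (Hdiv x y Ho) as Hd0. rewrite Hm1 in Hs. rewrite <- Hm2 in Hs.
  assert (H1 : p2 x y * (p1 x y + q2 x y) = 0) by (rewrite Hd0; ring).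
  assert (H2 : q1 x y * (p1 x y + q2 x y) = 0) by (rewrite Hd0; ring).
  lra.
Qed.

Lemma flow_circular (x y : R) : ring_open a b x y -> x * v1 x y + y * v2 x y = 0.
Proof.
  destruct (bounded_on_open a b p2 Hp2) as (B1 & HB1 & Hb1).
  destruct (bounded_on_open a b q1 Hq1) as (B2 & HB2 & Hb2).
  destruct (bounded_on_open a b q2 Hq2) as (B3 & HB3 & Hb3).
  set (u1 := v2). set (u2 := fun x y => -1 * v1 x y).
  set (u22 := fun x y => -1 * p2 x y).
  (* Incompressibility is the closedness of (v2, - v1): the x-derivative of - v1 is - p1 = q2, the
     y-derivative of v2. *)
  assert (Dopp : forall x y, ring_open a b x y ->
    differentiable_pt_lim u2 x y (q2 x y) (u22 x y)).
  { intros x0 y0 Ho. apply differentiable_eq with (-1 * p1 x0 y0) (-1 * p2 x0 y0); [| |reflexivity].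
    - apply (differentiable_scal (-1) v1), HD, Ho.
    - pose proof (Hdiv x0 y0 Ho). lra. }
  assert (Hu2 : continuous_2d_on (ring_closed a b) u2) by now apply continuous_2d_on_scal.
  assert (Hu22 : continuous_2d_on (ring_closed a b) u22) by now apply continuous_2d_on_scal.
  assert (Htan' : forall x y, x ^ 2 + y ^ 2 = a ^ 2 \/ x ^ 2 + y ^ 2 = b ^ 2 ->
    x * u2 x y - y * u1 x y = 0).
  { intros x0 y0 H. pose proof (Htan x0 y0 H). unfold u1, u2. lra. }
  assert (Dw : forall x y, ring_open a b x y ->
    differentiable_pt_lim (fun x y => q1 x y + u22 x y) x y
      (q11 x y + -1 * p21 x y) (q12 x y + -1 * p22 x y)).
  { intros x0 y0 Ho. apply (differentiable_plus q1 u22); [now apply HD|].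
    apply (differentiable_scal (-1) p2). now apply HD. }
  destruct (potential_exists a b (B1 + B2 + B3) u1 u2 q1 q2 u22) as (c & u & Hu & Du & Hin & Hout);
    try lra; auto.
  { intros x0 y0 Ho. now apply HD. }
  { intros x0 y0 Ho. specialize (Hb1 x0 y0 Ho). specialize (Hb2 x0 y0 Ho). specialize (Hb3 x0 y0 Ho).
    unfold u22. rewrite Rabs_mult, Rabs_m1. lra. }
  { apply (bounded_lipschitz_polar_C1 a b q1 q11 q12); auto. intros x0 y0 Ho. now apply HD. }
  { apply (bounded_lipschitz_polar_C1 a b q2 q21 q22); auto. intros x0 y0 Ho. now apply HD. }
  { apply (bounded_lipschitz_polar_C1 a b u22 (fun x y => -1 * p21 x y) (fun x y => -1 * p22 x y));
      auto using continuous_2d_on_scal.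
    intros x0 y0 Ho. apply (differentiable_scal (-1) p2). now apply HD. }
  assert (Hsq : forall f, continuous_2d_on (ring_closed a b) f ->
    continuous_2d_on (ring_closed a b) (fun x y => f x y ^ 2)).
  { intros f Hf. apply (continuous_2d_on_comp _ (fun t => t ^ 2)); [|exact Hf].
    intros t. apply derivable_continuous_pt, derivable_pt_pow. }
  (* The uniform lower bound m for the squared gradient is the attained minimum of the squared
     speed. *)
  destruct (compact_min _ (fun x y => v1 x y ^ 2 + v2 x y ^ 2) (compact_ring a b))
    as (xm & ym & Hm1 & Hm2).
  { apply (continuous_2d_on_plus _ (fun x y => v1 x y ^ 2) (fun x y => v2 x y ^ 2)); auto. }
  { exists a, 0. split; nra. }
  set (m := v1 xm ym ^ 2 + v2 xm ym ^ 2) in *.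
  assert (Hm : 0 < m) by now apply Hnz.
  assert (Hgrad : forall x y, u1 x y ^ 2 + u2 x y ^ 2 = v1 x y ^ 2 + v2 x y ^ 2).
  { intros. unfold u1, u2. ring. }
  assert (Habove : forall x y, ring_open a b x y -> Rmin 0 c < u x y).
  { apply (interior_above_boundary_min a b _ u u1 u2 q1 q2 q2 u22); auto.
    - intros x0 y0 Ho. split; [now apply Du|]. split; [now apply HD|]. split; [now apply Dopp|].
      rewrite Hgrad. now apply Hnz, ring_open_closed.
    - intros x0 y0 [H|H]; [rewrite (Hin _ _ H); apply Rmin_l|rewrite (Hout _ _ H); apply Rmin_r]. }
  assert (Hbelow : forall x y, ring_open a b x y -> u x y < Rmax 0 c).
  { intros x0 y0 Ho0. assert (- Rmax 0 c < -1 * u x0 y0); [|lra]. revert x0 y0 Ho0.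
    apply (interior_above_boundary_min a b _ (fun x y => -1 * u x y) (fun x y => -1 * u1 x y)
      (fun x y => -1 * u2 x y) (fun x y => -1 * q1 x y) (fun x y => -1 * q2 x y)
      (fun x y => -1 * q2 x y) (fun x y => -1 * u22 x y)); auto using continuous_2d_on_scal.
    - intros x0 y0 Ho. split; [now apply (differentiable_scal (-1) u), Du|].
      split; [now apply (differentiable_scal (-1) u1), HD|].
      split; [now apply (differentiable_scal (-1) u2), Dopp|].
      replace ((-1 * u1 x0 y0) ^ 2 + (-1 * u2 x0 y0) ^ 2) with (u1 x0 y0 ^ 2 + u2 x0 y0 ^ 2) by ring.
      rewrite Hgrad. now apply Hnz, ring_open_closed.
    - intros x0 y0 [H|H]; [rewrite (Hin _ _ H)|rewrite (Hout _ _ H)];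
        [pose proof (Rmax_l 0 c)|pose proof (Rmax_r 0 c)]; lra. }
  destruct (bounded_on_open a b p21 Hp21) as (C1 & HC1 & Hc1).
  destruct (bounded_on_open a b p22 Hp22) as (C2 & HC2 & Hc2).
  destruct (bounded_on_open a b q11 Hq11) as (C3 & HC3 & Hc3).
  destruct (bounded_on_open a b q12 Hq12) as (C4 & HC4 & Hc4).
  set (M := B1 + B2 + B3 + C1 + C2 + C3 + C4).
  assert (HM : forall x y, ring_open a b x y ->
    Rabs (q1 x y) <= M /\ Rabs (q2 x y) <= M /\ Rabs (q2 x y) <= M /\ Rabs (u22 x y) <= M /\
    Rabs (q11 x y + -1 * p21 x y) <= M /\ Rabs (q12 x y + -1 * p22 x y) <= M).
  { intros x0 y0 Ho.
    specialize (Hb1 x0 y0 Ho). specialize (Hb2 x0 y0 Ho). specialize (Hb3 x0 y0 Ho).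
    specialize (Hc1 x0 y0 Ho). specialize (Hc2 x0 y0 Ho). specialize (Hc3 x0 y0 Ho).
    specialize (Hc4 x0 y0 Ho). unfold u22, M.
    pose proof (Rabs_triang (q11 x0 y0) (-1 * p21 x0 y0)) as T1.
    pose proof (Rabs_triang (q12 x0 y0) (-1 * p22 x0 y0)) as T2.
    rewrite Rabs_mult, Rabs_m1 in T1, T2. rewrite Rabs_mult, Rabs_m1. lra. }
  intros Ho.
  assert (Hconcl : x * u2 x y - y * u1 x y = 0); [|unfold u1, u2 in *; lra].
  (* With c = 0, an interior value of u would lie strictly between 0 and 0. *)
  assert (Hc : c <> 0).
  { intros ->. pose proof (Habove x y Ho) as H1. pose proof (Hbelow x y Ho) as H2.
    rewrite Rmin_left in H1 by lra. rewrite Rmax_left in H2 by lra. lra. }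
  destruct (Rdichotomy _ _ Hc) as [Hneg|Hpos].
  (* If u decreases outwards, everything is applied to - u, whose outer value is - c > 0. *)
  - assert (H : x * (-1 * u2 x y) - y * (-1 * u1 x y) = 0); [|lra].
    apply (radial_symmetry a b (- c) M m (fun x y => -1 * u x y) (fun x y => -1 * u1 x y)
      (fun x y => -1 * u2 x y) (fun x y => -1 * q1 x y) (fun x y => -1 * q2 x y)
      (fun x y => -1 * q2 x y) (fun x y => -1 * u22 x y)
      (fun x y => -1 * (q11 x y + -1 * p21 x y)) (fun x y => -1 * (q12 x y + -1 * p22 x y)));
      auto using continuous_2d_on_scal; try lra.
    + intros x0 y0 H0. split; [now apply (differentiable_scal (-1) u), Du|].
      split; [now apply (differentiable_scal (-1) u1), HD|].
      split; [now apply (differentiable_scal (-1) u2), Dopp|].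
      apply differentiable_pt_lim_ext with (fun x y => -1 * (q1 x y + u22 x y)).
      * exists (mkposreal 1 Rlt_0_1). intros; ring.
      * now apply (differentiable_scal (-1) (fun x y => q1 x y + u22 x y)), Dw.
    + intros x0 y0 H0. rewrite !(Rabs_mult (-1)), !Rabs_m1, !Rmult_1_l.
      now apply HM.
    + intros x0 y0 H0. pose proof (vorticity_transport x0 y0 H0).
      unfold u1, u2. lra.
    + intros x0 y0 H0. rewrite (Hin _ _ H0). ring.
    + intros x0 y0 H0. rewrite (Hout _ _ H0). ring.
    + intros x0 y0 H0. pose proof (Habove x0 y0 H0) as H1. pose proof (Hbelow x0 y0 H0) as H2.
      rewrite Rmin_right in H1 by lra. rewrite Rmax_left in H2 by lra. lra.
    + intros x0 y0 H0. pose proof (Htan' x0 y0 H0). lra.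
    + intros x0 y0 H0.
      replace ((-1 * u1 x0 y0) ^ 2 + (-1 * u2 x0 y0) ^ 2) with (u1 x0 y0 ^ 2 + u2 x0 y0 ^ 2) by ring.
      rewrite Hgrad. now apply Hm2.
  - apply (radial_symmetry a b c M m u u1 u2 q1 q2 q2 u22
      (fun x y => q11 x y + -1 * p21 x y) (fun x y => q12 x y + -1 * p22 x y)); auto; try lra.
    + intros x0 y0 H0. split; [now apply Du|]. split; [now apply HD|].
      split; [now apply Dopp|now apply Dw].
    + intros x0 y0 H0. pose proof (vorticity_transport x0 y0 H0). unfold u1, u2. lra.
    + intros x0 y0 H0. pose proof (Habove x0 y0 H0) as H1. pose proof (Hbelow x0 y0 H0) as H2.
      rewrite Rmin_left in H1 by lra. rewrite Rmax_right in H2 by lra. lra.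
    + intros x0 y0 H0. rewrite Hgrad. now apply Hm2.
Qed.

Lemma flow_circular_closed (x y : R) : ring_closed a b x y -> x * v1 x y + y * v2 x y = 0.
Proof.
  intros [H1 H2].
  destruct (Req_dec (x ^ 2 + y ^ 2) (a ^ 2)) as [|Hna]; [apply Htan; tauto|].
  destruct (Req_dec (x ^ 2 + y ^ 2) (b ^ 2)) as [|Hnb]; [apply Htan; tauto|].
  apply flow_circular. split; lra.
Qed.

(* In polar coordinates [div v = 0] reads [d_theta v_theta = - d_r (r v_r)], and [v_r = 0]. *)
Lemma angular_velocity_radial (r t : R) : a <= r <= b ->
  cos t * polar v2 r t + - sin t * polar v1 r t = v2 r 0.
Proof.
  intros Hr.
  set (g := fun r t => cos t * polar v2 r t + - sin t * polar v1 r t).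
  assert (Hg0 : forall r, g r 0 = v2 r 0).
  { intros s. unfold g, polar. rewrite cos_0, sin_0, Ropp_0, Rmult_1_r, Rmult_0_r. ring. }
  assert (Hint : forall r t, a < r < b -> g r t = g r 0).
  { clear r t Hr. intros r t Hr.
    assert (Hder : forall s, is_derive (fun s => g r s) s 0).
    { intros s. pose proof (polar_ring_open a b r s (proj1 Ha) Hr) as Ho.
      destruct (HD _ _ Ho) as (D1 & D2 & _).
      apply differentiable_polar, differentiable_partials in D1, D2.
      fold (polar p1 r s) in D1. fold (polar p2 r s) in D1.
      fold (polar q1 r s) in D2. fold (polar q2 r s) in D2.
      destruct D1 as [D1r D1t]. destruct D2 as [D2r D2t].
      assert (Hrad : is_derive (fun z => z * (cos s * polar v1 z s + sin s * polar v2 z s)) r 0).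
      (* The function differentiated is r v_r, which vanishes at all nearby radii because the flow
         is circular. *)
      { apply is_derive_ext_loc with (fun _ => 0); [|apply (is_derive_const 0)].
        apply locally_of_abs with (Rmin (r - a) (b - r)); [apply Rmin_glb_lt; lra|].
        intros z Hz. pose proof (Rmin_l (r - a) (b - r)). pose proof (Rmin_r (r - a) (b - r)).
        apply Rabs_def2 in Hz.
        pose proof (flow_circular _ _ (polar_ring_open a b z s (proj1 Ha) ltac:(lra))) as Hz0.
        symmetry. refine (eq_trans _ Hz0). unfold polar. ring. }
      assert (Hrad2 : is_derive (fun z => z * (cos s * polar v1 z s + sin s * polar v2 z s)) r
        ((cos s * polar v1 r s + sin s * polar v2 r s) +
          r * (cos s * (polar p1 r s * cos s + polar p2 r s * sin s) +
               sin s * (polar q1 r s * cos s + polar q2 r s * sin s)))).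
      { evar_last.
        - apply (is_derive_mult (fun z => z)
            (fun z => cos s * polar v1 z s + sin s * polar v2 z s)); [| |exact Rmult_comm].
          + auto_derive; trivial.
          + apply (is_derive_plus (fun z => cos s * polar v1 z s) (fun z => sin s * polar v2 z s)).
            * apply (is_derive_scal (fun z => polar v1 z s)). exact D1r.
            * apply (is_derive_scal (fun z => polar v2 z s)). exact D2r.
        - unfold plus, mult; simpl. ring. }
      apply is_derive_unique in Hrad, Hrad2. rewrite Hrad in Hrad2.
      unfold g. evar_last.
      - apply (is_derive_plus (fun s => cos s * polar v2 r s) (fun s => - sin s * polar v1 r s)).
        + apply (is_derive_mult cos (fun s => polar v2 r s)); [|exact D2t|exact Rmult_comm].
          auto_derive; [trivial|reflexivity].
        + apply (is_derive_mult (fun s => - sin s) (fun s => polar v1 r s));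
            [|exact D1t|exact Rmult_comm].
          auto_derive; [trivial|reflexivity].
      - unfold plus, mult; simpl. pose proof (Hdiv _ _ Ho) as Hdv.
        fold (polar p1 r s) in Hdv. fold (polar q2 r s) in Hdv.
        pose proof (sin2_cos2 s) as Hsc. unfold Rsqr in Hsc.
        (* The right-hand side is r div v minus the radial derivative of r v_r. *)
        transitivity (r * ((sin s * sin s + cos s * cos s) * (polar p1 r s + polar q2 r s))
          - ((cos s * polar v1 r s + sin s * polar v2 r s) +
            r * (cos s * (polar p1 r s * cos s + polar p2 r s * sin s) +
               sin s * (polar q1 r s * cos s + polar q2 r s * sin s)))); [ring|].
        rewrite <- Hrad2, Hdv. ring. }
    assert (H : Rabs (g r t - g r 0) <= 0 * Rabs (t - 0)).
    { apply (lipschitz_of_derive (fun s => g r s) (fun _ => 0)). intros s _.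
      split; [apply Hder|rewrite Rabs_R0; lra]. }
    pose proof (Rabs_pos (g r t - g r 0)).
    apply Rminus_diag_uniq, NNPP. intros Hn. apply Rabs_pos_lt in Hn. lra. }
  assert (Hcont : radially_continuous a b g).
  { apply radially_continuous_plus; apply (radially_continuous_scal a b);
      apply radially_continuous_polar; tauto. }
  (* The difference vanishes at interior radii, and radial continuity carries this to r = a and r =
     b. *)
  assert (Hz : radially_continuous a b (fun r t => g r t + -1 * g r 0)).
  { apply radially_continuous_plus; [exact Hcont|].
    apply (radially_continuous_scal a b (fun _ => -1) (fun r _ => g r 0)).
    intros s _ Hs. now apply Hcont. }
  rewrite <- Hg0. fold (g r t). apply Rminus_diag_uniq, NNPP. intros Hn.
  apply Rabs_pos_lt in Hn.
  destruct (radial_approximation a b _ r t _ (proj2 Ha) Hz Hr Hn) as (r' & Hr' & _ & Hd).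
  cbv beta in Hd. rewrite (Hint r' t Hr') in Hd.
  replace (g r' 0 + -1 * g r' 0 - (g r t + -1 * g r 0)) with (- (g r t - g r 0)) in Hd by ring.
  rewrite Rabs_Ropp in Hd. lra.
Qed.

End Flow.

(** On the positive first axis the norm is the first coordinate, and differentiating the restriction
    is restricting the first partial derivative. *)
Lemma Ck_segment_of_Ck (a b : R) (k : nat) : 0 < a < b -> forall f : R * R -> R,
  Ck (annulus a b) (closed_annulus a b) k f -> Ck_segment a b k (fun r => f (r, 0)).
Proof.
  intros Ha.
  assert (Hn : forall r, 0 <= r -> norm ((r, 0) : R * R) = r).
  { intros r Hr. rewrite norm_plane. simpl fst; simpl snd.
    replace (r ^ 2 + 0 ^ 2) with (r ^ 2) by ring. now apply sqrt_pow2. }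
  assert (Hcont : forall f : R * R -> R, continuous_on (closed_annulus a b) f ->
    continuous_on (fun r => a <= r <= b) (fun r => f (r, 0))).
  { intros f Hf r Hr.
    apply (filterlim_comp _ _ _ (fun r : R => (r, 0)) f _
      (within (closed_annulus a b) (locally (r, 0)))).
    - intros S [d Hd]. exists d. intros s Hs Hsr. apply Hd.
      + split; [exact Hs|apply ball_center].
      + unfold closed_annulus. rewrite Hn; lra.
    - apply Hf. unfold closed_annulus. rewrite Hn; lra. }
  induction k as [|k IH]; intros f Hf; simpl.
  - now apply Hcont.
  - destruct Hf as [Hf (g1 & g2 & Hd & H1 & H2)]. split; [now apply Hcont|].
    exists (fun r => g1 (r, 0)). split; [|now apply IH].
    intros r Hr. apply (Hd (r, 0)). unfold annulus. rewrite Hn; lra.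
Qed.

(** By the intermediate value theorem the sign at a persists; [clamp] supplies the continuity on the
    whole line that [IVT_gen] expects. *)
Lemma nonvanishing_sign (a b : R) (f : R -> R) : a < b ->
  continuous_on (fun r => a <= r <= b) f -> (forall r, a <= r <= b -> f r <> 0) ->
  (forall r, a <= r <= b -> 0 < f r) \/ (forall r, a <= r <= b -> f r < 0).
Proof.
  intros Hab Hf Hnz.
  assert (Hc : continuity (fun r => f (clamp a b r))).
  { intros r eps He.
    destruct (Hf (clamp a b r) (clamp_in a b r ltac:(lra)) (ball (f (clamp a b r)) eps)) as [d Hd].
    { now exists (mkposreal eps He). }
    exists d. split; [apply cond_pos|]. intros s [_ Hs]. simpl in *. unfold Rdist in *.
    apply Hd; [|apply clamp_in; lra].
    apply Rle_lt_trans with (2 := Hs), clamp_lipschitz. }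
  assert (Hsame : forall r, a <= r <= b -> 0 < f a * f r).
  { intros r Hr. apply Rnot_le_lt. intros Hle.
    pose proof (Hnz a ltac:(lra)) as Ha0. pose proof (Hnz r Hr) as Hr0.
    destruct (IVT_gen (fun r => f (clamp a b r)) a r 0 Hc) as (s & _ & Hs).
    - rewrite !clamp_id by lra. unfold Rmin, Rmax. destruct (Rle_dec _ _); nra.
    - exact (Hnz _ (clamp_in a b s ltac:(lra)) Hs). }
  destruct (Rdichotomy _ _ (Hnz a ltac:(lra))) as [H|H]; [right|left];
    intros r Hr; specialize (Hsame r Hr); nra.
Qed.

Theorem theorem1p1 :
  forall (a b : R) (v : R * R -> R * R),
    0 < a -> a < b ->
    Ck_vec (annulus a b) (closed_annulus a b) 2 v ->
    (exists p : R * R -> R, steady_euler (annulus a b) v p) ->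
    (forall x : R * R, circle a x -> dot (v x) (e_r x) = 0) ->
    (forall x : R * R, circle b x -> dot (v x) (e_r x) = 0) ->
    (forall x : R * R, closed_annulus a b x -> 0 < norm (v x)) ->
    circular (annulus a b) v /\
    exists V : R -> R,
      Ck_segment a b 2 V /\
      ((forall r : R, a <= r <= b -> 0 < V r) \/
       (forall r : R, a <= r <= b -> V r < 0)) /\
      (forall x : R * R, closed_annulus a b x ->
         v x = scal (V (norm x)) (e_theta x)).
Proof.
  intros a b v Ha0 Hab [HC1 HC2] (p & (_ & Hp & Heuler)) Hca Hcb Hnz.
  assert (Ha : 0 < a < b) by lra.
  destruct (Ck_differentiable a b 1 _ Ha HC1) as (p1 & p2 & Cp1 & Cp2 & Dv1).
  destruct (Ck_differentiable a b 1 _ Ha HC2) as (q1 & q2 & Cq1 & Cq2 & Dv2).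
  destruct (Ck_differentiable a b 0 _ Ha Cp1) as (p11 & p12 & Cp11 & Cp12 & Dp1).
  destruct (Ck_differentiable a b 0 _ Ha Cp2) as (p21 & p22 & Cp21 & Cp22 & Dp2).
  destruct (Ck_differentiable a b 0 _ Ha Cq1) as (q11 & q12 & Cq11 & Cq12 & Dq1).
  destruct (Ck_differentiable a b 0 _ Ha Cq2) as (q21 & q22 & Cq21 & Cq22 & Dq2).
  destruct Hp as [_ (g1 & g2 & Hg & _)].
  set (v1 := fun x y => fst (v (x, y))). set (v2 := fun x y => snd (v (x, y))).
  assert (HE : forall x y, ring_open a b x y ->
    v1 x y * p1 (x, y) + v2 x y * p2 (x, y) + g1 (x, y) = 0 /\
    v1 x y * q1 (x, y) + v2 x y * q2 (x, y) + g2 (x, y) = 0 /\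
    p1 (x, y) + q2 (x, y) = 0).
  { intros x y Ho.
    assert (Hx : annulus a b (x, y)) by now apply annulus_ring.
    destruct (Heuler _ Hx) as [H1 H2]. destruct (Hg _ Hx) as [G1 G2].
    destruct (differentiable_partials _ _ _ _ _ (Dv1 x y Ho)) as [D1 D2].
    destruct (differentiable_partials _ _ _ _ _ (Dv2 x y Ho)) as [E1 E2].
    apply is_derive_unique in D1, D2, E1, E2, G1, G2.
    change (Defs.d1 (fun y => fst (v y)) (x, y) = p1 (x, y)) in D1.
    change (Defs.d2 (fun y => fst (v y)) (x, y) = p2 (x, y)) in D2.
    change (Defs.d1 (fun y => snd (v y)) (x, y) = q1 (x, y)) in E1.
    change (Defs.d2 (fun y => snd (v y)) (x, y) = q2 (x, y)) in E2.
    change (Defs.d1 p (x, y) = g1 (x, y)) in G1.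
    change (Defs.d2 p (x, y) = g2 (x, y)) in G2.
    unfold convection, grad, div, dot in H1, H2. simpl in H1, H2.
    rewrite D1, D2, E1, E2, G1, G2 in H1. rewrite D1, E2 in H2.
    apply (f_equal fst) in H1 as H3. apply (f_equal snd) in H1 as H4.
    simpl in H3, H4. unfold plus, zero in H3, H4. simpl in H3, H4. tauto. }
  assert (Hnorm : forall x y, norm ((x, y) : R * R) = sqrt (x ^ 2 + y ^ 2)).
  { intros x y. now rewrite norm_plane. }
  assert (Hdot : forall x y, 0 < sqrt (x ^ 2 + y ^ 2) ->
    (dot (v (x, y)) (e_r (x, y)) = 0 <-> x * v1 x y + y * v2 x y = 0)).
  { intros x y Hr. unfold dot, e_r. simpl fst; simpl snd. rewrite Hnorm.
    fold (v1 x y). fold (v2 x y). split; intros H.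
    - replace (x * v1 x y + y * v2 x y) with
        (sqrt (x ^ 2 + y ^ 2) * (v1 x y * (x / sqrt (x ^ 2 + y ^ 2)) + v2 x y * (y / sqrt (x ^ 2 + y ^ 2))))
        by (field; lra). rewrite H. ring.
    - replace (v1 x y * (x / sqrt (x ^ 2 + y ^ 2)) + v2 x y * (y / sqrt (x ^ 2 + y ^ 2))) with
        ((x * v1 x y + y * v2 x y) / sqrt (x ^ 2 + y ^ 2)) by (field; lra).
      rewrite H. field. lra. }
  assert (Htan : forall x y, x ^ 2 + y ^ 2 = a ^ 2 \/ x ^ 2 + y ^ 2 = b ^ 2 ->
    x * v1 x y + y * v2 x y = 0).
  { intros x y [H|H]; apply Hdot; try (rewrite H, sqrt_pow2; lra);
      [apply Hca|apply Hcb]; unfold circle; rewrite Hnorm, H; apply sqrt_pow2; lra. }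
  assert (Hpos : forall x y, ring_closed a b x y -> 0 < v1 x y ^ 2 + v2 x y ^ 2).
  { intros x y Hr. assert (Hx : closed_annulus a b (x, y)) by now apply annulus_ring.
    specialize (Hnz _ Hx). rewrite norm_plane in Hnz. fold (v1 x y) in Hnz. fold (v2 x y) in Hnz.
    apply Rnot_le_lt. intros Hle. rewrite sqrt_neg_0 in Hnz by exact Hle. lra. }
  pose (cur := fun (f : R * R -> R) x y => f (x, y)).
  assert (Hcont : forall k f, Ck (annulus a b) (closed_annulus a b) k f ->
    continuous_2d_on (ring_closed a b) (cur f)).
  { intros k f. now apply Ck_continuous. }
  assert (Kv1 : continuous_2d_on (ring_closed a b) v1) by exact (Hcont _ _ HC1).
  assert (Kv2 : continuous_2d_on (ring_closed a b) v2) by exact (Hcont _ _ HC2).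
  assert (HD : forall x y, ring_open a b x y ->
    differentiable_pt_lim v1 x y (cur p1 x y) (cur p2 x y) /\
    differentiable_pt_lim v2 x y (cur q1 x y) (cur q2 x y) /\
    differentiable_pt_lim (cur p1) x y (cur p11 x y) (cur p12 x y) /\
    differentiable_pt_lim (cur p2) x y (cur p21 x y) (cur p22 x y) /\
    differentiable_pt_lim (cur q1) x y (cur q11 x y) (cur q12 x y) /\
    differentiable_pt_lim (cur q2) x y (cur q21 x y) (cur q22 x y)).
  { intros x y Ho. repeat split; auto. }
  assert (HP : forall x y, ring_open a b x y ->
    is_derive (fun t => cur p t y) x (- (v1 x y * cur p1 x y + v2 x y * cur p2 x y)) /\
    is_derive (fun t => cur p x t) y (- (v1 x y * cur q1 x y + v2 x y * cur q2 x y))).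
  { intros x y Ho. destruct (HE x y Ho) as (H1 & H2 & _).
    assert (Hx : annulus a b (x, y)) by now apply annulus_ring.
    destruct (Hg _ Hx) as [G1 G2]. unfold cur.
    replace (- (v1 x y * p1 (x, y) + v2 x y * p2 (x, y))) with (g1 (x, y)) by lra.
    replace (- (v1 x y * q1 (x, y) + v2 x y * q2 (x, y))) with (g2 (x, y)) by lra.
    now split. }
  assert (Hdiv : forall x y, ring_open a b x y -> cur p1 x y + cur q2 x y = 0).
  { intros x y Ho. apply HE, Ho. }
  assert (Hcirc : forall x y, ring_closed a b x y -> x * v1 x y + y * v2 x y = 0).
  { apply (flow_circular_closed a b v1 v2 (cur p1) (cur p2) (cur p11) (cur p12) (cur p21) (cur p22)
      (cur q1) (cur q2) (cur q11) (cur q12) (cur q21) (cur q22) Ha) with (p := cur p);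
      try assumption; first [apply (Hcont 1%nat); assumption|apply (Hcont 0%nat); assumption]. }
  assert (Hrad : forall r t, a <= r <= b ->
    cos t * polar v2 r t + - sin t * polar v1 r t = v2 r 0).
  { apply (angular_velocity_radial a b v1 v2 (cur p1) (cur p2) (cur p11) (cur p12) (cur p21) (cur p22)
      (cur q1) (cur q2) (cur q11) (cur q12) (cur q21) (cur q22) Ha) with (p := cur p);
      try assumption; first [apply (Hcont 1%nat); assumption|apply (Hcont 0%nat); assumption]. }
  split.
  { intros [x y] Hx. apply annulus_ring in Hx; [|exact Ha].
    pose proof (radius_interior a b x y Ha Hx).
    apply Hdot; [lra|]. now apply Hcirc, ring_open_closed. }
  (* On the positive first axis [e_theta] is (0, 1), so the profile has to be the second component
     of v there. *)
  exists (fun r => v2 r 0).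
  assert (HV : Ck_segment a b 2 (fun r => v2 r 0)).
  { apply (Ck_segment_of_Ck a b 2 Ha (fun x => snd (v x))). exact HC2. }
  split; [exact HV|]. split.
  - apply nonvanishing_sign; [exact Hab|apply HV|]. intros r Hr Hz.
    assert (Hr' : ring_closed a b r 0).
    { unfold ring_closed. replace (r ^ 2 + 0 ^ 2) with (r ^ 2) by ring.
      split; apply pow_incr; lra. }
    pose proof (Hcirc r 0 Hr') as H0. pose proof (Hpos r 0 Hr') as H1.
    rewrite Rmult_0_l, Rplus_0_r in H0. apply Rmult_integral in H0.
    destruct H0 as [H0|H0]; [lra|]. rewrite H0, Hz in H1. lra.
  - intros [x y] Hx. apply annulus_ring in Hx; [|exact Ha].
    pose proof (radius_closed a b x y Ha Hx) as Hr.
    destruct (polar_form x y) as (t & Hxt & Hyt).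
    pose proof (Hcirc x y Hx) as H0. pose proof (Hrad _ t Hr) as H1.
    unfold polar in H1. rewrite <- Hxt, <- Hyt in H1.
    unfold e_theta. rewrite Hnorm. simpl fst; simpl snd.
    set (r := sqrt (x ^ 2 + y ^ 2)) in *.
    (* The radial component of v, after division by r > 0. *)
    assert (H2 : cos t * v1 x y + sin t * v2 x y = 0).
    { rewrite Hxt, Hyt in H0 at 1.
      apply Rmult_eq_reg_l with r; [|lra]. rewrite Rmult_0_r, <- H0.
      rewrite <- Hxt, <- Hyt. rewrite Hxt at 3. rewrite Hyt at 4. ring. }
    pose proof (sin2_cos2 t) as Hsc. unfold Rsqr in Hsc.
    rewrite (surjective_pairing (v (x, y))).
    change (fst (v (x, y))) with (v1 x y). change (snd (v (x, y))) with (v2 x y).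
    rewrite <- H1.
    replace (- y / r) with (- sin t) by (rewrite Hyt; field; lra).
    replace (x / r) with (cos t) by (rewrite Hxt; field; lra).
    unfold scal; simpl. unfold prod_scal, scal; simpl. unfold mult; simpl.
    f_equal.
    (* v is expanded in the orthonormal frame (cos t, sin t), (- sin t, cos t), where its first
       coefficient is zero. *)
    + transitivity ((sin t * sin t + cos t * cos t) * v1 x y
        - cos t * (cos t * v1 x y + sin t * v2 x y)); [rewrite Hsc, H2|]; ring.
    + transitivity ((sin t * sin t + cos t * cos t) * v2 x y
        - sin t * (cos t * v1 x y + sin t * v2 x y)); [rewrite Hsc, H2|]; ring.
Qed.
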